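(* Let $\mu$ and $\omega$ be radial weights, with $\mu\in\mathcal{D}$. Then $C_{\omega}:A^{2}_{\mu}\to A^{2}_{\mu}$ is bounded if and only if $\omega\in\mathcal{D}$.
   Context: $\mathbb{D}=\{z\in\mathbb{C}:|z|<1\}$ is the unit disc, $\mathcal{H}(\mathbb{D})$ is the space of analytic functions in $\mathbb{D}$, and $dA(z)=\frac{dx\,dy}{\pi}$ is the normalized area measure on $\mathbb{D}$. A radial weight is a nonnegative function $\omega\in L^1([0,1))$, extended to $\mathbb{D}$ by $\omega(z)=\omega(|z|)$, with the standing assumption that $\widehat{\omega}(z)=\int_{|z|}^1\omega(s)\,ds>0$ for all $z\in\mathbb{D}$. For a radial weight $\omega$, the weighted Bergman space $A^2_\omega$ is the Hilbert space of $f\in\mathcal{H}(\mathbb{D})$ with $\|f\|_{A^2_\omega}^2=\int_{\mathbb{D}}|f(z)|^2\omega(z)\,dA(z)<\infty$. Its Bergman reproducing kernels are the functions $B^\omega_z\in A^2_\omega$, $z\in\mathbb{D}$, such that $f(z)=\int_{\mathbb{D}}f(\zeta)\overline{B^\omega_z(\zeta)}\,\omega(\zeta)\,dA(\zeta)$ for all $f\in A^2_\omega$. The generalized Cesàro operator is defined for every $f\in\mathcal{H}(\mathbb{D})$ by $$C_{\omega}(f)(z)=\int_0^1 f(tz)\left(\frac{1}{z}\int_0^z B^{\omega}_t(\zeta)\,d\zeta\right)\omega(t)\,dt,\qquad z\in\mathbb{D}$$ (with the inner expression understood as its limit $B^\omega_t(0)$ at $z=0$). A radial weight $\omega$ belongs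 to $\widehat{\mathcal{D}}$ if there exists $C=C(\omega)>1$ such that $\widehat{\omega}(r)\le C\,\widehat{\omega}\left(\frac{1+r}{2}\right)$ for all $0\le r<1$. It belongs to $\check{\mathcal{D}}$ if there exist $K=K(\omega)>1$ and $C=C(\omega)>1$ such that $\widehat{\omega}(r)\ge C\,\widehat{\omega}\left(1-\frac{1-r}{K}\right)$ for all $0\le r<1$. The class $\mathcal{D}$ is $\mathcal{D}=\widehat{\mathcal{D}}\cap\check{\mathcal{D}}$. *)

(* Defs.v *)
From HB Require Import structures.
From mathcomp Require Import all_boot all_order all_algebra.
From mathcomp Require Import all_classical all_reals all_analysis.
From mathcomp Require Import complex.

Set Implicit Arguments.
Unset Strict Implicit.
Unset Printing Implicit Defensive.

Import Order.TTheory GRing.Theory Num.Theory numFieldNormedType.Exports.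

Local Open Scope classical_set_scope.
Local Open Scope complex_scope.
Local Open Scope ring_scope.

(* The norm of R[i] in MathComp takes its values in R[i]; this is the
   real-valued modulus. *)
Definition cmod {R : realType} (z : R[i]) : R := ComplexField.Normc.normc z.

(* Functions on the disc are represented by total functions R[i] -> R[i]; their
   values outside the disc play no role in any of the definitions below. *)
Definition disc {R : realType} : set R[i] := [set z | cmod z < 1].

(* R[i]^o is R[i] with the topology of the complex norm. *)
Definition analytic_on_disc {R : realType} (f : R[i] -> R[i]) : Prop :=
  forall z0 : R[i], disc z0 ->
    exists (r : R) (a : nat -> R[i]), 0 < r /\
      forall z : R[i], disc z -> cmod (z - z0) < r ->
        (series (fun n => a n * (z - z0) ^+ n) : nat -> R[i]^o) @ \oo
          --> (f z : R[i]^o).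

Definition cintegral {d} {T : measurableType d} {R : realType}
    (m : {measure set T -> \bar R}) (D : set T) (g : T -> R[i]) : R[i] :=
  (\int[m]_(x in D) complex.Re (g x)) +i* (\int[m]_(x in D) complex.Im (g x)).

(* The plane is measured on R * R, identified with R[i] by complex_of_pair. *)
Definition complex_of_pair {R : realType} (p : R * R) : R[i] := p.1 +i* p.2.

Definition pair_disc {R : realType} : set (R * R) :=
  [set p | disc (complex_of_pair p)].

Definition area_measure {R : realType} :=
  [the {measure set (_ * _) -> \bar R} of
   mscale (NngNum (ltW (eqbRL (invr_gt0 (pi : R)) (pi_gt0 R))))
          (@lebesgue_measure R \x @lebesgue_measure R)%E].

Definition tail_integral {R : realType} (w : R -> R) (r : R) : R :=
  \int[@lebesgue_measure R]_(s in `[r, 1[) w s.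

(* The weight on the disc is z |-> w (cmod z). *)
Record radial_weight {R : realType} (w : R -> R) : Prop := RadialWeight {
  radial_weight_ge0 : forall r : R, 0 <= r < 1 -> 0 <= w r;
  radial_weight_integrable :
    (@lebesgue_measure R).-integrable `[0, 1[ (EFin \o w);
  radial_weight_tail_gt0 : forall r : R, 0 <= r < 1 -> 0 < tail_integral w r
}.

(* The squared norm of f in the weighted Bergman space, possibly infinite. *)
Definition bergman_sqnorm {R : realType} (w : R -> R) (f : R[i] -> R[i]) :
    \bar R :=
  (\int[@area_measure R]_(p in pair_disc)
     (cmod (f (complex_of_pair p)) ^+ 2 * w (cmod (complex_of_pair p)))%:E)%E.

Definition bergman_space {R : realType} (w : R -> R) : set (R[i] -> R[i]) :=
  [set f | analytic_on_disc f /\ (bergman_sqnorm w f < +oo)%E].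

Definition bergman_norm {R : realType} (w : R -> R) (f : R[i] -> R[i]) : R :=
  Num.sqrt (fine (bergman_sqnorm w f)).

Definition is_bergman_kernel {R : realType} (w : R -> R) (z : R[i])
    (B : R[i] -> R[i]) : Prop :=
  bergman_space w B /\
  forall f : R[i] -> R[i], bergman_space w f ->
    f z = cintegral (@area_measure R) pair_disc
            (fun p => let zeta := complex_of_pair p in
               f zeta * (B zeta)^* * (w (cmod zeta))%:C).

(* For a radial weight the kernel exists and is unique on the disc, so that the
   default value of xget and the choice it makes are immaterial. *)
Definition bergman_kernel {R : realType} (w : R -> R) (z : R[i]) :
    R[i] -> R[i] :=
  xget (fun=> 0) [set B | is_bergman_kernel w z B].

(* The integral from 0 to z is taken along the segment s |-> s z, s in [0, 1];
   for a g analytic in the disc it does not depend on the path. *)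
Definition segment_integral {R : realType} (g : R[i] -> R[i]) (z : R[i]) :
    R[i] :=
  cintegral (@lebesgue_measure R) `[0, 1] (fun s : R => g (s%:C * z) * z).

Definition segment_mean {R : realType} (g : R[i] -> R[i]) (z : R[i]) : R[i] :=
  if z == 0 then g 0 else z^-1 * segment_integral g z.

Definition cesaro_op {R : realType} (w : R -> R) (f : R[i] -> R[i]) :
    R[i] -> R[i] :=
  fun z => cintegral (@lebesgue_measure R) `[0, 1[
    (fun t : R => f (t%:C * z) * segment_mean (bergman_kernel w t%:C) z
                  * (w t)%:C).

Definition bounded_on_bergman {R : realType} (w : R -> R)
    (T : (R[i] -> R[i]) -> (R[i] -> R[i])) : Prop :=
  exists M : R, forall f : R[i] -> R[i], bergman_space w f ->
    bergman_space w (T f) /\ bergman_norm w (T f) <= M * bergman_norm w f.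

Definition class_Dhat {R : realType} (w : R -> R) : Prop :=
  exists C : R, 1 < C /\
    forall r : R, 0 <= r < 1 ->
      tail_integral w r <= C * tail_integral w ((1 + r) / 2).

Definition class_Dcheck {R : realType} (w : R -> R) : Prop :=
  exists K C : R, [/\ 1 < K, 1 < C &
    forall r : R, 0 <= r < 1 ->
      C * tail_integral w (1 - (1 - r) / K) <= tail_integral w r].

Definition class_D {R : realType} (w : R -> R) : Prop :=
  class_Dhat w /\ class_Dcheck w.

(* Main.v *)
From HB Require Import structures.
Require Import Defs.
From mathcomp Require Import all_boot all_order all_algebra.
From mathcomp Require Import all_classical all_reals all_analysis.
From mathcomp Require Import complex measurable_realfun cyclic separable cyclotomic.
From mathcomp Require Import ring lra zify.

Set Implicit Arguments.
Unset Strict Implicit.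
Unset Printing Implicit Defensive.
Import Order.TTheory GRing.Theory Num.Theory numFieldNormedType.Exports.
Local Open Scope classical_set_scope.
Local Open Scope ring_scope.

                                  

(** In terms of Taylor coefficients the operator is a lower triangular matrix with positive entries,
    and the theorem becomes a weighted l^2 inequality for that matrix.

    Write f(z) = sum a_n z^n and let w_n denote the moment of order n, the integral of r^n w(r) over
    [0,1). Monomials are orthogonal for a radial weight, so the squared norm of f in A^2_mu is sum c
    mu_(2n+1) |a_n|^2 ([parseval]), where c > 0 is the constant of integration in polar form. The
    kernel at t is sum (tz)^n / (c omega_(2n+1)) ([bergman_kernel_pser]). Averaging it over [0,z]
    divides the n-th coefficient by n+1, and integrating in t turns t^N into omega_N. Hence the N-th
    coefficient of the image of f is omega_N times the sum over k <= N of a_k / ((N-k+1) c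
    omega_(2(N-k)+1)) ([cesaro_pser]). Boundedness is an inequality for this matrix in l^2 with
    weights m_n = mu_(2n+1) ([bounded_matrix], [matrix_bounded]). Put g_j = 1/((j+1) omega_(2j+1)).

    Sufficiency: omega in D gives doubling, omega_n <= A omega_(2n+1), and decay, omega_(Ln) <=
    omega_n / 2. Together they bound omega_n sum_(j<=n) g_j ([log_sum_bounded]), and a Schur test
    with h_n = (n+1)^(-1/2) then yields the inequality for nonincreasing m ([hardy_bounded]).

    Necessity: the matrix is tested on indicators of [n, 3n], where doubling of mu makes the weights
    m comparable. Rows near 12n compare omega_(13n) with omega_(18n+1); iteration gives doubling
    ([hardy_bounded_doubling]). Rows near 2n bound omega_n sum_(j<=n) g_j. Each dyadic block beyond
    n adds at least 1/(2 omega_n) to the sum of the g_j, so the sum up to Ln is at least of order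
    log L / omega_n, and omega_(Ln)/omega_n is as small as desired for L large
    ([hardy_bounded_decay]).

    The dictionary between moments and weight classes is that, under doubling of tails or of
    moments, omega_n is comparable with the tail at 1 - 1/n ([Dhat_moment_le_tail],
    [moment_doubling_le_tail]).

    In the underlying analysis, averages over roots of unity replace integrals over circles
    ([discrete_parseval]). They give the Cauchy estimate behind [taylor] as well as the
    orthogonality of monomials. *)

(** * Changes of variables in the plane and integration in polar form *)

Lemma lebesgue_affine (R : realType) (r c : R) (A : set R) : 0 < r ->
  measurable A ->
  (r%:E * lebesgue_measure ((fun x => (r * x + c)%R) @^-1` A) = lebesgue_measure A)%E.
Proof.
move=> r0 mA.
have mf : measurable_fun setT (fun x : R => r * x + c).
  by apply: measurable_funD => //; apply: measurable_funM.
have r0' : 0 <= r by exact: ltW.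
apply: esym; apply: (@lebesgue_measure_unique R (mscale (NngNum r0')
  (pushforward (lebesgue_measure : {measure set (measurableTypeR R) -> \bar R})
     (fun x : measurableTypeR R => (r * x + c : measurableTypeR R))))) => //.
move=> X [[a b] _ /= <-].
rewrite /mscale/=.
rewrite [pushforward _ _ _](_ : _ = lebesgue_measure `](a - c) / r, (b - c) / r]%classic); last first.
  congr (lebesgue_measure _); apply/seteqP; split=> x /=;
  rewrite !in_itv/= ltr_pdivrMr// ler_pdivlMr// => /andP[? ?];
  by apply/andP; split; nra.
rewrite !lebesgue_measure_itv/= !lte_fin ltr_pM2r ?invr_gt0// ltrD2r.
case: ifPn => // ab; last by rewrite mule0.
by rewrite -!EFinD -EFinM; congr EFin; field; rewrite gt_eqF.
Qed.

Lemma ge0_integral_affine (R : realType) (r c : R) (f : R -> \bar R) : 0 < r ->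
  measurable_fun setT f -> (forall x, (0 <= f x)%E) ->
  (r%:E * \int[lebesgue_measure]_x f (r * x + c)%R = \int[lebesgue_measure]_x f x)%E.
Proof.
move=> r0 mf f0.
have mg : measurable_fun setT (fun x : R => r * x + c).
  by apply: measurable_funD => //; apply: measurable_funM.
have r0' : 0 <= r by exact: ltW.
rewrite -[X in (_ * X)%E](@ge0_integral_pushforward _ _ (measurableTypeR R) (measurableTypeR R) R _ mg lebesgue_measure setT f)//.
apply: etrans.
  by apply: esym; exact: (@ge0_integral_mscale _ (measurableTypeR R) R _ setT measurableT (NngNum r0') f).
apply: eq_measure_integral => A mA _.
exact: lebesgue_affine.
Qed.

Lemma ge0_integral_swap (R : realType) (F : R * R -> \bar R) :
  measurable_fun setT F -> (forall x, (0 <= F x)%E) ->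
  (\int[lebesgue_measure \x lebesgue_measure]_p F (p.2, p.1) = \int[lebesgue_measure \x lebesgue_measure]_p F p)%E.
Proof.
move=> mF F0.
have ms : measurable_fun setT (fun p : R * R => (p.2, p.1)).
  by apply: measurable_fun_pair.
rewrite fubini_tonelli1//; last by apply: measurableT_comp mF ms.
by rewrite fubini_tonelli2.
Qed.

Lemma ge0_integral_shear (R : realType) (t : R) (F : R * R -> \bar R) :
  measurable_fun setT F -> (forall x, (0 <= F x)%E) ->
  (\int[lebesgue_measure \x lebesgue_measure]_p F (p.1 + t * p.2, p.2)%R = \int[lebesgue_measure \x lebesgue_measure]_p F p)%E.
Proof.
move=> mF F0.
have ms : measurable_fun setT (fun p : R * R => (p.1 + t * p.2, p.2)%R).
  apply: measurable_fun_pair => //.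
  by apply: measurable_funD => //; apply: measurable_funM.
rewrite fubini_tonelli2//; last by apply: measurableT_comp mF ms.
rewrite fubini_tonelli2//; apply: eq_integral => y _.
rewrite /fubini_G/=.
rewrite -[RHS](@ge0_integral_affine _ 1 (t * y))// ?mul1e.
  by apply: eq_integral => x _; rewrite mul1r.
exact: measurableT_comp mF (pair2_measurable _).
Qed.

Lemma ge0_integral_dilate (R : realType) (r : R) (F : R * R -> \bar R) : 0 < r ->
  measurable_fun setT F -> (forall x, (0 <= F x)%E) ->
  ((r ^+ 2)%:E * \int[lebesgue_measure \x lebesgue_measure]_p F (r * p.1, r * p.2)%R = \int[lebesgue_measure \x lebesgue_measure]_p F p)%E.
Proof.
move=> r0 mF F0.
have ms : measurable_fun setT (fun p : R * R => (r * p.1, r * p.2)%R).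
  by apply: measurable_fun_pair; apply: measurable_funM.
rewrite fubini_tonelli2//; last by apply: measurableT_comp mF ms.
rewrite fubini_tonelli2//. 
rewrite -[RHS](@ge0_integral_affine _ r 0)//; last 2 first.
- exact: measurable_fun_fubini_tonelli_G.
- by move=> x; apply: integral_ge0.
rewrite expr2 EFinM -muleA; congr (_ * _)%E.
rewrite -ge0_integralZl//; last 3 first.
- apply: (@measurable_fun_fubini_tonelli_G _ _ _ _ _ lebesgue_measure (fun p : R * R => F (r * p.1, r * p.2)%R)) => //.
  exact: measurableT_comp mF ms.
- by move=> x _; apply: integral_ge0.
- by rewrite lee_fin ltW.
apply: eq_integral => y _; rewrite /fubini_G/= addr0.
rewrite -[RHS](@ge0_integral_affine _ r 0)//.
  by under [X in _ = (_ * X)%E]eq_integral do rewrite addr0.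
exact: measurableT_comp mF (pair2_measurable _).
Qed.

(** Open left rays form a pi-system generating the Borel sets, and the rays with integer endpoint
    exhaust the line by sets of finite measure. *)
Lemma measure_unique_ray (R : realType) (n1 n2 : {measure set R -> \bar R}) :
  (forall x : R, n1 `]-oo, x[%classic = n2 `]-oo, x[%classic) -> (forall x : R, (n1 `]-oo, x[%classic < +oo)%E) ->
  forall A : set R, measurable A -> n1 A = n2 A.
Proof.
move=> E foo A mA.
refine (@measure_unique _ R R (@RGenInftyO.G R) (fun n => `]-oo, n%:R[%classic) _ _ _ _ n1 n2 _ _ A mA) => //.
- exact: RGenInftyO.measurableE.
- move=> _ _ [x ->] [y ->]; exists (Num.min x y).
  by apply/seteqP; split=> z /=; rewrite !in_itv/= lt_min => /andP.
- by move=> i; exists i%:R.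
- apply/seteqP; split=> // x _; exists (Num.truncn `|x|).+1 => //=; rewrite in_itv/=.
  by rewrite (le_lt_trans (ler_norm _))// truncnS_gt.
- by move=> _ [x ->].
Qed.

(** Restricting each measure to the preimage of [0,1) and pushing it forward gives two measures on
    the line that agree on rays, hence everywhere; the integral of [k] sees only these image
    measures. *)
Lemma ge0_integral_pushforward_eq d1 d2 (T1 : measurableType d1) (T2 : measurableType d2) (R : realType)
  (m1 : {measure set T1 -> \bar R}) (m2 : {measure set T2 -> \bar R})
  (g1 : T1 -> R) (g2 : T2 -> R) (k : R -> \bar R) :
  measurable_fun setT g1 -> measurable_fun setT g2 ->
  (forall x : R, m1 (g1 @^-1` `[0, 1[ `&` g1 @^-1` `]-oo, x[) = m2 (g2 @^-1` `[0, 1[ `&` g2 @^-1` `]-oo, x[)) ->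
  (m1 (g1 @^-1` `[0%R, 1%R[) < +oo)%E ->
  measurable_fun (`[0, 1[%classic : set R) k -> (forall r : R, 0 <= r < 1 -> (0 <= k r)%E) ->
  (\int[m1]_(x in g1 @^-1` `[0%R, 1%R[) k (g1 x) = \int[m2]_(x in g2 @^-1` `[0%R, 1%R[) k (g2 x))%E.
Proof.
move=> mg1 mg2 H foo mk k0.
have mD1 : measurable (g1 @^-1` `[0, 1[) by rewrite -[X in measurable X]setTI; exact: mg1.
have mD2 : measurable (g2 @^-1` `[0, 1[) by rewrite -[X in measurable X]setTI; exact: mg2.
rewrite (@eq_measure_integral _ _ _ _ (mrestr m1 mD1)); last first.
  by move=> A mA AD; transitivity (m1 (A `&` (g1 @^-1` `[0%R, 1%R[))); first by rewrite setIidl.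
rewrite [RHS](@eq_measure_integral _ _ _ _ (mrestr m2 mD2)); last first.
  by move=> A mA AD; transitivity (m2 (A `&` (g2 @^-1` `[0%R, 1%R[))); first by rewrite setIidl.
have k0' : {in `[0, 1[%classic, forall y, (0 <= k y)%E}.
  by move=> y; rewrite inE/= in_itv/=; exact: k0.
rewrite -(ge0_integral_pushforward mg1 _ (measurable_itv _) mk k0').
rewrite -(ge0_integral_pushforward mg2 _ (measurable_itv _) mk k0').
apply: eq_measure_integral => A mA _.
apply: (@measure_unique_ray R _ _ _ _ A mA) => x.
  by rewrite /= /pushforward /mrestr/= setIC H setIC.
rewrite /= /pushforward /mrestr/=.
apply: le_lt_trans foo; apply: le_measure; rewrite ?inE//.
apply: measurableI => //.
by rewrite -[X in measurable X]setTI; exact: mg1.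
Qed.

Lemma product_lebesgue_dilate (R : realType) (r : R) (A : set (R * R)) : 0 < r -> measurable A ->
  ((lebesgue_measure \x lebesgue_measure) A = (r ^+ 2)%:E * (lebesgue_measure \x lebesgue_measure) [set p : R * R | A (r * p.1, r * p.2)%R])%E.
Proof.
move=> r0 mA.
have ms : measurable_fun setT (fun p : R * R => (r * p.1, r * p.2)%R).
  by apply: measurable_fun_pair; apply: measurable_funM.
have mB : measurable [set p : R * R | A (r * p.1, r * p.2)%R].
  by rewrite -[X in measurable X]setTI; exact: ms.
rewrite -{1}[A]setIT -integral_indic// -(@ge0_integral_dilate R r)//; last first.
  by apply/measurable_EFinP; exact: measurable_indic.
congr (_ * _)%E; by rewrite -[in RHS](setIT [set p : R * R| _]) -integral_indic.
Qed.

Lemma measurable_cmod (R : realType) : measurable_fun setT (fun p : R * R => cmod (complex_of_pair p)).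
Proof.
rewrite /cmod /complex_of_pair /ComplexField.Normc.normc.
have ms : measurable_fun setT (Num.sqrt : R -> R).
  by apply: continuous_measurable_fun; exact: sqrt_continuous.
apply: (measurableT_comp ms).
by apply: measurable_funD; apply: measurable_funX.
Qed.

Lemma pair_discE (R : realType) : @pair_disc R = (fun p : R * R => cmod (complex_of_pair p)) @^-1` `[0, 1[.
Proof.
apply/seteqP; split=> p; rewrite /pair_disc/disc/= in_itv/=; first by move=> ->; rewrite sqrtr_ge0.
by case/andP.
Qed.

Lemma measurable_pair_disc (R : realType) : measurable (@pair_disc R).
Proof. by rewrite pair_discE -[X in measurable X]setTI; exact: measurable_cmod. Qed.

Lemma cmod_scale (R : realType) (r : R) p : 0 < r ->
  cmod (complex_of_pair (r * p.1, r * p.2)%R) = r * cmod (complex_of_pair p).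
Proof.
move=> r0; rewrite /cmod/= !exprMn -mulrDr sqrtrM ?sqr_ge0// sqrtr_sqr gtr0_norm//.
Qed.

                                                                                               
                                                                                               
(** A stand-in for the modulus: on the cone 0 <= y < x it is homogeneous of degree one with
    triangles as sublevel sets, which Fubini handles directly. The value -1 lies outside [0,1) and
    so discards the rest of the plane. *)
Definition cone_coord (R : realType) (p : R * R) : R :=
  if (0 <= p.2) && (p.2 < p.1) then p.1 else -1.

Lemma measurable_cone_coord (R : realType) : measurable_fun setT (@cone_coord R).
Proof.
apply: measurable_fun_ifT => //.
apply: measurable_and.
- exact: measurable_fun_ler.
- exact: measurable_fun_ltr.
Qed.

(** Dilation by x carries the set where 0 <= g < 1 onto the set where 0 <= g < x and multiplies area
    by x^2. *)
Lemma homogeneous_measure (R : realType) (g : R * R -> R) (x : R) :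
  measurable_fun setT g ->
  (forall (r : R) p, 0 < r -> 0 <= g p -> g (r * p.1, r * p.2)%R = r * g p) ->
  (forall (r : R) p, 0 < r -> g p < 0 -> g (r * p.1, r * p.2)%R < 0) ->
  0 < x -> x <= 1 ->
  (lebesgue_measure \x lebesgue_measure)%E (g @^-1` `[0%R, 1%R[ `&` g @^-1` `]-oo, x[) =
  ((x ^+ 2)%:E * (lebesgue_measure \x lebesgue_measure) (g @^-1` `[0%R, 1%R[))%E.
Proof.
move=> mg gh gn x0 x1.
rewrite (product_lebesgue_dilate x0); last first.
  by apply: measurableI; rewrite -[X in measurable X]setTI; exact: mg.
congr (_ * (lebesgue_measure \x lebesgue_measure) _)%E; apply/seteqP; split=> p /=; rewrite !in_itv/=.
  have [gp|gp] := ltP (g p) 0.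
    by move=> [/andP[]]; rewrite leNgt gn.
  by rewrite gh// => -[_]; rewrite -ltr_pdivlMl// mulVf ?gt_eqF.
by case/andP => gp g1; rewrite gh// mulr_ge0 ?(ltW x0)//; split; nra.
Qed.

Definition triangle (R : realType) : set (R * R) := @cone_coord R @^-1` `[0, 1[.

Lemma triangleE (R : realType) (p : R * R) : triangle p <-> [/\ 0 <= p.2, p.2 < p.1 & p.1 < 1].
Proof.
rewrite /triangle/= /cone_coord in_itv/=; case: ifPn => [/andP[p0 p1]|pn].
  split=> [/andP[_ ?] //|[_ _ ->]].
  by rewrite andbT (le_trans p0)// ltW.
split; first by lra.
by case=> p0 p1 _; rewrite p0 p1 in pn.
Qed.

Lemma measurable_triangle (R : realType) : measurable (@triangle R).
Proof. by rewrite -[X in measurable X]setTI; exact: measurable_cone_coord. Qed.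

Lemma measure_rectangle (R : realType) (a b c d : R) : a < b -> c < d ->
  (lebesgue_measure \x lebesgue_measure)%E (`[a, b[ `*` `[c, d[) = ((b - a) * (d - c))%:E.
Proof.
move=> ab cd; rewrite product_measure1E//.
transitivity ((b - a)%:E * (d - c)%:E)%E => //.
have L (u v : R) : u < v -> lebesgue_measure (`[u, v[%classic : set R) = (v - u)%:E.
  by rewrite lebesgue_measure_itv/= lte_fin => ->.
by congr (_ * _)%E; exact: L.
Qed.

(** An inner and an outer rectangle make the area positive and finite; the exact areas of the disc
    and of the triangle are never computed. *)
Lemma between_rectangles (R : realType) (A : set (R * R)) (a b c d : R) : measurable A ->
  a < b -> c < d -> `[a, b[ `*` `[c, d[ `<=` A -> A `<=` `[-1, 1[ `*` `[-1, 1[ ->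
  exists2 x : R, 0 < x & (lebesgue_measure \x lebesgue_measure)%E A = x%:E.
Proof.
move=> mA ab cd sA As.
have mR (x y z t : R) : measurable (`[x, y[ `*` `[z, t[) by apply: measurableX.
have h1 : (((b - a) * (d - c))%:E <= (lebesgue_measure \x lebesgue_measure) A)%E.
  by rewrite -measure_rectangle//; apply: le_measure => //; rewrite inE; first exact: mR.
have h2 : ((lebesgue_measure \x lebesgue_measure) A <= ((1 - -1) * (1 - -1))%:E)%E.
  rewrite -measure_rectangle; [|lra|lra]; apply: le_measure => //; rewrite inE//; exact: mR.
move: h1 h2; case: ((lebesgue_measure \x lebesgue_measure)%E A) => [r| |]//.
rewrite !lee_fin => h1 h2; exists r => //.
by rewrite (lt_le_trans _ h1)// mulr_gt0// subr_gt0.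
Qed.

(** The vertical slice of the triangle at abscissa r has length r; this is the source of the
    Jacobian of polar coordinates. *)
Lemma ge0_integral_triangle (R : realType) (k : R -> \bar R) :
  measurable_fun (`[0, 1[%classic : set R) k -> (forall r : R, 0 <= r < 1 -> (0 <= k r)%E) ->
  (\int[lebesgue_measure \x lebesgue_measure]_(p in @triangle R) k (cone_coord p) =
  \int[lebesgue_measure]_(r in `[0%R, 1%R[) (k r * r%:E))%E.
Proof.
move=> mk k0.
rewrite integral_mkcond fubini_tonelli1//; last 2 first.
- apply/(measurable_restrictT _ (@measurable_triangle R)).
  apply: (measurable_comp (measurable_itv (Interval (BLeft 0) (BLeft 1)))) => //.
    by move=> r [p] + <-.
  exact: measurable_funS (@measurable_cone_coord R).
- move=> p; rewrite patchE; case: ifPn => //; rewrite inE /triangle /= in_itv/=; exact: k0.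
rewrite [RHS]integral_mkcond; apply: eq_integral => x _.
rewrite /fubini_F patchE; case: ifPn => [|xn]; last first.
  apply: integral0_eq => y _; rewrite patchE; case: ifPn => //.
  rewrite inE => /triangleE /= [y0 yx x1]; move: xn; rewrite notin_setE/= in_itv/= x1.
  by rewrite (le_trans y0 (ltW yx)).
rewrite inE/= in_itv/= => /andP[x0 x1].
transitivity (\int[lebesgue_measure]_(y in `[0%R, x[) (k x))%E.
  rewrite [RHS]integral_mkcond; apply: eq_integral => y _; rewrite !patchE.
  case: ifPn; rewrite ?inE ?notin_setE.
    move=> /[dup] /triangleE/= [y0 yx _] _.
    by rewrite mem_set ?/cone_coord/= ?in_itv/= ?y0 ?yx.
  move=> H; case: ifPn => //; rewrite inE/= in_itv/= => /andP[y0 yx].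
  by exfalso; apply: H; apply/triangleE.
rewrite integral_cst//= lebesgue_measure_itv/= lte_fin; case: ifPn; rewrite ?sube0// -leNgt => x0'.
by have -> : x = 0 by apply/eqP; rewrite eq_le x0 x0'.
Qed.

Lemma ge0_integral_area (R : realType) (D : set (R * R)) (f : R * R -> \bar R) :
  measurable D -> measurable_fun D f -> (forall x, D x -> (0 <= f x)%E) ->
  (\int[@area_measure R]_(p in D) f p = pi^-1%:E * \int[lebesgue_measure \x lebesgue_measure]_(p in D) f p)%E.
Proof. by move=> mD mf f0; exact: ge0_integral_mscale. Qed.

(** Polar coordinates without angles: the modulus on the disc and [cone_coord] on the triangle both
    have distribution function proportional to x^2, so the integrals of [k] along them are
    proportional, and the triangle is integrated by slices. The constant is a ratio of areas. *)
Lemma radial_integral (R : realType) : exists2 c : R, 0 < c & forall k : R -> \bar R,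
  measurable_fun (`[0, 1[%classic : set R) k -> (forall r : R, 0 <= r < 1 -> (0 <= k r)%E) ->
  (\int[@area_measure R]_(p in @pair_disc R) k (cmod (complex_of_pair p)) =
   c%:E * \int[lebesgue_measure]_(r in `[0%R, 1%R[) (k r * r%:E))%E.
Proof.
have [a1 a10 a1E] : exists2 x : R, 0 < x & (lebesgue_measure \x lebesgue_measure)%E (@pair_disc R) = x%:E.
  apply: (@between_rectangles _ _ 0 (2^-1) 0 (2^-1)); rewrite ?invr_gt0//.
  - exact: measurable_pair_disc.
  - move=> [x y] [/=]; rewrite !in_itv/= => /andP[? ?] /andP[? ?].
    rewrite /pair_disc/disc/= /cmod/= -[ltRHS]sqrtr1 ltr_sqrt//; nra.
  - move=> [x y]; rewrite /pair_disc/disc/= /cmod/= -[ltRHS]sqrtr1 ltr_sqrt// => h.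
    by split; rewrite /= in_itv/=; apply/andP; split; nra.
have [a2 a20 a2E] : exists2 x : R, 0 < x & (lebesgue_measure \x lebesgue_measure)%E (@triangle R) = x%:E.
  apply: (@between_rectangles _ _ (2^-1) (3/4) 0 (2^-1)); rewrite ?invr_gt0//; first 1 last.
  - lra.
  - move=> [x y] [/=]; rewrite !in_itv/= => /andP[? ?] /andP[? ?].
    by apply/triangleE; split => /=; lra.
  - move=> [x y] /triangleE/= [? ? ?].
    by split; rewrite /= in_itv/=; apply/andP; split; lra.
  exact: measurable_triangle.
exists (pi^-1 * a1 / a2); first by rewrite divr_gt0// mulr_gt0// invr_gt0 pi_gt0.
move=> k mk k0.
have mkd : measurable_fun (@pair_disc R) (fun p => k (cmod (complex_of_pair p))).
  rewrite pair_discE; apply: (measurable_comp (measurable_itv (Interval (BLeft 0) (BLeft 1)))) => //.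
    by move=> r [p] + <-.
  exact: measurable_funS (@measurable_cmod R).
have mkt : measurable_fun (@triangle R) (fun p => k (cone_coord p)).
  apply: (measurable_comp (measurable_itv (Interval (BLeft 0) (BLeft 1)))) => //.
    by move=> r [p] + <-.
  exact: measurable_funS (@measurable_cone_coord R).
have kd0 (p : R * R) : pair_disc p -> (0 <= k (cmod (complex_of_pair p)))%E.
  by rewrite pair_discE/= in_itv/=; exact: k0.
have kt0 (p : R * R) : triangle p -> (0 <= k (cone_coord p))%E.
  by rewrite /triangle/= in_itv/=; exact: k0.
have a10' := ltW a10; have a20' := ltW a20.
have H1 (x : R) : 0 < x -> x <= 1 -> (lebesgue_measure \x lebesgue_measure)%E
   ((fun p : R * R => cmod (complex_of_pair p)) @^-1` `[0, 1[ `&` (fun p : R * R => cmod (complex_of_pair p)) @^-1` `]-oo, x[) = (x ^+ 2 * a1)%:E.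
  move=> x0 x1; rewrite homogeneous_measure//.
  - by rewrite -pair_discE a1E.
  - exact: measurable_cmod.
  - by move=> r p r0 _; rewrite cmod_scale.
  - by move=> r p r0; rewrite ltNge sqrtr_ge0.
have H2 (x : R) : 0 < x -> x <= 1 -> (lebesgue_measure \x lebesgue_measure)%E
   (@cone_coord R @^-1` `[0, 1[ `&` @cone_coord R @^-1` `]-oo, x[) = (x ^+ 2 * a2)%:E.
  move=> x0 x1; rewrite homogeneous_measure//.
  - by rewrite -/(@triangle R) a2E.
  - exact: measurable_cone_coord.
  - by move=> r p r0; rewrite /cone_coord /= pmulr_rge0// ltr_pM2l//; case: ifPn => // _; lra.
  - by move=> r p r0; rewrite /cone_coord /= pmulr_rge0// ltr_pM2l//; case: ifPn => // _; nra.
(* Each measure is scaled by the area of the other set, so that both distribution functions become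
   x^2 a1 a2 on (0,1]. *)
have [m1 m1E m1I] : exists2 m1 : {measure set (measurableTypeR R * measurableTypeR R) -> \bar R},
   (forall A, m1 A = (a2%:E * (@lebesgue_measure R \x @lebesgue_measure R) A)%E) &
   (forall D f, measurable D -> measurable_fun D f -> (forall x, D x -> (0 <= f x)%E) ->
     \int[m1]_(x in D) f x = a2%:E * \int[@lebesgue_measure R \x @lebesgue_measure R]_(x in D) f x)%E.
  exists (mscale (NngNum a20') (@lebesgue_measure R \x @lebesgue_measure R)%E) => //.
  by move=> D f mD mf f0; rewrite ge0_integral_mscale.
have [m2 m2E m2I] : exists2 m2 : {measure set (measurableTypeR R * measurableTypeR R) -> \bar R},
   (forall A, m2 A = (a1%:E * (@lebesgue_measure R \x @lebesgue_measure R) A)%E) &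
   (forall D f, measurable D -> measurable_fun D f -> (forall x, D x -> (0 <= f x)%E) ->
     \int[m2]_(x in D) f x = a1%:E * \int[@lebesgue_measure R \x @lebesgue_measure R]_(x in D) f x)%E.
  exists (mscale (NngNum a10') (@lebesgue_measure R \x @lebesgue_measure R)%E) => //.
  by move=> D f mD mf f0; rewrite ge0_integral_mscale.
have E : (\int[m1]_(p in @pair_disc R) k (cmod (complex_of_pair p)) = \int[m2]_(p in @triangle R) k (cone_coord p))%E.
  rewrite pair_discE /triangle; apply: ge0_integral_pushforward_eq => //.
  - exact: measurable_cmod.
  - exact: measurable_cone_coord.
  - move=> x; rewrite m1E m2E.
    have [x0|x0] := leP x 0.
      rewrite (_ : _ `&` _ = set0); last first.
        by apply/seteqP; split=> p //=; rewrite !in_itv/=; lra.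
      rewrite (_ : @cone_coord R @^-1` _ `&` _ = set0) ?measure0 ?mule0//.
      by apply/seteqP; split=> p //=; rewrite !in_itv/=; lra.
    have [x1|x1] := leP x 1.
      by rewrite H1// H2// -!EFinM; congr EFin; ring.
    rewrite (setIidl (_ : _ `<=` _)); last by move=> p /=; rewrite !in_itv/=; lra.
    rewrite (setIidl (_ : @cone_coord R @^-1` _ `<=` _)); last by move=> p /=; rewrite !in_itv/=; lra.
    by rewrite -pair_discE -/(@triangle R) a1E a2E -!EFinM; congr EFin; ring.
  - by rewrite m1E -pair_discE a1E ltry.
move: E; rewrite m1I//; last exact: measurable_pair_disc.
rewrite m2I//; last exact: measurable_triangle.
rewrite ge0_integral_triangle//= => E.
rewrite (ge0_integral_area (@measurable_pair_disc R))//.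
transitivity ((pi^-1 / a2)%:E * (a2%:E * \int[lebesgue_measure \x lebesgue_measure]_(x in pair_disc) k (cmod (complex_of_pair x))))%E.
  by rewrite muleA -EFinM divfK// gt_eqF.
by rewrite E muleA -EFinM; congr (_%:E * _)%E; ring.
Qed.

                       

(** * Modulus, convergence and absolute summability of complex sequences *)

Definition cseq_cvg (R : realType) (u : nat -> R[i]) (l : R[i]) : Prop :=
  forall e : R, 0 < e -> exists N, forall n, (N <= n)%N -> cmod (u n - l) < e.

Section cmod_theory.
Variable R : realType.
Implicit Types (x y z : R[i]) (r : R).

Lemma cmod_ge0 z : 0 <= cmod z. Proof. by case: z => a b; exact: sqrtr_ge0. Qed.

Lemma cmodE z : (cmod z)%:C%C = `|z|. Proof. by case: z. Qed.

Lemma cmodM x y : cmod (x * y) = cmod x * cmod y.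
Proof. exact: ComplexField.Normc.normcM. Qed.

Lemma ler_cmodD x y : cmod (x + y) <= cmod x + cmod y.
Proof. by rewrite -lecR rmorphD/= !cmodE ler_normD. Qed.

Lemma cmodN x : cmod (- x) = cmod x.
Proof. by apply/complexI; rewrite !cmodE normrN. Qed.

Lemma cmod0 : cmod (0 : R[i]) = 0.
Proof. by apply/complexI; rewrite cmodE normr0. Qed.

Lemma cmod1 : cmod (1 : R[i]) = 1.
Proof. by apply/complexI; rewrite cmodE normr1. Qed.

Lemma cmodX x n : cmod (x ^+ n) = cmod x ^+ n.
Proof. by elim: n => [|n IH]; rewrite ?expr0 ?cmod1// !exprS cmodM IH. Qed.

Lemma cmod_eq0 x : (cmod x == 0) = (x == 0).
Proof. by rewrite -(inj_eq (@complexI R)) cmodE normr_eq0. Qed.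

Lemma cmod_gt0 x : (0 < cmod x) = (x != 0).
Proof. by rewrite lt0r cmod_ge0 andbT cmod_eq0. Qed.

Lemma cmodC r : cmod r%:C%C = `|r|.
Proof. by rewrite /cmod/= expr0n addr0 sqrtr_sqr. Qed.

Lemma cmodB x y : cmod (x - y) = cmod (y - x).
Proof. by rewrite -cmodN opprB. Qed.

Lemma sqr_cmod x : cmod x ^+ 2 = complex.Re x ^+ 2 + complex.Im x ^+ 2.
Proof. by case: x => a b; rewrite /cmod/= sqr_sqrtr// addr_ge0 ?sqr_ge0. Qed.

Lemma sqr_cmodC x : (cmod x ^+ 2)%:C%C = x * x^*%C.
Proof. by rewrite -sqr_normc rmorphXn/= cmodE. Qed.

Lemma ler_Re_cmod x : `|complex.Re x| <= cmod x.
Proof.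
by rewrite -sqrtr_sqr -[leRHS]ger0_norm ?cmod_ge0// -sqrtr_sqr ler_wsqrtr// sqr_cmod lerDl sqr_ge0.
Qed.

Lemma ler_Im_cmod x : `|complex.Im x| <= cmod x.
Proof.
by rewrite -sqrtr_sqr -[leRHS]ger0_norm ?cmod_ge0// -sqrtr_sqr ler_wsqrtr// sqr_cmod lerDr sqr_ge0.
Qed.

Lemma ler_cmod_ReIm x : cmod x <= `|complex.Re x| + `|complex.Im x|.
Proof.
case: x => a b.
have {1}-> : (a +i* b)%C = a%:C%C + (0 +i* b)%C by apply/eqP; rewrite eq_complex/= addr0 add0r !eqxx.
apply: (le_trans (ler_cmodD _ _)); rewrite cmodC lerD2l /=.
by rewrite /cmod/= expr0n add0r sqrtr_sqr.
Qed.

Lemma ler_cmod_sum (I : Type) (s : seq I) (P : pred I) (F : I -> R[i]) :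
  cmod (\sum_(i <- s | P i) F i) <= \sum_(i <- s | P i) cmod (F i).
Proof.
elim/big_ind2 : _ => //; first by rewrite cmod0.
by move=> ? ? ? ? h1 h2; apply: (le_trans (ler_cmodD _ _)); exact: lerD.
Qed.

Lemma ler_cmod_triangle x y z : cmod (x - z) <= cmod (x - y) + cmod (y - z).
Proof. by rewrite -[x - z](subrKA y) ; exact: ler_cmodD. Qed.

Lemma cvg_complexP (u : nat -> R[i]) (l : R[i]) :
  ((u : nat -> R[i]^o) @ \oo --> (l : R[i]^o)) <-> cseq_cvg u l.
Proof.
split=> [/cvgrPdist_lt h e e0|h].
  have /h[N _ hN] : 0 < e%:C%C by rewrite ltcR.
  by exists N => n Nn; have := hN n Nn; rewrite /= -ltcR cmodE distrC.
apply/cvgrPdist_lt => -[e e'] /=; rewrite ltcE/= => /andP[/eqP -> e0].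
have [N hN] := h e e0; exists N => // n Nn /=.
by have := hN n Nn; rewrite -ltcR cmodE distrC.
Qed.

Lemma cseq_cvg_unique u l l' : @cseq_cvg R u l -> cseq_cvg u l' -> l = l'.
Proof.
move=> h h'; apply/eqP; rewrite -subr_eq0 -cmod_eq0; apply/eqP/le_anti.
rewrite cmod_ge0 andbT; apply/ler_addgt0Pr => e e0; rewrite add0r.
have e20 : 0 < e / 2 by rewrite divr_gt0.
have [N hN] := h _ e20; have [N' hN'] := h' _ e20.
have h1 := hN (maxn N N') (leq_maxl _ _); have h2 := hN' (maxn N N') (leq_maxr _ _).
by rewrite cmodB in h1; have := ler_cmod_triangle l (u (maxn N N')) l'; lra.
Qed.

Lemma cseq_cvg_le u l M : @cseq_cvg R u l -> (forall n, cmod (u n) <= M) -> cmod l <= M.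
Proof.
move=> h hM; apply/ler_addgt0Pr => e e0; have [N hN] := h _ e0.
have := hN N (leqnn _); have := hM N.
have := ler_cmodD (u N) (l - u N); rewrite addrC subrK cmodB; lra.
Qed.

Lemma cseq_cvgD u v l l' : @cseq_cvg R u l -> cseq_cvg v l' -> cseq_cvg (fun n => u n + v n) (l + l').
Proof.
move=> h h' e e0; have e20 : 0 < e / 2 by rewrite divr_gt0.
have [N hN] := h _ e20; have [N' hN'] := h' _ e20.
exists (maxn N N') => n; rewrite geq_max => /andP[/hN h1 /hN' h2].
rewrite opprD addrACA; have := ler_cmodD (u n - l) (v n - l'); lra.
Qed.

Lemma cseq_cvgZ (a : R[i]) u l : cseq_cvg u l -> cseq_cvg (fun n => a * u n) (a * l).
Proof.
move=> h e e0; have a1 : 0 < cmod a + 1 by rewrite ltr_wpDl ?cmod_ge0.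
have [N hN] := h _ (divr_gt0 e0 a1); exists N => n /hN.
rewrite -mulrBr cmodM ltr_pdivlMr// => h1; have := cmod_ge0 (u n - l); have := cmod_ge0 a; nra.
Qed.

Lemma cseq_cvg_eq u v l : (forall n, u n = v n) -> @cseq_cvg R u l -> cseq_cvg v l.
Proof. by move=> /funext ->. Qed.

Lemma cseq_cvgP (u : nat -> R[i]) l :
  cseq_cvg u l <-> (((fun n => complex.Re (u n)) @ \oo --> complex.Re l) /\ ((fun n => complex.Im (u n)) @ \oo --> complex.Im l)).
Proof.
split=> [h|[/cvgrPdist_lt hr /cvgrPdist_lt hi] e e0].
  split; apply/cvgrPdist_lt => e e0; have [N hN] := h e e0; exists N => // n /hN /=;
  rewrite cmodB; apply: le_lt_trans; rewrite -raddfB; [exact: ler_Re_cmod|exact: ler_Im_cmod].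
have e20 : 0 < e / 2 by rewrite divr_gt0.
have [N _ hN] := hr _ e20; have [N' _ hN'] := hi _ e20.
exists (maxn N N') => n; rewrite geq_max => /andP[/hN/= h1 /hN'/= h2].
have := ler_cmod_ReIm (u n - l); rewrite !raddfB/= distrC [X in _ <= _ + X]distrC; lra.
Qed.

End cmod_theory.

Section complex_series.
Variable R : realType.
Implicit Types (c d : nat -> R[i]).

Definition has_csum c (l : R[i]) := cseq_cvg (fun n => \sum_(i < n) c i) l.

Definition abs_summable c := exists M : R, forall n, \sum_(i < n) cmod (c i) <= M.

Lemma nneg_sum_leq (u : nat -> R) m n : (forall i, 0 <= u i) -> (m <= n)%N -> \sum_(i < m) u i <= \sum_(i < n) u i.
Proof.
move=> u0 mn; rewrite -!(big_mkord xpredT) (big_cat_nat (leq0n m) mn)//= lerDl.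
by apply: sumr_ge0.
Qed.

Lemma abs_summable_cauchy c : abs_summable c ->
  forall e : R, 0 < e -> exists N, forall m n, (N <= m)%N -> (m <= n)%N -> \sum_(m <= i < n) cmod (c i) < e.
Proof.
move=> [M hM] e e0.
pose S := [set x | exists n, x = \sum_(i < n) cmod (c i)].
have hS : has_sup S.
  split; first by exists 0, 0%N; rewrite big_ord0.
  by exists M => _ [n ->].
have [_ [N ->] hN] := sup_adherent e0 hS.
exists N => m n Nm mn.
have h1 : \sum_(i < n) cmod (c i) <= sup S by apply: sup_upper_bound => //; exists n.
have h2 := nneg_sum_leq (u := fun i => cmod (c i)) (fun i => cmod_ge0 _) Nm.
have h3 : \sum_(i < n) cmod (c i) = \sum_(i < m) cmod (c i) + \sum_(m <= i < n) cmod (c i).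
  by rewrite -!(big_mkord xpredT (fun i => cmod (c i))) (big_cat_nat (leq0n m) mn).
lra.
Qed.

Lemma real_sum_cvg (u : nat -> R) (M : R) : (forall n, \sum_(i < n) `|u i| <= M) ->
  exists l : R, (fun n => \sum_(i < n) u i) @ \oo --> l.
Proof.
move=> h.
have : cvgn (series u).
  apply: normed_cvg.
  rewrite /normed_series_of seriesEord.
  apply: nondecreasing_is_cvgn.
    by move=> m n mn; exact: (nneg_sum_leq (u := fun i => `|u i|)).
  exists M => _ [n _ <-] /=; exact: h.
move=> /cvg_ex[l hl]; exists l; apply: cvg_trans hl.
by rewrite (_ : series u = fun n => \sum_(i < n) u i)//; apply/funext => n; rewrite /series/= big_mkord.
Qed.

Lemma abs_summable_cvg c : abs_summable c -> exists l, has_csum c l.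
Proof.
move=> [M h].
have [a ha] : exists l : R, (fun n => \sum_(i < n) complex.Re (c i)) @ \oo --> l.
  apply: (@real_sum_cvg (fun i => complex.Re (c i)) M) => n; apply: le_trans (h n).
  by apply: ler_sum => i _; exact: ler_Re_cmod.
have [b hb] : exists l : R, (fun n => \sum_(i < n) complex.Im (c i)) @ \oo --> l.
  apply: (@real_sum_cvg (fun i => complex.Im (c i)) M) => n; apply: le_trans (h n).
  by apply: ler_sum => i _; exact: ler_Im_cmod.
exists (a +i* b)%C; apply/cseq_cvgP; split => /=.
  by rewrite (_ : (fun n => _) = (fun n => \sum_(i < n) complex.Re (c i)))//; apply/funext => n; rewrite raddf_sum.
by rewrite (_ : (fun n => _) = (fun n => \sum_(i < n) complex.Im (c i)))//; apply/funext => n; rewrite raddf_sum.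
Qed.

Lemma has_csum_le c l M : has_csum c l -> (forall n, \sum_(i < n) cmod (c i) <= M) -> cmod l <= M.
Proof. by move=> h hM; apply: (cseq_cvg_le h) => n; apply: le_trans (hM n); exact: ler_cmod_sum. Qed.

Lemma has_csum_tail c l : has_csum c l -> forall m M, (forall n, (m <= n)%N -> \sum_(m <= i < n) cmod (c i) <= M) ->
  cmod (l - \sum_(i < m) c i) <= M.
Proof.
move=> h m M hM; have h' : cseq_cvg (fun n => \sum_(i < n) c i + - \sum_(i < m) c i) (l - \sum_(i < m) c i).
  by apply: cseq_cvgD => // e e0; exists 0%N => n _; rewrite subrr cmod0.
apply/ler_addgt0Pr => e e0; have [N hN] := h' _ e0.
have := hN (maxn N m) (leq_maxl _ _); have mn := leq_maxr N m.
set n := maxn N m in mn *.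
have -> : \sum_(i < n) c i - \sum_(i < m) c i = \sum_(m <= i < n) c i.
  by rewrite -!(big_mkord xpredT c) (big_cat_nat (leq0n m) mn)//= addrAC subrr add0r.
have h1 : cmod (\sum_(m <= i < n) c i) <= M by apply: le_trans (hM _ mn); exact: ler_cmod_sum.
have := ler_cmodD (l - \sum_(i < m) c i - \sum_(m <= i < n) c i) (\sum_(m <= i < n) c i).
by rewrite subrK [cmod (_ - (l - _))]cmodB; lra.
Qed.

Lemma has_csumD c d l l' : has_csum c l -> has_csum d l' -> has_csum (fun n => c n + d n) (l + l').
Proof.
move=> h h'; apply: cseq_cvg_eq (cseq_cvgD h h') => n /=; exact/esym/big_split.
Qed.

Lemma has_csumZ a c l : has_csum c l -> has_csum (fun n => a * c n) (a * l).
Proof.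
by move=> h; apply: cseq_cvg_eq (cseq_cvgZ a h) => n /=; rewrite mulr_sumr.
Qed.

Lemma abs_summable_le c d : (forall n, cmod (c n) <= cmod (d n)) -> abs_summable d -> abs_summable c.
Proof. by move=> h [M hM]; exists M => n; apply: le_trans (hM n); apply: ler_sum. Qed.

Lemma abs_summableZ a c : abs_summable c -> abs_summable (fun n => a * c n).
Proof.
move=> [M hM]; exists (cmod a * M) => n; under eq_bigr do rewrite cmodM.
by rewrite -mulr_sumr ler_wpM2l ?cmod_ge0.
Qed.

Lemma geometric_le (q : R) n : 0 <= q < 1 -> \sum_(i < n) q ^+ i <= (1 - q)^-1.
Proof.
move=> /andP[q0 q1]; have q1' : 0 < 1 - q by rewrite subr_gt0.
rewrite -[leRHS]mul1r ler_pdivlMr// mulrC.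
have := subrX1 q n; have := exprn_ge0 n q0; lra.
Qed.

End complex_series.

                     

(** * Power series: radius of convergence, recentring, uniqueness *)

Section power_series.
Variable R : realType.
Implicit Types (a b : nat -> R[i]) (z w h : R[i]) (r s : R).

                                                                          
(** Says that the radius of convergence is at least [r], through bounded terms rather than an upper
    limit. *)
Definition geom_bounded a r := forall s, 0 <= s -> s < r -> exists M : R, forall n, cmod (a n) * s ^+ n <= M.

(** Comparison with the geometric series of ratio s/t, where t is the midpoint of s and r. *)
Lemma geom_bounded_summable a r s : geom_bounded a r -> 0 <= s -> s < r -> exists M : R, forall n, \sum_(i < n) cmod (a i) * s ^+ i <= M.
Proof.
move=> h s0 sr; pose t := (s + r) / 2.
have st : s < t by rewrite /t; lra.
have tr : t < r by rewrite /t; lra.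
have t0 : 0 < t by lra.
have [M hM] := h t (ltW t0) tr.
have M0 : 0 <= M by apply: le_trans (hM 0%N); rewrite mulr_ge0// cmod_ge0.
exists (M * (1 - s / t)^-1) => n.
apply: le_trans (_ : \sum_(i < n) M * (s / t) ^+ i <= _).
  apply: ler_sum => i _; have := hM i.
  have -> : s ^+ i = (s / t) ^+ i * t ^+ i by rewrite -exprMn divfK// gt_eqF.
  by move=> h1; rewrite mulrCA mulrC ler_wpM2r// exprn_ge0// divr_ge0// ltW.
rewrite -mulr_sumr ler_wpM2l// geometric_le// divr_ge0 ?(ltW t0)//=.
by rewrite ltr_pdivrMr// mul1r.
Qed.

Lemma pser_abs_summable a r z : geom_bounded a r -> cmod z < r -> abs_summable (fun n => a n * z ^+ n).
Proof.
move=> h zr; have [M hM] := geom_bounded_summable h (cmod_ge0 z) zr; exists M => n.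
by under eq_bigr do rewrite cmodM cmodX.
Qed.

Definition is_pser a z l := has_csum (fun n => a n * z ^+ n) l.

Lemma pser_cvg_bounded a z l : is_pser a z l -> exists M : R, forall n, cmod (a n) * cmod z ^+ n <= M.
Proof.
move=> h; have [N hN] := h 1 ltr01.
(* The first N terms are bounded by their own sum; a later term is the difference of two partial
   sums within 1 of the limit, hence the 2. *)
pose M := \sum_(i < N) cmod (a i) * cmod z ^+ i + 2.
exists M => n; case: (ltnP n N) => nN.
  rewrite /M (bigD1 (Ordinal nN))//= -addrA lerDl addr_ge0// sumr_ge0// => i _.
  by rewrite mulr_ge0 ?cmod_ge0// exprn_ge0// cmod_ge0.
have h1 := hN n nN; have h2 := hN n.+1 (leqW nN).
have : cmod (a n * z ^+ n) <= 2.
  have -> : a n * z ^+ n = (\sum_(i < n.+1) a i * z ^+ i - l) - (\sum_(i < n) a i * z ^+ i - l).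
    by rewrite big_ord_recr/=; ring.
  apply: (le_trans (ler_cmodD _ _)); rewrite cmodN; lra.
rewrite cmodM cmodX => /le_trans; apply; rewrite /M lerDr sumr_ge0// => i _.
by rewrite mulr_ge0 ?cmod_ge0// exprn_ge0// cmod_ge0.
Qed.

Lemma pser_cvg_radius a r : (forall z, cmod z < r -> exists l, is_pser a z l) -> geom_bounded a r.
Proof.
move=> h s s0 sr; have [l hl] : exists l, is_pser a s%:C%C l by apply: h; rewrite cmodC ger0_norm.
by have := pser_cvg_bounded hl; rewrite cmodC ger0_norm.
Qed.

Lemma geom_bounded_le a r s : s <= r -> geom_bounded a r -> geom_bounded a s.
Proof. by move=> sr h t t0 ts; apply: h => //; exact: lt_le_trans sr. Qed.

Lemma pser_tail a r s : geom_bounded a r -> 0 <= s -> s < r -> forall e : R, 0 < e -> exists N, forall n z l,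
   (N <= n)%N -> cmod z <= s -> is_pser a z l -> cmod (l - \sum_(i < n) a i * z ^+ i) <= e.
Proof.
move=> h s0 sr e e0.
have [M hM] := geom_bounded_summable h s0 sr.
have /abs_summable_cauchy/(_ _ e0)[N hN] : abs_summable (fun i => a i * s%:C%C ^+ i).
  by exists M => n; under eq_bigr do rewrite cmodM cmodX cmodC ger0_norm//.
exists N => n z l Nn zs hl; apply: (has_csum_tail hl) => k nk.
apply: le_trans (ltW (hN n k Nn nk)); apply: ler_sum => i _.
rewrite !cmodM !cmodX cmodC ger0_norm// ler_wpM2l ?cmod_ge0// lerXn2r// nnegrE// cmod_ge0//.
Qed.

                                                                                   
(** The coefficients of sum a_m (w + h)^m in powers of h. For m < n the truncated exponent is
    harmless, since the binomial coefficient vanishes. *)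
Definition reexpand a w b := forall n, has_csum (fun m => a m * (w ^+ (m - n) *+ 'C(m, n))) (b n).

Lemma binomial_truncE (K : comNzRingType) (x y : K) m M : (m < M)%N ->
  \sum_(n < M) x ^+ (m - n) * y ^+ n *+ 'C(m, n) = (x + y) ^+ m.
Proof.
move=> mM; rewrite exprDn (big_ord_widen M (fun n => x ^+ (m - n) * y ^+ n *+ 'C(m, n)) mM).
rewrite ?[LHS]big_mkcond [RHS]big_mkcond/=; apply: eq_bigr => n _; case: ltnP => // mn.
by rewrite bin_small.
Qed.

Lemma binomial_trunc_le (x y : R) m M : 0 <= x -> 0 <= y ->
  \sum_(n < M) x ^+ (m - n) * y ^+ n *+ 'C(m, n) <= (x + y) ^+ m.
Proof.
move=> x0 y0; rewrite -(binomial_truncE x y (leq_maxr M m.+1)).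
apply: (nneg_sum_leq (u := fun n => x ^+ (m - n) * y ^+ n *+ 'C(m, n))); last exact: leq_maxl.
by move=> n; rewrite mulrn_wge0// mulr_ge0// exprn_ge0.
Qed.

Lemma binomial_term_le (x y : R) m n : 0 <= x -> 0 <= y ->
  x ^+ (m - n) * y ^+ n *+ 'C(m, n) <= (x + y) ^+ m.
Proof.
move=> x0 y0; apply: le_trans (binomial_trunc_le m n.+1 x0 y0).
rewrite big_ord_recr/= lerDr sumr_ge0// => i _.
by rewrite mulrn_wge0// mulr_ge0// exprn_ge0.
Qed.

Lemma cmodMn z n : cmod (z *+ n) = cmod z *+ n.
Proof. by rewrite -mulr_natr cmodM -[X in _ * cmod X](rmorph_nat (real_complex R)) cmodC ger0_norm ?ler0n// mulr_natr. Qed.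

(** C(m,n) |w|^(m-n) d^n is one term of the binomial expansion of (|w| + d)^m, so a single majorant
    [S] serves every n. *)
Lemma reexpand_exists a w (d S : R) : 0 < d ->
  (forall n, \sum_(m < n) cmod (a m) * (cmod w + d) ^+ m <= S) ->
  exists2 b, reexpand a w b & forall n, cmod (b n) * d ^+ n <= S.
Proof.
move=> d0 hS.
have bnd n N : \sum_(m < N) cmod (a m * (w ^+ (m - n) *+ 'C(m, n))) <= S / d ^+ n.
  rewrite ler_pdivlMr ?exprn_gt0// mulr_suml; apply: le_trans (hS N); apply: ler_sum => m _.
  rewrite cmodM -mulrA ler_wpM2l ?cmod_ge0// cmodMn cmodX mulrnAl.
  exact: binomial_term_le (cmod_ge0 _) (ltW d0).
have /choice[b hb] n : exists l, has_csum (fun m => a m * (w ^+ (m - n) *+ 'C(m, n))) l.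
  by apply: abs_summable_cvg; exists (S / d ^+ n).
exists b => // n; rewrite -ler_pdivlMr ?exprn_gt0//.
exact: has_csum_le (hb n) (bnd n).
Qed.

Lemma cseq_cvg_sum (M : nat) (u : nat -> nat -> R[i]) (l : nat -> R[i]) :
  (forall n, cseq_cvg (u n) (l n)) -> cseq_cvg (fun k => \sum_(n < M) u n k) (\sum_(n < M) l n).
Proof.
move=> h; elim: M => [|M IH].
  by move=> e e0; exists 0%N => n _; rewrite !big_ord0 subrr cmod0.
rewrite big_ord_recr/=; apply: cseq_cvg_eq (cseq_cvgD IH (h M)) => k.
by rewrite big_ord_recr.
Qed.

(** Rearrangement of a double series. With both sums cut at M, the terms with m < M are complete
    binomial expansions, and the rest is bounded by the tail of sum |a_m| s^m with s = |w| + |h|. *)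
Lemma reexpand_pser a r w h b l : geom_bounded a r -> reexpand a w b -> cmod w + cmod h < r ->
  is_pser a (w + h) l -> is_pser b h l.
Proof.
move=> ga hb whr hl; pose s := cmod w + cmod h.
have s0 : 0 <= s by rewrite addr_ge0 ?cmod_ge0.
have [S hS] := geom_bounded_summable ga s0 whr.
have /abs_summable_cauchy hc : abs_summable (fun i => a i * s%:C%C ^+ i).
  by exists S => n; under eq_bigr do rewrite cmodM cmodX cmodC ger0_norm//.
move=> e e0; have e20 : 0 < e / 2 by rewrite divr_gt0.
have [N1 hN1] := hl _ e20; have [N2 hN2] := hc _ e20.
exists (maxn N1 N2) => M; rewrite geq_max => /andP[M1 M2].
have := hN1 M M1.
suff : cmod (\sum_(n < M) b n * h ^+ n - \sum_(m < M) a m * (w + h) ^+ m) <= e / 2.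
  by move=> h1 h2; apply: le_lt_trans (ler_cmod_triangle _ (\sum_(m < M) a m * (w + h) ^+ m) _) _; lra.
have cv : cseq_cvg (fun L => \sum_(n < M) h ^+ n * \sum_(m < L) a m * (w ^+ (m - n) *+ 'C(m, n)) - \sum_(m < M) a m * (w + h) ^+ m)
   (\sum_(n < M) b n * h ^+ n - \sum_(m < M) a m * (w + h) ^+ m).
  apply: cseq_cvgD; last by move=> ? ?; exists 0%N => n _; rewrite subrr cmod0.
  rewrite (eq_bigr (fun n : 'I_M => h ^+ n * b n)); last by move=> n _; rewrite mulrC.
  apply: (@cseq_cvg_sum M (fun n L => h ^+ n * \sum_(m < L) a m * (w ^+ (m - n) *+ 'C(m, n))) (fun n => h ^+ n * b n)).
  by move=> n; apply: cseq_cvgZ; exact: hb.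
have cvM : cseq_cvg (fun L => \sum_(n < M) h ^+ n * \sum_(m < M + L) a m * (w ^+ (m - n) *+ 'C(m, n)) - \sum_(m < M) a m * (w + h) ^+ m)
   (\sum_(n < M) b n * h ^+ n - \sum_(m < M) a m * (w + h) ^+ m).
  move=> e' /cv[N hN]; exists N => n Nn; apply: hN; exact: leq_trans (leq_addl _ _).
apply: (cseq_cvg_le cvM) => L.
have E : \sum_(n < M) h ^+ n * \sum_(m < M + L) a m * (w ^+ (m - n) *+ 'C(m, n)) =
    \sum_(m < M + L) a m * \sum_(n < M) (w ^+ (m - n) * h ^+ n *+ 'C(m, n)).
  under eq_bigr do rewrite mulr_sumr.
  rewrite exchange_big/=; apply: eq_bigr => m _; rewrite mulr_sumr; apply: eq_bigr => n _.
  by rewrite mulrCA -mulrnAl [h ^+ n * _]mulrC.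
rewrite E big_split_ord/= (eq_bigr (fun m : 'I_M => a m * (w + h) ^+ m)); last first.
  by move=> m _; rewrite binomial_truncE.
rewrite addrAC subrr add0r; apply: (le_trans (ler_cmod_sum _ _ _)).
apply: le_trans (ltW (hN2 M (M + L)%N M2 (leq_addr _ _))).
rewrite -[in leRHS](add0n M) big_addn add0n addKn big_mkord; apply: ler_sum => m _.
rewrite !cmodM cmodX cmodC (ger0_norm s0) addnC ler_wpM2l ?cmod_ge0//.
apply: le_trans (binomial_trunc_le (m + M) M (cmod_ge0 w) (cmod_ge0 h)).
apply: (le_trans (ler_cmod_sum _ _ _)); apply: ler_sum => n _.
by rewrite cmodMn cmodM !cmodX.
Qed.

(** Identity theorem for zeros accumulating at 0: once a_0, ..., a_(n-1) vanish, a zero h gives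
    |a_n| |h|^n <= S (|h|/s)^(n+1), so |a_n| is at most a constant times |h|. *)
Lemma pser_unique a r : 0 < r -> geom_bounded a r ->
  (forall e : R, 0 < e -> exists h, [/\ h != 0, cmod h < e & is_pser a h 0]) -> forall n, a n = 0.
Proof.
move=> r0 ga H; elim/ltn_ind => n IH.
pose s := r / 2; have s0 : 0 < s by rewrite divr_gt0.
have sr : s < r by rewrite /s; lra.
have [S hS] := geom_bounded_summable ga (ltW s0) sr.
have S0 : 0 <= S by have := hS 0%N; rewrite big_ord0.
apply/eqP; rewrite -cmod_eq0; apply/eqP/le_anti; rewrite cmod_ge0 andbT.
apply/ler_addgt0Pr => e e0; rewrite add0r.
pose S' := (S + 1) / s ^+ n.+1.
have S'0 : 0 < S' by rewrite divr_gt0 ?exprn_gt0// ltr_wpDl.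
have [h [h0 he h1]] := H (Num.min s (e / S')) (ltac:(by rewrite lt_min s0 divr_gt0)).
have ch0 : 0 < cmod h by rewrite cmod_gt0.
move: he; rewrite lt_min => /andP[hs]; rewrite ltr_pdivlMr// => he.
have /(_ n.+1 ((cmod h / s) ^+ n.+1 * S)) := has_csum_tail h1.
rewrite sub0r cmodN big_ord_recr/= big1 ?add0r; last by move=> i _; rewrite (IH i)// mul0r.
move=> H1; have : cmod (a n * h ^+ n) <= (cmod h / s) ^+ n.+1 * S.
  apply: H1 => k nk; apply: le_trans (_ : (cmod h / s) ^+ n.+1 * (\sum_(n.+1 <= i < k) cmod (a i) * s ^+ i) <= _).
    rewrite mulr_sumr; rewrite big_nat [leRHS]big_nat; apply: ler_sum => i /andP[ni ik].
    rewrite cmodM cmodX mulrCA ler_wpM2l ?cmod_ge0//.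
    rewrite -{1}(divfK (lt0r_neq0 s0) (cmod h)) exprMn ler_wpM2r ?exprn_ge0 ?(ltW s0)//.
    apply: ler_wiXn2l => //; first by rewrite divr_ge0 ?(ltW s0) ?(ltW ch0).
    by rewrite ler_pdivrMr// mul1r ltW.
  apply: ler_wpM2l; first by rewrite exprn_ge0// divr_ge0 ?(ltW s0) ?(ltW ch0).
  apply: le_trans (hS k); rewrite -(big_mkord xpredT (fun i => cmod (a i) * s ^+ i)).
  rewrite (big_cat_nat (leq0n n.+1) nk)//= lerDr sumr_ge0// => i _.
  by rewrite mulr_ge0 ?cmod_ge0// exprn_ge0// ltW.
rewrite cmodM cmodX expr_div_n exprSr => H2.
have : cmod (a n) <= cmod h * S / s ^+ n.+1.
  rewrite -(ler_pM2r (exprn_gt0 n ch0)); apply: (le_trans H2); rewrite le_eqVlt; apply/orP; left; apply/eqP; field.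
  by rewrite !gt_eqF// exprn_gt0.
move/le_trans; apply; apply: le_trans (ltW he); rewrite -mulrA ler_wpM2l ?cmod_ge0//.
by rewrite ler_wpM2r ?invr_ge0 ?exprn_ge0 ?(ltW s0)// lerDl.
Qed.

(** X^n - 1 splits over the algebraically closed field R[i] with n distinct roots, and n distinct
    n-th roots of unity include a primitive one. *)
Lemma primitive_root_exists n : (0 < n)%N -> exists u : R[i], n.-primitive_root u.
Proof.
pose p : {poly R[i]} := 'X^n - 1; have [r Dp] := closed_field_poly_normal p.
move=> n_gt0; rewrite (monicP _) ?monicXnsubC // scale1r in Dp.
have rn1 : all n.-unity_root r by apply/allP=> z; rewrite -root_prod_XsubC -Dp.
have sz_r : (n < (size r).+1)%N by rewrite -(size_prod_XsubC r id) -Dp size_XnsubC.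
have [|z] := hasP (has_prim_root n_gt0 rn1 _ sz_r); last by exists z.
by rewrite -separable_prod_XsubC -Dp separable_Xn_sub_1 // pnatr_eq0 -lt0n.
Qed.

End power_series.
Arguments cmod {R} z : simpl never.

                                               

(** * Cauchy estimates by roots of unity, and Taylor expansion on the whole disc *)

Section taylor.
Variable R : realType.
Implicit Types (a b : nat -> R[i]) (z w h u : R[i]) (r s : R) (f : R[i] -> R[i]).

Lemma unity_root_conj u N : (0 < N)%N -> u ^+ N = 1 -> cmod u = 1 /\ u^*%C = u^-1.
Proof.
move=> N0 uN; have cu : cmod u = 1.
  apply/eqP; rewrite -(@pexpr_eq1 _ _ N)// ?cmod_ge0//.
  by rewrite -cmodX uN cmod1.
split=> //; have u0 : u != 0 by rewrite -cmod_eq0 cu oner_eq0.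
by apply: (mulfI u0); rewrite mulfV// -sqr_cmodC cu expr1n.
Qed.

Lemma prim_root_orthogonal u N n m : N.-primitive_root u -> (n < N)%N -> (m < N)%N ->
  \sum_(k < N) (u ^+ n * u^*%C ^+ m) ^+ k = (N * (n == m))%:R.
Proof.
move=> pu nN mN; have N0 := prim_order_gt0 pu; have uN := prim_expr_order pu.
have [cu uJ] := unity_root_conj N0 uN.
have u0 : u != 0 by rewrite -cmod_eq0 cu oner_eq0.
case: eqVneq => [->|nm].
  rewrite uJ -exprMn mulfV// expr1n (eq_bigr (fun=> 1)); last by move=> ? _; rewrite expr1n.
  by rewrite sumr_const card_ord muln1.
rewrite muln0; set x := _ * _.
have x1 : x - 1 != 0.
  rewrite subr_eq0; apply/negP => /eqP x1.
  have : u ^+ n == u ^+ m by rewrite -[X in _ == X]mul1r -x1 /x uJ exprVn divfK// expf_neq0.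
  by rewrite (eq_prim_root_expr pu) !modn_small// (negbTE nm).
apply: (mulfI x1); rewrite mulr0 -subrX1 /x uJ exprMn exprVn -!exprM ![(_ * N)%N]mulnC !exprM uN !expr1n.
by rewrite exprVn -exprM mulnC exprM uN expr1n invr1 mulr1 subrr.
Qed.

(** Averaging over the N-th roots of unity plays the part of integration over a circle; for
    polynomials of degree below N orthogonality cancels all cross terms exactly. *)
Lemma discrete_parseval a z u N : N.-primitive_root u ->
  \sum_(k < N) cmod (\sum_(n < N) a n * (u ^+ k * z) ^+ n) ^+ 2 =
  N%:R * \sum_(n < N) cmod (a n) ^+ 2 * cmod z ^+ n.*2.
Proof.
move=> pu; apply: (@complexI R); rewrite !rmorph_sum rmorphM rmorph_nat rmorph_sum/=.
transitivity (\sum_(k < N) \sum_(n < N) \sum_(m < N)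
   (a n * z ^+ n * (a m * z ^+ m)^*%C) * (u ^+ n * u^*%C ^+ m) ^+ k).
  apply: eq_bigr => k _; rewrite sqr_cmodC rmorph_sum mulr_suml; apply: eq_bigr => n _.
  rewrite mulr_sumr; apply: eq_bigr => m _.
  rewrite !rmorphM/= !rmorphXn/= !rmorphM/= !rmorphXn/= !exprMn -!exprM ![(_ * k)%N]mulnC; ring.
rewrite exchange_big/= mulr_sumr; apply: eq_bigr => n _.
rewrite exchange_big/= (bigD1 n)//= -mulr_sumr prim_root_orthogonal// eqxx muln1 big1 ?addr0.
  rewrite mulrC; congr (_ * _).
  by rewrite -sqr_cmodC cmodM cmodX exprMn -exprM muln2.
move=> m mn; rewrite -mulr_sumr prim_root_orthogonal//.
by rewrite (_ : (n == m :> nat) = false) ?muln0 ?mulr0//; apply/negbTE; rewrite eq_sym.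
Qed.

(** Cauchy estimate: the discrete Parseval identity for a long partial sum on the circle of radius s
    bounds a single term by the mean square, and the discarded tail costs e. *)
Lemma pser_coef_le a r s M n : geom_bounded a r -> 0 <= s -> s < r ->
  (forall z l, cmod z = s -> is_pser a z l -> cmod l <= M) -> cmod (a n) * s ^+ n <= M.
Proof.
move=> ga s0 sr hM; apply/ler_addgt0Pr => e e0.
have [N hN] := pser_tail ga s0 sr e0.
pose K := (maxn N n).+1; have NK : (N <= K)%N by rewrite /K leqW// leq_maxl.
have nK : (n < K)%N by rewrite /K ltnS leq_maxr.
have [u pu] := primitive_root_exists R (ltn0Sn (maxn N n)); rewrite -/K in pu.
have [cu _] := unity_root_conj (ltn0Sn _) (prim_expr_order pu).
have bnd k : cmod (\sum_(n < K) a n * (u ^+ k * s%:C%C) ^+ n) <= M + e.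
  set z := _ * _; have cz : cmod z = s by rewrite /z cmodM cmodX cu expr1n mul1r cmodC ger0_norm.
  have [l hl] : exists l, is_pser a z l by apply/abs_summable_cvg/(pser_abs_summable ga); rewrite cz.
  have := hN K z l NK; rewrite cz lexx => /(_ isT hl); have := hM z l cz hl.
  set p := \sum_(_ < _) _; have := ler_cmodD l (p - l).
  by rewrite addrC subrK cmodB; lra.
have Me : 0 <= M + e by apply: le_trans (bnd 0%N); exact: cmod_ge0.
rewrite -(@ler_pXn2r _ 2)// ?nnegrE ?mulr_ge0 ?cmod_ge0 ?exprn_ge0//.
have K0 : (0 : R) < K%:R by rewrite ltr0n.
rewrite -(ler_pM2l K0).
have := discrete_parseval a s%:C%C pu; rewrite cmodC ger0_norm// => H.
apply: (@le_trans _ _ (\sum_(k < K) (M + e) ^+ 2)); last by rewrite sumr_const card_ord mulr_natl.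
apply: (@le_trans _ _ (K%:R * \sum_(n < K) cmod (a n) ^+ 2 * s ^+ n.*2)).
  rewrite ler_pM2l// (bigD1 (Ordinal nK))//= exprMn -exprM muln2 lerDl sumr_ge0// => i _.
  by rewrite mulr_ge0 ?sqr_ge0// exprn_ge0.
rewrite -H; apply: ler_sum => k _.
by rewrite lerXn2r ?nnegrE ?cmod_ge0.
Qed.

(** Radius and coefficient bound are both recorded so that compactness can make them uniform in
    z. *)
Definition local_pser f z (d M : R) := exists b,
  (forall n, cmod (b n) * d ^+ n <= M) /\ forall h, cmod h < d -> is_pser b h (f (z + h)).

Lemma local_pser_le f z (d d' M M' : R) : 0 <= d' -> d' <= d -> M <= M' -> local_pser f z d M -> local_pser f z d' M'.
Proof.
move=> d0 dd MM [b [hb hf]]; exists b; split.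
  move=> n; apply: le_trans MM; apply: le_trans (hb n); rewrite ler_wpM2l ?cmod_ge0//.
  by rewrite lerXn2r ?nnegrE// (le_trans d0).
by move=> h hd; apply: hf; exact: lt_le_trans dd.
Qed.

(** Recentring the expansion at z to a nearby w keeps a radius and a coefficient bound that do not
    depend on w. *)
Lemma local_pser_near f z : analytic_on_disc f -> cmod z < 1 -> exists d M : R, 0 < d /\
  forall w, cmod (w - z) < d -> local_pser f w d M.
Proof.
move=> af z1; have [r [a [r0 ha]]] := af z z1.
pose d := Num.min r (1 - cmod z) / 4.
have d0 : 0 < d by rewrite divr_gt0// lt_min r0 subr_gt0.
have dr : 4 * d <= r by rewrite /d mulrC divfK// ge_min lexx.
have dz : 4 * d <= 1 - cmod z by rewrite /d mulrC divfK// ge_min lexx orbT.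
have hh h : cmod h < 4 * d -> is_pser a h (f (z + h)).
  move=> hd; have /ha : disc (z + h).
    by rewrite /disc/=; apply: (le_lt_trans (ler_cmodD _ _)); lra.
  rewrite addrC addKr => /(_ (lt_le_trans hd dr)) /cvg_complexP.
  by apply: cseq_cvg_eq => n; rewrite /series/= big_mkord.
have ga : geom_bounded a (4 * d) by apply: pser_cvg_radius => h /hh; exists (f (z + h)).
have d20 : 0 <= 2 * d by lra.
have d24 : 2 * d < 4 * d by lra.
have [S hS] := geom_bounded_summable ga d20 d24.
exists d, S; split=> // w wd.
have hS' n : \sum_(m < n) cmod (a m) * (cmod (w - z) + d) ^+ m <= S.
  apply: le_trans (hS n); apply: ler_sum => m _; rewrite ler_wpM2l ?cmod_ge0// lerXn2r ?nnegrE//; have := cmod_ge0 (w - z); lra.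
have [b hb1 hb2] := reexpand_exists d0 hS'.
exists b; split=> // h hd.
have -> : w + h = z + (w - z + h) by ring.
apply: (reexpand_pser ga hb1); first lra.
by apply: hh; apply: (le_lt_trans (ler_cmodD _ _)); lra.
Qed.

Lemma compact_disc r : compact [set p : R * R | cmod (complex_of_pair p) <= r].
Proof.
pose K : set (R * R) := `[-r, r]%classic `*` `[-r, r]%classic.
apply: (@subclosed_compact _ _ K).
- have [r0|r0] := leP 0 r; last first.
    rewrite (_ : mkset _ = set0); first exact: closed0.
    by apply/seteqP; split=> // p h; exfalso; have := cmod_ge0 (complex_of_pair p); rewrite leNgt (le_lt_trans h r0).
  rewrite (_ : mkset _ = (fun p : R * R => p.1 ^+ 2 + p.2 ^+ 2) @^-1` [set x | x <= r ^+ 2]); last first.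
    have E (p : R * R) : (cmod (complex_of_pair p) <= r) = (p.1 ^+ 2 + p.2 ^+ 2 <= r ^+ 2).
      by rewrite -(@ler_pXn2r _ 2)// ?nnegrE ?cmod_ge0// sqr_cmod.
    by apply/seteqP; split=> p /=; rewrite E.
  apply: closed_comp; last exact: closed_le.
  move=> p _; apply: cvgD; rewrite /= ?expr2; apply: cvgM; exact: cvg_fst + exact: cvg_snd.
- by apply: compact_setX; exact: segment_compact.
- move=> [x y] /= h; split; rewrite /= in_itv/= -ler_norml; apply: le_trans h.
  exact: (ler_Re_cmod (x +i* y)%C).
  exact: (ler_Im_cmod (x +i* y)%C).
Qed.

Lemma local_pser_uniform f r : analytic_on_disc f -> r < 1 -> exists d M : R, 0 < d /\
  forall z, cmod z <= r -> local_pser f z d M.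
Proof.
move=> af r1.
have /compact_near_coveringP := compact_disc (r := r).
(* A single integer n encodes both the radius 1/(n+1) and the bound n, so compactness along [\oo]
   chooses the two at once. *)
move=> /(_ nat \oo (fun n p => local_pser f (complex_of_pair p) n.+1%:R^-1 n%:R) _).
move=> /(_ _)[].
  move=> p /= pr; have [d [M [d0 hd]]] := local_pser_near af (le_lt_trans pr r1).
  have d20 : 0 < d / 2 by rewrite divr_gt0.
  exists (ball p (d / 2), [set n | d^-1 <= n%:R /\ M <= n%:R]).
    split=> /=; first exact: nbhsx_ballx.
    exists (maxn (Num.truncn d^-1).+1 (Num.truncn `|M|).+1) => // n /=; rewrite geq_max => /andP[n1 n2].
    split.
      by apply: le_trans (ltW (truncnS_gt _)) _; rewrite ler_nat.
    by apply: le_trans (ler_norm _) _; apply: le_trans (ltW (truncnS_gt _)) _; rewrite ler_nat.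
  move=> [p' n] /= [[b1 b2] [n1 n2]].
  apply: (local_pser_le (d := d) (M := M)) => //.
    by rewrite invf_ple ?posrE// (le_trans n1)// ler_nat.
  apply: hd; apply: (le_lt_trans (ler_cmod_ReIm _)) => /=.
  have B (x y e : R) : ball x e y -> `|y - x| < e by rewrite /ball/= distrC.
  have := B _ _ _ b1; have := B _ _ _ b2; lra.
move=> N _ hN; exists N.+1%:R^-1, N%:R; split=> [|z zr]; first by rewrite invr_gt0.
by have := hN N (leqnn N) (complex.Re z, complex.Im z); case: z zr => x y zr; apply.
Qed.

(** Let q be the supremum of the radii on which the expansion at 0 represents f. If q < 1,
    compactness gives a local radius d and a bound M common to all |z| <= q. Cauchy estimates on the
    recentred coefficients, viewed as functions of the centre, then push the radius of convergence
    beyond q, and the local expansions show that the series still represents f there. *)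
Theorem taylor f : analytic_on_disc f ->
  exists2 a, geom_bounded a 1 & forall z, cmod z < 1 -> is_pser a z (f z).
Proof.
move=> af.
have [|d0 [M0 [d00 hd0]]] := @local_pser_near f 0 af; first by rewrite cmod0.
have [|a [_ ha]] := hd0 0; first by rewrite subr0 cmod0.
pose S := [set r : R | r <= 1 /\ forall z, cmod z < r -> is_pser a z (f z)].
have S0 : S (Num.min d0 1).
  by split; [rewrite ge_min lexx orbT|move=> z; rewrite lt_min => /andP[/ha + _]; rewrite add0r].
have hS : has_sup S by split; [exists (Num.min d0 1)|exists 1 => r []].
pose q := sup S.
have q0 : 0 < q by apply: (@lt_le_trans _ _ (Num.min d0 1)); [rewrite lt_min d00 ltr01|exact: sup_upper_bound].
have Sq z : cmod z < q -> is_pser a z (f z).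
  move=> zq; have /(sup_adherent)/(_ hS)[r [r1 hr]] : 0 < q - cmod z by rewrite subr_gt0.
  by rewrite -/q subKr => zr; exact: hr.
have ga : geom_bounded a q by apply: pser_cvg_radius => z /Sq; exists (f z).
have [q1|q1] := leP 1 q.
  by exists a; [exact: geom_bounded_le ga|move=> z z1; apply: Sq; exact: lt_le_trans q1].
exfalso.
have [d1 [M [d10 hd1]]] := local_pser_uniform af q1.
pose d := Num.min d1 q.
have d0' : 0 < d by rewrite lt_min d10 q0.
have dq : d <= q by rewrite ge_min lexx orbT.
have hd z : cmod z <= q -> local_pser f z d M.
  by move=> /hd1; apply: local_pser_le => //; [exact: ltW|rewrite ge_min lexx].
(* By uniqueness near w the recentred coefficients coincide with the local ones, and so inherit the
   bound M uniformly in w. *)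
have reexp w : cmod w < q -> exists c, [/\ reexpand a w c, (forall n, cmod (c n) * d ^+ n <= M) &
     forall h, cmod h < d -> is_pser c h (f (w + h))].
  move=> wq; have [b [hb hf]] := hd w (ltW wq).
  pose t := (q - cmod w) / 2; have t0 : 0 < t by rewrite divr_gt0// subr_gt0.
  have wt0 : 0 <= cmod w + t by rewrite addr_ge0 ?cmod_ge0 ?ltW.
  have wtq : cmod w + t < q by rewrite /t; lra.
  have [T hT] := geom_bounded_summable ga wt0 wtq.
  have [c hc hcT] := reexpand_exists t0 hT.
  have bc n : b n - c n = 0.
    pose m := Num.min d t; have m0 : 0 < m by rewrite lt_min d0' t0.
    have gb : geom_bounded b m by apply: pser_cvg_radius => h hm; exists (f (w + h)); apply: hf; apply: lt_le_trans hm _; rewrite ge_min lexx.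
    have hc' h : cmod h < m -> is_pser c h (f (w + h)).
      rewrite lt_min => /andP[_ ht]; apply: (reexpand_pser ga hc); first lra.
      by apply: Sq; apply: (le_lt_trans (ler_cmodD _ _)); lra.
    have hbc h : cmod h < m -> is_pser (fun n => b n - c n) h 0.
      move=> hm; have := has_csumD (hf h _) (has_csumZ (-1) (hc' h hm)).
      rewrite mulN1r subrr => /(_ (lt_le_trans hm _)); rewrite ge_min lexx => /(_ isT).
      by apply: cseq_cvg_eq => k; apply: eq_bigr => i _; ring.
    apply: (@pser_unique R (fun n => b n - c n) m) => //.
      by apply: pser_cvg_radius => h /hbc; exists 0.
    move=> e e0; pose x : R := Num.min e m / 2.
    have x0 : 0 < x by rewrite divr_gt0// lt_min e0 m0.
    have xx : x < Num.min e m by have : 0 < Num.min e m; [rewrite lt_min e0 m0|rewrite /x; lra].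
    exists x%:C%C; move: xx; rewrite lt_min => /andP[xe xm].
    rewrite cmodC gtr0_norm//; split=> //; last by apply: hbc; rewrite cmodC gtr0_norm.
    by rewrite -cmod_gt0 cmodC gtr0_norm.
  have cb : c = b by apply/funext => n; apply/esym/eqP; rewrite -subr_eq0 bc.
  by exists b; split=> //; rewrite -cb.
(* The n-th recentred coefficient is a power series in the centre w with coefficients a_(n+N) C(n+N,
   n), so the Cauchy estimate applies to it. *)
have coef N n s : 0 <= s -> s < q -> (cmod (a (n + N)%N) *+ 'C(n + N, n)) * s ^+ N * d ^+ n <= M.
  move=> s0 sq; rewrite -ler_pdivlMr ?exprn_gt0//.
  pose a' k := a (n + k)%N *+ 'C(n + k, n).
  have ha' w : cmod w < q -> exists2 c, is_pser a' w c & cmod c * d ^+ n <= M.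
    move=> /reexp[c [hc hM _]]; exists (c n) => // e e0; have [K hK] := hc n e e0.
    exists K => k Kk; have := hK (n + k)%N (leq_trans Kk (leq_addl _ _)).
    rewrite big_split_ord/= big1 ?add0r; last by move=> i _; rewrite bin_small ?mulr0n ?mulr0.
    congr (cmod (_ - _) < _); apply: eq_bigr => i _.
    by rewrite /a' addKn mulrnAl mulrnAr.
  rewrite -cmodMn -/(a' N); apply: (pser_coef_le (r := q)) => //.
    by apply: pser_cvg_radius => w /ha'[c]; exists c.
  move=> z l zs hl; have [|c hc hcM] := ha' z; first by rewrite zs.
  by rewrite (cseq_cvg_unique hl hc) ler_pdivlMr ?exprn_gt0.
(* With this s the radius s + d/2 exceeds q by d/4. *)
pose s := q - d / 4.
have s0 : 0 < s by rewrite /s; lra.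
have sq : s < q by rewrite /s; lra.
pose q' := Num.min (s + d / 2) 1.
have qq' : q < q' by rewrite lt_min q1 andbT /s; lra.
(* Summing the coefficient estimates of fixed total degree N with weights 2^-n rebuilds (s + d/2)^N
   by the binomial formula, at the cost of a factor 2. *)
have ga' : geom_bounded a (s + d / 2).
  move=> t t0 tq; exists (2 * M) => N; apply: (@le_trans _ _ (cmod (a N) * (s + d / 2) ^+ N)).
    by rewrite ler_wpM2l ?cmod_ge0// lerXn2r ?nnegrE// ltW// (le_lt_trans t0).
  rewrite -(binomial_truncE _ _ (ltnSn N)) mulr_sumr.
  have Mn0 : 0 <= M by apply: le_trans (coef 0%N 0%N 0 (lexx 0) q0); rewrite expr0 !mulr1 mulrn_wge0// cmod_ge0.
  apply: (@le_trans _ _ (\sum_(n < N.+1) M * (2^-1) ^+ n)); last first.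
    have h2 : 0 <= (2^-1 : R) < 1 by lra.
    rewrite -mulr_sumr mulrC ler_wpM2r//; apply: (le_trans (geometric_le N.+1 h2)).
    by rewrite (_ : 1 - 2^-1 = 2^-1 :> R) ?invrK//; lra.
  apply: ler_sum => n _; have nN : (n <= N)%N by rewrite -ltnS.
  have := coef (N - n)%N n s (ltW s0) sq; rewrite subnKC// => H.
  have h2 : (0 : R) <= (2^-1) ^+ n by rewrite exprn_ge0// invr_ge0.
  apply: le_trans (ler_wpM2r h2 H); rewrite exprMn le_eqVlt; apply/orP; left; apply/eqP.
  rewrite -[X in _ * X = _]mulr_natr -[X in _ = X * _ * _ * _]mulr_natr; ring.
have : S q'.
  split; first by rewrite ge_min lexx orbT.
  move=> z; rewrite lt_min => /andP[zq' _]; have [zq|zq] := ltP (cmod z) q; first exact: Sq.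
  have z0 : 0 < cmod z by exact: lt_le_trans zq.
  (* The point of modulus s on the segment from 0 to z; its local expansion still reaches z. *)
  pose w := (s / cmod z)%:C%C * z.
  have cw : cmod w = s by rewrite /w cmodM cmodC ger0_norm ?divr_ge0 ?(ltW s0) ?(ltW z0)// divfK ?gt_eqF.
  have zw : cmod (z - w) = cmod z - s.
    have -> : z - w = (1 - s / cmod z)%:C%C * z by rewrite [in RHS]rmorphB/= [RHS]mulrBl; congr (_ - _); exact/esym/mul1r.
    rewrite cmodM cmodC ger0_norm; first by field; rewrite gt_eqF.
    by rewrite subr_ge0 ler_pdivrMr// mul1r; lra.
  have [|c [hc _ hcf]] := reexp w; first by rewrite cw.
  have [l hl] : exists l, is_pser a z l by apply/abs_summable_cvg/(pser_abs_summable ga').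
  have := hcf (z - w); rewrite zw [w + _]addrC subrK => hf.
  have hl' : is_pser c (z - w) l.
    by apply: (reexpand_pser ga' hc); [rewrite cw zw; lra|rewrite addrC subrK].
  by rewrite -(cseq_cvg_unique hl' (hf _))//; lra.
by move=> /(sup_upper_bound hS); rewrite -/q leNgt qq'.
Qed.

Lemma pser_analytic a f : geom_bounded a 1 -> (forall z, cmod z < 1 -> is_pser a z (f z)) -> analytic_on_disc f.
Proof.
move=> ga hf w w1; pose d := (1 - cmod w) / 2.
have w1' : cmod w < 1 by [].
have d0 : 0 < d by rewrite divr_gt0// subr_gt0.
have wd0 : 0 <= cmod w + d by rewrite addr_ge0 ?cmod_ge0 ?ltW.
have wd1 : cmod w + d < 1 by rewrite /d; lra.
have [S hS] := geom_bounded_summable ga wd0 wd1.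
have [b hb _] := reexpand_exists d0 hS.
exists d, b; split=> // z z1 zw; apply/cvg_complexP.
have : is_pser b (z - w) (f z).
  by apply: (reexpand_pser ga hb); [lra|rewrite addrC subrK; apply: hf].
by apply: cseq_cvg_eq => n; rewrite /series/= big_mkord.
Qed.

End taylor.

                                    

(** * Rotation invariance of area, and measurability of complex functions *)

Section rotation.
Variable R : realType.

                                              
(** A rotation is a product of three shears, with slopes t, s, t for t = -s/(1+c), the middle one in
    the other coordinate. Each preserves area by Fubini. For the half-turn c = -1 the slope t would
    be infinite. *)
Lemma ge0_integral_rotation (c s : R) (F : R * R -> \bar R) :
  c ^+ 2 + s ^+ 2 = 1 -> c != -1 ->
  measurable_fun setT F -> (forall x, (0 <= F x)%E) ->
  (\int[lebesgue_measure \x lebesgue_measure]_p F (c * p.1 - s * p.2, s * p.1 + c * p.2)%R =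
   \int[lebesgue_measure \x lebesgue_measure]_p F p)%E.
Proof.
move=> cs c1 mF F0; pose t := - s / (1 + c).
have c1' : 1 + c != 0 by rewrite addrC addr_eq0.
have msh (x : R) : measurable_fun setT (fun p : R * R => (p.1 + x * p.2, p.2)%R).
  apply: measurable_fun_pair => //.
  by apply: measurable_funD => //; apply: measurable_funM.
have msw : measurable_fun setT (fun p : R * R => (p.2, p.1)).
  by apply: measurable_fun_pair.
have ts : t * (1 + c) = - s by rewrite /t divfK.
have E1 : (1 + s * t = c)%R.
  by apply: (mulIf c1'); rewrite mulrDl -mulrA ts; lra.
have E2 : (t + t * c = - s)%R by rewrite -ts; ring.
rewrite -[RHS](ge0_integral_shear t)//.
pose F1 (p : R * R) := F (p.1 + t * p.2, p.2)%R.
have mF1 : measurable_fun setT F1 by apply: measurableT_comp mF (msh t).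
rewrite -[RHS](@ge0_integral_swap R F1)//; last by move=> x; exact: F0.
pose F2 (p : R * R) := F1 (p.2, p.1).
have mF2 : measurable_fun setT F2 by apply: measurableT_comp mF1 msw.
rewrite -[RHS](@ge0_integral_shear R s F2)//; last by move=> x; exact: F0.
pose F3 (p : R * R) := F2 (p.1 + s * p.2, p.2)%R.
have mF3 : measurable_fun setT F3 by apply: measurableT_comp mF2 (msh s).
rewrite -[RHS](@ge0_integral_swap R F3)//; last by move=> x; exact: F0.
pose F4 (p : R * R) := F3 (p.2, p.1).
have mF4 : measurable_fun setT F4 by apply: measurableT_comp mF3 msw.
rewrite -[RHS](@ge0_integral_shear R t F4)//; last by move=> x; exact: F0.
apply: eq_integral => p _; rewrite /F4 /F3 /F2 /F1/=; congr (F (_, _)).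
  by transitivity ((1 + s * t) * p.1 + (t + t * (1 + s * t)) * p.2); [rewrite E1 E2; ring|ring].
by rewrite -E1; ring.
Qed.

Lemma area_rotation (u : R[i]) (G : R[i] -> \bar R) : cmod u = 1 -> u != -1 ->
  measurable_fun (@pair_disc R) (fun p => G (complex_of_pair p)) -> (forall z, cmod z < 1 -> (0 <= G z)%E) ->
  (\int[@area_measure R]_(p in @pair_disc R) G (u * complex_of_pair p)%R =
   \int[@area_measure R]_(p in @pair_disc R) G (complex_of_pair p))%E.
Proof.
case: u => c s cu u1 mG G0.
have cs : c ^+ 2 + s ^+ 2 = 1 by rewrite -(sqr_cmod (c +i* s)%C) cu expr1n.
have c1 : c != -1.
  apply: contra u1 => /eqP c1; rewrite eq_complex /= c1 eqxx/=.
  by rewrite c1 sqrrN expr1n in cs; rewrite oppr0 -sqrf_eq0; apply/eqP; lra.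
have mrot : measurable_fun setT (fun p : R * R => (c * p.1 - s * p.2, s * p.1 + c * p.2)%R).
  apply: measurable_fun_pair.
    by apply: measurable_funB; apply: measurable_funM.
  by apply: measurable_funD; apply: measurable_funM.
have rotE (p : R * R) : (c +i* s)%C * complex_of_pair p = complex_of_pair (c * p.1 - s * p.2, s * p.1 + c * p.2)%R.
  by rewrite /complex_of_pair/=; apply/eqP; rewrite eq_complex/= eqxx/= addrC eqxx.
have rotD (p : R * R) : pair_disc (c * p.1 - s * p.2, s * p.1 + c * p.2)%R <-> pair_disc p.
  by rewrite /pair_disc /disc /mkset -rotE cmodM cu mul1r.
pose rot (p : R * R) := (c * p.1 - s * p.2, s * p.1 + c * p.2)%R.
rewrite (_ : (fun p => G ((c +i* s)%C * _)) = (fun p => G (complex_of_pair p)) \o rot); last first.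
  by apply/funext => p; rewrite rotE.
have mGr : measurable_fun (@pair_disc R) ((fun p => G (complex_of_pair p)) \o rot).
  apply: (measurable_comp (F := @pair_disc R)) => //; first exact: measurable_pair_disc.
    by move=> _ [p pD <-]; apply/rotD.
  exact: measurable_funS mrot.
rewrite !ge0_integral_area//; first 1 last.
- exact: measurable_pair_disc.
- by move=> p pD; exact: G0.
- exact: measurable_pair_disc.
- by move=> p pD; apply: G0; apply/rotD.
congr (_ * _)%E; rewrite [LHS]integral_mkcond [RHS]integral_mkcond.
rewrite -[RHS](@ge0_integral_rotation c s)//.
- apply: eq_integral => p _; rewrite !patchE.
  by rewrite (_ : (rot p \in pair_disc) = (p \in pair_disc))//; apply/idP/idP; rewrite !inE => /rotD.
- exact/(measurable_restrictT _ (@measurable_pair_disc R)).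
- by move=> p; rewrite patchE; case: ifPn => //; rewrite inE => /G0.
Qed.

End rotation.

Section measurable_complex.
Context d (T : measurableType d) (R : realType).
Implicit Types (f g : T -> R[i]) (D : set T).

Definition cmeasurable D f := measurable_fun D (fun x => complex.Re (f x)) /\ measurable_fun D (fun x => complex.Im (f x)).

Lemma cmeasurable_cst D (z : R[i]) : cmeasurable D (fun=> z).
Proof. by split; exact: measurable_cst. Qed.

Lemma cmeasurableD D f g : cmeasurable D f -> cmeasurable D g -> cmeasurable D (fun x => f x + g x).
Proof.
move=> [f1 f2] [g1 g2]; split.
  by under eq_fun do rewrite raddfD; exact: measurable_funD.
by under eq_fun do rewrite raddfD; exact: measurable_funD.
Qed.

Lemma cmeasurableM D f g : cmeasurable D f -> cmeasurable D g -> cmeasurable D (fun x => f x * g x).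
Proof.
move=> [f1 f2] [g1 g2]; split.
  rewrite (_ : (fun x => _) = (fun x => complex.Re (f x) * complex.Re (g x) - complex.Im (f x) * complex.Im (g x))).
    by apply: measurable_funB; apply: measurable_funM.
  by apply/funext => x; case: (f x) => ? ?; case: (g x).
rewrite (_ : (fun x => _) = (fun x => complex.Re (f x) * complex.Im (g x) + complex.Im (f x) * complex.Re (g x))).
  by apply: measurable_funD; apply: measurable_funM.
by apply/funext => x; case: (f x) => ? ?; case: (g x).
Qed.

Lemma cmeasurable_sum D n (F : nat -> T -> R[i]) : (forall i, cmeasurable D (F i)) ->
  cmeasurable D (fun x => \sum_(i < n) F i x).
Proof.
move=> mF; elim: n => [|n IH].
  by under eq_fun do rewrite big_ord0; exact: cmeasurable_cst.
by under eq_fun do rewrite big_ord_recr/=; exact: cmeasurableD.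
Qed.

Lemma cmeasurableX D f n : cmeasurable D f -> cmeasurable D (fun x => f x ^+ n).
Proof.
move=> mf; elim: n => [|n IH]; first by under eq_fun do rewrite expr0; exact: cmeasurable_cst.
by under eq_fun do rewrite exprS; exact: cmeasurableM.
Qed.

Lemma cmeasurable_poly D f (a : nat -> R[i]) n : cmeasurable D f -> cmeasurable D (fun x => \sum_(i < n) a i * f x ^+ i).
Proof.
move=> mf; apply: (cmeasurable_sum n (F := fun i x => a i * f x ^+ i)) => i.
by apply: cmeasurableM; [exact: cmeasurable_cst|exact: cmeasurableX].
Qed.

Lemma cmeasurable_lim D (F : nat -> T -> R[i]) f : (forall n, cmeasurable D (F n)) ->
  (forall x, D x -> cseq_cvg (F ^~ x) (f x)) -> cmeasurable D f.
Proof.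
move=> mF h; split.
  apply: (@measurable_fun_cvg _ _ _ D (fun n x => complex.Re (F n x))); first by move=> n; have [] := mF n.
  by move=> x /h /cseq_cvgP[].
apply: (@measurable_fun_cvg _ _ _ D (fun n x => complex.Im (F n x))); first by move=> n; have [] := mF n.
by move=> x /h /cseq_cvgP[].
Qed.

Lemma measurable_sqr_cmod D f : cmeasurable D f -> measurable_fun D (fun x => cmod (f x) ^+ 2).
Proof.
move=> [f1 f2]; under eq_fun do rewrite sqr_cmod.
by apply: measurable_funD; apply: measurable_funX.
Qed.

End measurable_complex.

Lemma cmeasurable_complex_of_pair (R : realType) (D : set (R * R)) : cmeasurable D (@complex_of_pair R).
Proof. by split; apply: measurable_funS (measurable_fst : measurable_fun setT _) || apply: measurable_funS (measurable_snd : measurable_fun setT _). Qed.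

                                                   

(** * Parseval formula, moments, and the series of the Bergman kernel *)

Section parseval.
Variables (R : realType) (c : R).
Hypothesis c0 : 0 < c.
Hypothesis radial : forall k : R -> \bar R,
  measurable_fun (`[0, 1[%classic : set R) k -> (forall r : R, 0 <= r < 1 -> (0 <= k r)%E) ->
  (\int[@area_measure R]_(p in @pair_disc R) k (cmod (complex_of_pair p)) =
   c%:E * \int[lebesgue_measure]_(r in `[0%R, 1%R[) (k r * r%:E))%E.
Implicit Types (a : nat -> R[i]) (v : R -> R).

Lemma measurable_radial (k : R -> R) : measurable_fun (`[0, 1[%classic : set R) k ->
  measurable_fun (@pair_disc R) (fun p => k (cmod (complex_of_pair p))).
Proof.
move=> mk; rewrite pair_discE; apply: (measurable_comp (measurable_itv (Interval (BLeft 0) (BLeft 1)))) => //.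
  by move=> r [p] + <-.
exact: measurable_funS (@measurable_cmod R).
Qed.

(** Rotating by the N-th roots of unity does not change the left integral, and the average of the
    rotated integrands is the radial integrand on the right. N > 2 keeps the primitive root away
    from -1, where the decomposition into shears fails. *)
Lemma poly_parseval a v N : (2 < N)%N -> measurable_fun (`[0, 1[%classic : set R) v ->
  (forall r, 0 <= r < 1 -> 0 <= v r) ->
  (\int[@area_measure R]_(p in @pair_disc R) (cmod (\sum_(n < N) a n * complex_of_pair p ^+ n) ^+ 2 * v (cmod (complex_of_pair p)))%:E =
   \int[@area_measure R]_(p in @pair_disc R) ((\sum_(n < N) cmod (a n) ^+ 2 * cmod (complex_of_pair p) ^+ n.*2) * v (cmod (complex_of_pair p)))%:E)%E.
Proof.
move=> N2 mv v0; have N0 : (0 < N)%N by apply: leq_trans N2.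
have [u pu] := primitive_root_exists R N0.
have [cu _] := unity_root_conj N0 (prim_expr_order pu).
have u1 : u != -1.
  apply/eqP => u1; have := prim_order_dvd pu 2; rewrite u1 sqrrN expr1n eqxx => /(dvdn_leq (ltn0Sn 1)).
  by rewrite leqNgt N2.
pose G (z : R[i]) := (cmod (\sum_(n < N) a n * z ^+ n) ^+ 2 * v (cmod z))%:E.
have v0' z : cmod z < 1 -> 0 <= v (cmod z) by move=> z1; rewrite v0// cmod_ge0.
have G0 z : cmod z < 1 -> (0 <= G z)%E.
  by move=> z1; rewrite lee_fin mulr_ge0 ?sqr_ge0// v0'.
have mG k : measurable_fun (@pair_disc R) (fun p => G (u ^+ k * complex_of_pair p)).
  apply/measurable_EFinP; apply: measurable_funM.
    apply: measurable_sqr_cmod; apply: cmeasurable_poly; apply: cmeasurableM; first exact: cmeasurable_cst.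
    exact: cmeasurable_complex_of_pair.
  by under eq_fun do rewrite cmodM cmodX cu expr1n mul1r; exact: measurable_radial.
have IG k : (\int[@area_measure R]_(p in @pair_disc R) G (u ^+ k * complex_of_pair p)%R =
   \int[@area_measure R]_(p in @pair_disc R) G (complex_of_pair p))%E.
  elim: k => [|k IH]; first by apply: eq_integral => p _; rewrite expr0 mul1r.
  rewrite -IH -(@area_rotation R u (fun z => G (u ^+ k * z)))//.
    by apply: eq_integral => p _; rewrite exprSr mulrA.
  by move=> z z1; apply: G0; rewrite cmodM cmodX cu expr1n mul1r.
have NR0 : N%:R != 0 :> R by rewrite pnatr_eq0 -lt0n.
pose H (p : R * R) := ((\sum_(n < N) cmod (a n) ^+ 2 * cmod (complex_of_pair p) ^+ n.*2) * v (cmod (complex_of_pair p)))%:E.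
have mH : measurable_fun (@pair_disc R) H.
  apply/measurable_EFinP; apply: measurable_funM; last exact: measurable_radial.
  apply: (measurable_radial (k := fun r => \sum_(n < N) cmod (a n) ^+ 2 * r ^+ n.*2)).
  by apply: measurable_sum => n; apply: measurable_funM.
have H0 p : pair_disc p -> (0 <= H p)%E.
  move=> pD; rewrite lee_fin mulr_ge0 ?v0'// sumr_ge0// => i _.
  by rewrite mulr_ge0 ?sqr_ge0// exprn_ge0// cmod_ge0.
suff : (N%:R%:E * \int[@area_measure R]_(p in @pair_disc R) G (complex_of_pair p) =
        N%:R%:E * \int[@area_measure R]_(p in @pair_disc R) H p)%E.
  move=> /(congr1 (mule (N%:R^-1)%:E)); rewrite !muleA -!EFinM mulVf// !mul1e.
  exact.
have sumc (x : \bar R) n : (0 <= x)%E -> (\sum_(k < n) x = n%:R%:E * x)%E.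
  move=> x0; elim: n => [|n IH]; first by rewrite big_ord0 mul0e.
  by rewrite big_ord_recr/= IH -natr1 EFinD ge0_muleDl ?mul1e ?lee_fin.
rewrite -[RHS]ge0_integralZl_EFin; [|exact: measurable_pair_disc|exact: H0|exact: mH|by rewrite ler0n].
transitivity (\sum_(k < N) \int[@area_measure R]_(p in @pair_disc R) G (u ^+ k * complex_of_pair p)%R)%E.
  rewrite (eq_bigr (fun=> \int[@area_measure R]_(p in @pair_disc R) G (complex_of_pair p))%E); last by move=> k _.
  by rewrite sumc//; apply: integral_ge0 => p /G0.
rewrite -ge0_integral_sum//; last 2 first.
- by move=> k; exact: mG.
- by move=> k p pD; apply: G0; rewrite cmodM cmodX cu expr1n mul1r.
apply: eq_integral => p _; rewrite /G /H -EFinM sumEFin; congr EFin.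
under eq_bigr do rewrite [cmod (_ * complex_of_pair p)]cmodM cmodX cu expr1n mul1r.
by rewrite -mulr_suml discrete_parseval// mulrA.
exact: measurable_pair_disc.
Qed.

Lemma ge0_integral_radial (k : R -> R) : measurable_fun (`[0, 1[%classic : set R) k ->
  (forall r : R, 0 <= r < 1 -> 0 <= k r) ->
  (\int[@area_measure R]_(p in @pair_disc R) (k (cmod (complex_of_pair p)))%:E =
   c%:E * \int[lebesgue_measure]_(r in `[0%R, 1%R[) (k r * r)%:E)%E.
Proof.
move=> mk k0; apply: (radial (k := EFin \o k)).
  exact/measurable_EFinP.
by move=> r /k0.
Qed.

(** A weight cut off at rho < 1 lives where the partial sums are uniformly bounded, so dominated
    convergence passes from polynomials to f. *)
Lemma trunc_parseval a f v (rho : R) : (forall z, cmod z < 1 -> is_pser a z (f z)) ->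
  lebesgue_measure.-integrable `[0, 1[ (EFin \o v) ->
  (forall r, 0 <= r < 1 -> 0 <= v r) ->
  rho < 1 -> (forall r, rho <= r -> v r = 0) ->
  (\int[@area_measure R]_(p in @pair_disc R) (cmod (f (complex_of_pair p)) ^+ 2 * v (cmod (complex_of_pair p)))%:E =
   \int[@area_measure R]_(p in @pair_disc R) \sum_(0 <= n <oo) (cmod (a n) ^+ 2 * cmod (complex_of_pair p) ^+ n.*2 * v (cmod (complex_of_pair p)))%:E)%E.
Proof.
move=> hf iv v0 rho1 vrho.
have mv : measurable_fun (`[0, 1[%classic : set R) v.
  by have /measurable_int/measurable_EFinP := iv.
have mD := @measurable_pair_disc R.
have ga : geom_bounded a 1 by apply: pser_cvg_radius => z /hf; exists (f z).
have v0' z : cmod z < 1 -> 0 <= v (cmod z) by move=> z1; rewrite v0// cmod_ge0.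
pose s := Num.max rho 0.
have s0 : 0 <= s by rewrite le_max lexx orbT.
have s1 : s < 1 by rewrite gt_max rho1 ltr01.
have [S hS] := geom_bounded_summable ga s0 s1.
pose F N (p : R * R) := (cmod (\sum_(n < N) a n * complex_of_pair p ^+ n) ^+ 2 * v (cmod (complex_of_pair p)))%:E.
pose g (p : R * R) := (S ^+ 2 * v (cmod (complex_of_pair p)))%:E.
have mP N : cmeasurable (@pair_disc R) (fun p => \sum_(n < N) a n * complex_of_pair p ^+ n).
  by apply: cmeasurable_poly; exact: cmeasurable_complex_of_pair.
have mF N : measurable_fun (@pair_disc R) (F N).
  apply/measurable_EFinP; apply: measurable_funM; last exact: measurable_radial.
  exact: measurable_sqr_cmod.
have mf : measurable_fun (@pair_disc R) (fun p => (cmod (f (complex_of_pair p)) ^+ 2 * v (cmod (complex_of_pair p)))%:E).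
  apply/measurable_EFinP; apply: measurable_funM; last exact: measurable_radial.
  apply: measurable_sqr_cmod; apply: cmeasurable_lim mP _.
  by move=> p pD; exact: hf.
have Fg N p : pair_disc p -> (`|F N p| <= g p)%E.
  move=> pD; rewrite gee0_abs ?lee_fin; last by rewrite mulr_ge0 ?sqr_ge0// v0'.
  have [pr|pr] := ltP (cmod (complex_of_pair p)) rho; last by rewrite vrho// !mulr0.
  apply: ler_wpM2r; first exact: v0'.
  have h : cmod (\sum_(n < N) a n * complex_of_pair p ^+ n) <= S.
    apply: le_trans (hS N); apply: le_trans (ler_cmod_sum _ _ _) _; apply: ler_sum => i _.
    rewrite cmodM cmodX ler_wpM2l ?cmod_ge0// lerXn2r ?nnegrE ?cmod_ge0//.
    by rewrite le_max (ltW pr).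
  by rewrite lerXn2r ?nnegrE ?cmod_ge0// (le_trans (cmod_ge0 _) h).
have ig : (@area_measure R).-integrable (@pair_disc R) g.
  apply/integrableP; split.
    by apply/measurable_EFinP; apply: measurable_funM => //; exact: measurable_radial.
  have -> : (\int[@area_measure R]_(p in @pair_disc R) `|g p| = \int[@area_measure R]_(p in @pair_disc R) g p)%E.
    by apply: eq_integral => p; rewrite inE => pD; rewrite gee0_abs// lee_fin mulr_ge0 ?sqr_ge0// v0'.
  rewrite (ge0_integral_radial (k := fun r => S ^+ 2 * v r)); last 2 first.
  - exact: measurable_funM.
  - by move=> r r1; rewrite mulr_ge0 ?sqr_ge0 ?v0.
  have : (\int[lebesgue_measure]_(r in `[0%R, 1%R[) (S ^+ 2 * v r * r)%:E < +oo)%E.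
    apply: (@le_lt_trans _ _ (\int[lebesgue_measure]_(r in `[0%R, 1%R[) ((S ^+ 2)%:E * (v r)%:E))%E).
      apply: ge0_le_integral => //.
      - by move=> r; rewrite /= in_itv/= => /[dup] /v0 vr /andP[r0 r1]; rewrite lee_fin; apply: mulr_ge0 => //; apply: mulr_ge0 => //; exact: sqr_ge0.
      - by apply/measurable_EFinP; apply: measurable_funM => //; apply: measurable_funM.
      - by apply/measurable_EFinP; apply: measurable_funM.
      - move=> r; rewrite /= in_itv/= => /[dup] /v0 vr /andP[r0 r1]; rewrite -EFinM lee_fin -mulrA ler_wpM2l ?sqr_ge0//.
        by rewrite -[leRHS]mulr1 ler_wpM2l// ltW.
    rewrite integralZl//.
    have /fineK <- : (\int[lebesgue_measure]_(r in `[0%R, 1%R[) (v r)%:E)%E \is a fin_num.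
      exact: integrable_fin_num iv.
    by rewrite -EFinM ltry.
  have : (0 <= \int[lebesgue_measure]_(r in `[0%R, 1%R[) (S ^+ 2 * v r * r)%:E)%E.
    apply: integral_ge0 => r; rewrite /= in_itv/= => /[dup] /v0 vr /andP[r0 r1].
    by rewrite lee_fin; apply: mulr_ge0 => //; apply: mulr_ge0 => //; exact: sqr_ge0.
  by case: (\int[_]_(_ in _) _)%E => // x _ _; rewrite -EFinM ltry.
(* The shift by 3 keeps the number of terms in the range N > 2 of [poly_parseval]. *)
have ptw p : pair_disc p -> F (N + 3)%N p @[N --> \oo] --> (cmod (f (complex_of_pair p)) ^+ 2 * v (cmod (complex_of_pair p)))%:E.
  move=> pD; rewrite (cvg_shiftn 3 (fun N => F N p)); apply/cvg_EFin; first by near=> N.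
  rewrite /comp/=; apply: cvgM; last exact: cvg_cst.
  have /cseq_cvgP[hr hi] := hf _ pD.
  rewrite (_ : (fun N => _) = fun N => (complex.Re (\sum_(n < N) a n * complex_of_pair p ^+ n) ^+ 2 + complex.Im (\sum_(n < N) a n * complex_of_pair p ^+ n) ^+ 2)); last first.
    by apply/funext => N; rewrite sqr_cmod.
  by rewrite sqr_cmod; apply: cvgD; rewrite expr2; under eq_fun do rewrite expr2; apply: cvgM.
have [_ _] := @dominated_convergence _ _ R (@area_measure R) (@pair_disc R) mD (fun N => F (N + 3)%N) _ g (fun N => mF (N + 3)%N) mf (aeW (@area_measure R) ptw) ig (aeW (@area_measure R) (fun p N pD => Fg (N + 3)%N _ pD)).
pose H n (p : R * R) := (cmod (a n) ^+ 2 * cmod (complex_of_pair p) ^+ n.*2 * v (cmod (complex_of_pair p)))%:E.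
have mH n : measurable_fun (@pair_disc R) (H n).
  apply/measurable_EFinP; apply: (measurable_radial (k := fun r => cmod (a n) ^+ 2 * r ^+ n.*2 * v r)).
  by apply: measurable_funM => //; apply: measurable_funM.
have H0 n p : pair_disc p -> (0 <= H n p)%E.
  by move=> pD; rewrite lee_fin !mulr_ge0 ?sqr_ge0 ?exprn_ge0 ?cmod_ge0 ?v0'.
rewrite (_ : [sequence _]_N = fun N => (\sum_(0 <= n < N + 3) \int[@area_measure R]_(p in @pair_disc R) H n p)%E); last first.
  apply/funext => N /=; rewrite poly_parseval//; last by rewrite addn3.
  rewrite -ge0_integral_sum//; apply: eq_integral => p _.
  by rewrite big_mkord sumEFin mulr_suml.
rewrite (cvg_shiftn 3 (fun N => (\sum_(0 <= n < N) \int[@area_measure R]_(p in @pair_disc R) H n p)%E)) => cv.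
rewrite integral_nneseries//.
apply/esym/cvg_lim => //.
Unshelve. all: by end_near.
Qed.

Definition moment (w : R -> R) n : R := \int[@lebesgue_measure R]_(r in `[0, 1[) (w r * r ^+ n).

Lemma integrable_moment w n : radial_weight w ->
  (@lebesgue_measure R).-integrable `[0, 1[ (fun r => (w r * r ^+ n)%:E).
Proof.
move=> [w0 iw _]; have mw : measurable_fun (`[0, 1[%classic : set R) w.
  by have /measurable_int/measurable_EFinP := iw.
apply: (le_integrable _ _ _ iw) => //.
  by apply/measurable_EFinP; apply: measurable_funM.
move=> r; rewrite /= in_itv/= => /andP[r0 r1]; rewrite lee_fin normrM ler_piMr//.
by rewrite normrX ger0_norm// exprn_ile1// ltW.
Qed.

Lemma momentE w n : radial_weight w ->
  (moment w n)%:E = (\int[@lebesgue_measure R]_(r in `[0%R, 1%R[) (w r * r ^+ n)%:E)%E.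
Proof.
move=> hw; rewrite /moment/= /Rintegral fineK//.
exact: integrable_fin_num (integrable_moment n hw).
Qed.

(** The truncated identity holds on each disc of radius 1 - 1/(j+1); monotone convergence takes both
    sides to the full disc, and the series is then integrated term by term in polar form. *)
Lemma parseval a f w : radial_weight w -> (forall z, cmod z < 1 -> is_pser a z (f z)) ->
  bergman_sqnorm w f = (\sum_(0 <= n <oo) (c * (cmod (a n) ^+ 2 * moment w n.*2.+1))%:E)%E.
Proof.
move=> hw hf; have [w0 iw _] := hw.
have mw : measurable_fun (`[0, 1[%classic : set R) w.
  by have /measurable_int/measurable_EFinP := iw.
have mD := @measurable_pair_disc R.
have w0' z : cmod z < 1 -> 0 <= w (cmod z) by move=> z1; rewrite w0// cmod_ge0.
pose rho j : R := 1 - j.+1%:R^-1.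
have rho1 j : rho j < 1 by rewrite /rho ltrBlDr ltrDl invr_gt0.
pose F j : set (R * R) := [set p | cmod (complex_of_pair p) < rho j].
have FD j : F j `<=` @pair_disc R by move=> p /= pj; apply: lt_trans pj (rho1 j).
have mF j : measurable (F j).
  rewrite (_ : F j = (fun p : R * R => cmod (complex_of_pair p)) @^-1` `]-oo, rho j[); last first.
    by apply/seteqP; split=> p /=; rewrite in_itv.
  by rewrite -[X in measurable X]setTI; exact: measurable_cmod.
have bF : \bigcup_j F j = @pair_disc R.
  apply/seteqP; split=> [p [j _]|p pD]; first exact: FD.
  have h : 0 < 1 - cmod (complex_of_pair p) by rewrite subr_gt0.
  exists (Num.truncn (1 - cmod (complex_of_pair p))^-1) => //=.
  rewrite /F/= /rho ltrBrDr -ltrBrDl invf_plt ?posrE//.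
  exact: truncnS_gt.
have ndF : {homo F : n m / (n <= m)%N >-> (n <= m)%O}.
  move=> n m nm; apply/subsetPset => p /= pn; apply: lt_le_trans pn _.
  by rewrite /rho lerD2l lerN2 lef_pV2 ?posrE// ler_nat.
pose g (p : R * R) := (cmod (f (complex_of_pair p)) ^+ 2 * w (cmod (complex_of_pair p)))%:E.
pose H n (p : R * R) := (cmod (a n) ^+ 2 * cmod (complex_of_pair p) ^+ n.*2 * w (cmod (complex_of_pair p)))%:E.
have mP N : cmeasurable (@pair_disc R) (fun p => \sum_(n < N) a n * complex_of_pair p ^+ n).
  by apply: cmeasurable_poly; exact: cmeasurable_complex_of_pair.
have mg : measurable_fun (@pair_disc R) g.
  apply/measurable_EFinP; apply: measurable_funM; last exact: measurable_radial.
  apply: measurable_sqr_cmod; apply: cmeasurable_lim mP _.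
  by move=> p pD; exact: hf.
have mHr n : measurable_fun (`[0, 1[%classic : set R) (fun r => cmod (a n) ^+ 2 * r ^+ n.*2 * w r).
  by apply: measurable_funM => //; apply: measurable_funM.
have mH n : measurable_fun (@pair_disc R) (H n).
  by apply/measurable_EFinP; apply: (measurable_radial (mHr n)).
have H0 n p : pair_disc p -> (0 <= H n p)%E.
  by move=> pD; rewrite lee_fin !mulr_ge0 ?sqr_ge0 ?exprn_ge0 ?cmod_ge0 ?w0'.
pose G (p : R * R) := (\sum_(0 <= n <oo) H n p)%E.
have G0 p : pair_disc p -> (0 <= G p)%E by move=> pD; apply: nneseries_ge0 => n _ _; exact: H0.
have mG : measurable_fun (@pair_disc R) G.
  by apply: ge0_emeasurable_sum => // n p pD _; exact: H0.
have EF j : (\int[@area_measure R]_(p in F j) g p = \int[@area_measure R]_(p in F j) G p)%E.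
  pose v r := if r < rho j then w r else 0.
  have v0 r : 0 <= r < 1 -> 0 <= v r by move=> /w0; rewrite /v; case: ifP.
  have iv : lebesgue_measure.-integrable `[0, 1[ (EFin \o v).
    apply: (le_integrable _ _ _ iw) => //.
      apply/measurable_EFinP; apply: measurable_fun_if => //.
      - exact: measurable_fun_ltr.
      - by apply: measurable_funS mw => // r [].
    by move=> r r01; rewrite /v/=; case: ifP => //; rewrite normr0 lee_fin.
  have vr r : rho j <= r -> v r = 0 by rewrite /v ltNge => ->.
  have := trunc_parseval hf iv v0 (rho1 j) vr.
  have -> : F j = @pair_disc R `&` F j by rewrite setIidr.
  rewrite !integral_mkcondr.
  have inF p : (p \in F j) = (cmod (complex_of_pair p) < rho j) by apply/idP/idP; rewrite inE.
  move=> E; apply: etrans (etrans _ E) _; apply: eq_integral => p _; rewrite patchE inF /v; case: ifP => // _.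
    by rewrite mulr0.
  by apply: eseries0 => n _ _; rewrite mulr0.
rewrite /bergman_sqnorm -/g.
transitivity (\int[@area_measure R]_(p in @pair_disc R) G p)%E.
  rewrite -bF.
  have c1 : (\int[@area_measure R]_(p in F j) g p @[j --> \oo] --> \int[@area_measure R]_(p in \bigcup_j F j) g p)%E.
    apply: (ge0_nondecreasing_set_cvg_integral (mu := @area_measure R) ndF mF).
      by move=> j; apply: measurable_funS mg.
    by move=> j p /FD pD; rewrite lee_fin mulr_ge0 ?sqr_ge0// w0'.
  have c2 : (\int[@area_measure R]_(p in F j) G p @[j --> \oo] --> \int[@area_measure R]_(p in \bigcup_j F j) G p)%E.
    apply: (ge0_nondecreasing_set_cvg_integral (mu := @area_measure R) ndF mF).
      by move=> j; apply: measurable_funS mG.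
    by move=> j p /FD pD; exact: G0.
  have E12 : (fun j => \int[@area_measure R]_(p in F j) g p)%E = (fun j => \int[@area_measure R]_(p in F j) G p)%E.
    by apply/funext => j; exact: EF.
  by rewrite -(cvg_lim _ c1)// -(cvg_lim _ c2)// E12.
rewrite integral_nneseries//; apply: eq_eseriesr => n _.
rewrite (ge0_integral_radial (mHr n)); last first.
  by move=> r /[dup] /w0 wr /andP[r0 r1]; apply: mulr_ge0 => //; apply: mulr_ge0; [exact: sqr_ge0|exact: exprn_ge0].
rewrite EFinM; congr (_ * _)%E; rewrite EFinM momentE// -integralZl//; last exact: integrable_moment.
have E (x y z r : R) : x * y * z * r = x * (z * (r * y)) by ring.
by apply: eq_integral => r _; rewrite -EFinM (exprS r) E.
Qed.

Lemma tailE w r : radial_weight w -> 0 <= r ->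
  (tail_integral w r)%:E = (\int[@lebesgue_measure R]_(s in `[r, 1%R[) (w s)%:E)%E.
Proof.
move=> [w0 iw _] r0; rewrite /tail_integral/= /Rintegral fineK//.
apply: integrable_fin_num => //; apply: integrableS iw => // s; rewrite /= !in_itv/= => /andP[rs ->].
by rewrite (le_trans r0).
Qed.

Lemma moment_ge_tail w r n : radial_weight w -> 0 <= r -> r ^+ n * tail_integral w r <= moment w n.
Proof.
move=> hw r0; have [w0 iw _] := hw.
have mw : measurable_fun (`[0, 1[%classic : set R) w.
  by have /measurable_int/measurable_EFinP := iw.
have sub : `[r, 1[ `<=` (`[0, 1[%classic : set R).
  by move=> s; rewrite /= !in_itv/= => /andP[rs ->]; rewrite (le_trans r0).
rewrite -lee_fin EFinM (tailE hw r0) (momentE _ hw).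
have mS : measurable_fun (`[r, 1[%classic : set R) w by apply: measurable_funS mw.
have mwn : measurable_fun (`[0, 1[%classic : set R) (fun s => (w s * s ^+ n)%:E).
  by apply/measurable_EFinP; apply: measurable_funM.
rewrite -ge0_integralZl_EFin//; last 3 first.
- by move=> s /sub; rewrite /= in_itv/= => /w0.
- exact/measurable_EFinP.
- exact: exprn_ge0.
apply: (@le_trans _ _ (\int[@lebesgue_measure R]_(s in `[r, 1%R[) (w s * s ^+ n)%:E)%E).
  apply: ge0_le_integral => //.
  - by move=> s /sub; rewrite /= in_itv/= => /w0 ws; rewrite -EFinM lee_fin mulr_ge0// exprn_ge0.
  - by apply/measurable_EFinP; apply: measurable_funM.
  - exact: measurable_funS mwn.
  - move=> s /[dup] /sub; rewrite /= in_itv/= => /w0 ws; rewrite in_itv/= => /andP[rs _].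
    rewrite -EFinM lee_fin mulrC ler_wpM2l// lerXn2r// nnegrE//.
    exact: le_trans rs.
apply: ge0_subset_integral => // s; rewrite /= in_itv/= => /[dup] /w0 ws /andP[s0 _].
by rewrite lee_fin mulr_ge0// exprn_ge0.
Qed.

Lemma moment_gt0 w n : radial_weight w -> 0 < moment w n.
Proof.
move=> hw; have h2 : 0 <= (2^-1 : R) < 1 by lra.
apply: lt_le_trans (moment_ge_tail n hw (r := 2^-1) _); last lra.
have [_ _ wt] := hw; rewrite mulr_gt0 ?wt// exprn_gt0//; lra.
Qed.

(** Below rho, r^n <= rho^(n-y) r^y; above it, r^n <= 1. *)
Lemma moment_le_split w (rho : R) n y : radial_weight w -> 0 <= rho < 1 -> (y <= n)%N ->
  moment w n <= rho ^+ (n - y) * moment w y + tail_integral w rho.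
Proof.
move=> hw /andP[p0 p1] yn; have [w0 iw _] := hw.
have mw : measurable_fun (`[0, 1[%classic : set R) w.
  by have /measurable_int/measurable_EFinP := iw.
have mwn k : measurable_fun (`[0, 1[%classic : set R) (fun s => (w s * s ^+ k)%:E).
  by apply/measurable_EFinP; apply: measurable_funM.
have sub : `[rho, 1[ `<=` (`[0, 1[%classic : set R).
  by move=> s; rewrite /= !in_itv/= => /andP[rs ->]; rewrite (le_trans p0).
rewrite -lee_fin EFinD EFinM (tailE hw p0) !(momentE _ hw).
have -> : (\int[@lebesgue_measure R]_(s in `[rho, 1%R[) (w s)%:E)%E =
  (\int[@lebesgue_measure R]_(s in `[0%R, 1%R[) (((fun s => (w s)%:E) \_ `[rho, 1%R[) s))%E.
  by rewrite -integral_mkcondr setIidr.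
have wk0 k s : `[0, 1[%classic s -> (0 <= (w s * s ^+ k)%:E)%E.
  by rewrite /= in_itv/= => /[dup] /w0 ws /andP[s0 _]; rewrite lee_fin mulr_ge0// exprn_ge0.
have mr : measurable_fun (`[0, 1[%classic : set R) ((fun s => (w s)%:E) \_ `[rho, 1[).
  apply/(measurable_restrict _ (measurable_itv _) (measurable_itv _)); rewrite setIidr//.
  by apply: measurable_funS (sub) _ => //; exact/measurable_EFinP.
have r0 s : `[0, 1[%classic s -> (0 <= ((fun s => (w s)%:E) \_ `[rho, 1%R[) s)%E.
  by rewrite /= in_itv/= patchE; case: ifP => // _ /w0; rewrite lee_fin.
rewrite -ge0_integralZl_EFin; [|by []|exact: wk0|exact: mwn|exact: exprn_ge0].
rewrite -ge0_integralD//; last 2 first.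
- by move=> s s01; apply: mule_ge0; [rewrite lee_fin exprn_ge0|exact: wk0].
- by apply: measurable_funeM; exact: mwn.
apply: ge0_le_integral => //.
- exact: wk0.
- exact: mwn.
- by apply: emeasurable_funD => //; apply: measurable_funeM; exact: mwn.
move=> s; rewrite /= in_itv/= => /[dup] /w0 ws /andP[s0 s1]; rewrite patchE.
have [sr|sr] := ltP s rho.
  rewrite memNset ?adde0; last by rewrite /= in_itv/= leNgt sr.
  rewrite -EFinM lee_fin mulrCA ler_wpM2l// -{1}(subnK yn) exprD ler_wpM2r ?exprn_ge0//.
  by rewrite lerXn2r// ltW.
rewrite mem_set; last by rewrite /= in_itv/= sr.
rewrite -EFinM -EFinD lee_fin; apply: (@le_trans _ _ (w s)); last first.
  by rewrite lerDr mulr_ge0 ?exprn_ge0// mulr_ge0// exprn_ge0.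
by rewrite ler_piMr// exprn_ile1// ltW.
Qed.

Lemma moment_le w m n : radial_weight w -> (m <= n)%N -> moment w n <= moment w m.
Proof.
move=> hw mn; have [w0 iw _] := hw.
have mw : measurable_fun (`[0, 1[%classic : set R) w.
  by have /measurable_int/measurable_EFinP := iw.
have mwn k : measurable_fun (`[0, 1[%classic : set R) (fun s => (w s * s ^+ k)%:E).
  by apply/measurable_EFinP; apply: measurable_funM.
rewrite -lee_fin !(momentE _ hw); apply: ge0_le_integral => //.
  move=> s; rewrite /= in_itv/= => /[dup] /w0 ws /andP[s0 _].
  by rewrite lee_fin mulr_ge0// exprn_ge0.
- exact: mwn.
- exact: mwn.
move=> s; rewrite /= in_itv/= => /[dup] /w0 ws /andP[s0 s1].
by rewrite lee_fin ler_wpM2l// ler_wiXn2l// ltW.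
Qed.

Lemma tail_le (w : R -> R) (r s : R) : radial_weight w -> 0 <= r -> r <= s -> tail_integral w s <= tail_integral w r.
Proof.
move=> hw r0 rs; have [w0 iw _] := hw.
have mw : measurable_fun (`[0, 1[%classic : set R) w.
  by have /measurable_int/measurable_EFinP := iw.
have sub : `[r, 1[ `<=` (`[0, 1[%classic : set R).
  by move=> x; rewrite /= !in_itv/= => /andP[rx ->]; rewrite (le_trans r0).
rewrite -lee_fin (tailE hw r0) (tailE hw (le_trans r0 rs)); apply: ge0_subset_integral => //.
- by apply/measurable_EFinP; apply: measurable_funS mw.
- by move=> x /sub; rewrite /= in_itv/= => /w0.
- by move=> x; rewrite /= !in_itv/= => /andP[sx ->]; rewrite (le_trans rs).
Qed.
                              
(** By [parseval], the squared norm of z^n. *)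
Definition mono_sqnorm w n := c * moment w n.*2.+1.

(** Trades the extended-real series for a bound on all partial sums, the form in which norms are
    compared below. *)
Lemma sqnorm_leP a f w (M : R) : radial_weight w -> (forall z, cmod z < 1 -> is_pser a z (f z)) ->
  (bergman_sqnorm w f <= M%:E)%E <-> (forall N, \sum_(n < N) mono_sqnorm w n * cmod (a n) ^+ 2 <= M).
Proof.
move=> hw hf; rewrite (parseval hw hf).
have t0 n : (0 <= (c * (cmod (a n) ^+ 2 * moment w n.*2.+1))%:E)%E.
  by rewrite lee_fin; apply: mulr_ge0; [exact: ltW|apply: mulr_ge0; [exact: sqr_ge0|exact/ltW/moment_gt0]].
have E N : (\sum_(0 <= n < N) (c * (cmod (a n) ^+ 2 * moment w n.*2.+1))%:E = (\sum_(n < N) mono_sqnorm w n * cmod (a n) ^+ 2)%:E)%E.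
  by rewrite sumEFin big_mkord; congr EFin; apply: eq_bigr => n _; rewrite /mono_sqnorm; ring.
split=> [h N|h].
  by rewrite -lee_fin -E; apply: le_trans h; apply: nneseries_lim_ge.
apply: lime_le; first exact: is_cvg_nneseries.
by near=> N; rewrite E lee_fin.
Unshelve. all: by end_near.
Qed.

Lemma bergman_space_pserP f w : radial_weight w ->
  bergman_space w f <-> exists a (M : R), [/\ geom_bounded a 1, (forall z, cmod z < 1 -> is_pser a z (f z)) &
    forall N, \sum_(n < N) mono_sqnorm w n * cmod (a n) ^+ 2 <= M].
Proof.
move=> hw; split=> [[af hf]|[a [M [ga ha hM]]]].
  have [a ga ha] := taylor af.
  exists a, (fine (bergman_sqnorm w f)); split=> //.
  apply/(sqnorm_leP _ hw ha); rewrite fineK// ge0_fin_numE//.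
  rewrite (parseval hw ha); apply: nneseries_ge0 => n _ _; rewrite lee_fin.
  by apply: mulr_ge0; [exact: ltW|apply: mulr_ge0; [exact: sqr_ge0|exact/ltW/moment_gt0]].
split; first exact: pser_analytic ga ha.
by apply: le_lt_trans (ltry M); apply/(sqnorm_leP _ hw ha).
Qed.

Lemma sqnorm_ge0 (f : R[i] -> R[i]) (w : R -> R) : radial_weight w -> (0 <= bergman_sqnorm w f)%E.
Proof.
move=> [w0 _ _]; apply: integral_ge0 => p pD; rewrite lee_fin; apply: mulr_ge0; first exact: sqr_ge0.
by apply: w0; rewrite cmod_ge0.
Qed.

Lemma sqnorm_cvg a f w : radial_weight w -> (forall z, cmod z < 1 -> is_pser a z (f z)) -> (bergman_sqnorm w f < +oo)%E ->
  (fun N => \sum_(n < N) mono_sqnorm w n * cmod (a n) ^+ 2) @ \oo --> fine (bergman_sqnorm w f).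
Proof.
move=> hw hf foo.
suff h : (fun N => (\sum_(n < N) mono_sqnorm w n * cmod (a n) ^+ 2)%:E) @ \oo --> (fine (bergman_sqnorm w f))%:E.
  exact: (fine_cvg h).
rewrite fineK; last by rewrite ge0_fin_numE// sqnorm_ge0.
rewrite (parseval hw hf).
have E N : (\sum_(0 <= n < N) (c * (cmod (a n) ^+ 2 * moment w n.*2.+1))%:E = (\sum_(n < N) mono_sqnorm w n * cmod (a n) ^+ 2)%:E)%E.
  by rewrite sumEFin big_mkord; congr EFin; apply: eq_bigr => n _; rewrite /mono_sqnorm; ring.
under eq_fun do rewrite -E.
apply: is_cvg_nneseries => n _ _; rewrite lee_fin.
by apply: mulr_ge0; [exact: ltW|apply: mulr_ge0; [exact: sqr_ge0|exact/ltW/moment_gt0]].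
Qed.

Lemma cmeasurable_pser a (f : R[i] -> R[i]) : (forall z, cmod z < 1 -> is_pser a z (f z)) ->
  cmeasurable (@pair_disc R) (fun p => f (complex_of_pair p)).
Proof.
move=> hf; apply: (cmeasurable_lim (F := fun N p => \sum_(n < N) a n * complex_of_pair p ^+ n)).
  by move=> N; apply: cmeasurable_poly; exact: cmeasurable_complex_of_pair.
by move=> p pD; exact: hf.
Qed.

Lemma integrable_sqr_cmod a f w : radial_weight w -> (forall z, cmod z < 1 -> is_pser a z (f z)) -> (bergman_sqnorm w f < +oo)%E ->
  (@area_measure R).-integrable (@pair_disc R) (fun p => (cmod (f (complex_of_pair p)) ^+ 2 * w (cmod (complex_of_pair p)))%:E).
Proof.
move=> hw hf foo; have [w0 iw _] := hw.
have mw : measurable_fun (`[0, 1[%classic : set R) w.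
  by have /measurable_int/measurable_EFinP := iw.
apply/integrableP; split.
  apply/measurable_EFinP; apply: measurable_funM; last exact: measurable_radial.
  exact/measurable_sqr_cmod/(cmeasurable_pser hf).
apply: le_lt_trans foo; rewrite le_eqVlt; apply/orP; left; apply/eqP.
apply: eq_integral => p; rewrite inE => pD; rewrite gee0_abs// lee_fin; apply: mulr_ge0; first exact: sqr_ge0.
by apply: w0; rewrite cmod_ge0.
Qed.

(** Polarization, 2 Re(x conj y) = |x + y|^2 - |x|^2 - |y|^2, used both under the integral and on
    the coefficients, reduces inner products to norms. *)
Lemma inner_product_Re a b f g w l : radial_weight w ->
  (forall z, cmod z < 1 -> is_pser a z (f z)) -> (bergman_sqnorm w f < +oo)%E ->
  (forall z, cmod z < 1 -> is_pser b z (g z)) -> (bergman_sqnorm w g < +oo)%E ->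
  (fun N => \sum_(n < N) mono_sqnorm w n * complex.Re (a n * (b n)^*%C)) @ \oo --> l ->
  \int[@area_measure R]_(p in @pair_disc R) (complex.Re (f (complex_of_pair p) * (g (complex_of_pair p))^*%C) * w (cmod (complex_of_pair p))) = l.
Proof.
move=> hw hf foo hg goo hl; have [w0 iw _] := hw.
have polar (x y : R[i]) : complex.Re (x * y^*%C) = 2^-1 * (cmod (x + y) ^+ 2 - cmod x ^+ 2 - cmod y ^+ 2).
  by rewrite !sqr_cmod; case: x => x1 x2; case: y => y1 y2 /=; field.
have hfg z : cmod z < 1 -> is_pser (fun n => a n + b n) z (f z + g z).
  move=> z1; apply: cseq_cvg_eq (has_csumD (hf _ z1) (hg _ z1)) => N.
  by apply: eq_bigr => n _; rewrite mulrDl.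
have W0 n : 0 < mono_sqnorm w n by rewrite mulr_gt0// moment_gt0.
have fgoo : (bergman_sqnorm w (fun z => f z + g z)%R < +oo)%E.
  have Hf := (sqnorm_leP (fine (bergman_sqnorm w f)) hw hf).1 _.
  have Hg := (sqnorm_leP (fine (bergman_sqnorm w g)) hw hg).1 _.
  rewrite !fineK ?ge0_fin_numE ?sqnorm_ge0// in Hf Hg.
  apply: le_lt_trans (ltry (2 * (fine (bergman_sqnorm w f) + fine (bergman_sqnorm w g)))).
  apply/(sqnorm_leP _ hw hfg) => N.
  apply: (@le_trans _ _ (2 * (\sum_(n < N) mono_sqnorm w n * cmod (a n) ^+ 2 + \sum_(n < N) mono_sqnorm w n * cmod (b n) ^+ 2))).
    rewrite -big_split/= mulr_sumr; apply: ler_sum => n _.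
    have key : cmod (a n + b n) ^+ 2 <= 2 * (cmod (a n) ^+ 2 + cmod (b n) ^+ 2).
      have h : cmod (a n + b n) ^+ 2 <= (cmod (a n) + cmod (b n)) ^+ 2.
        by rewrite lerXn2r ?nnegrE ?addr_ge0 ?cmod_ge0// ler_cmodD.
      by have := sqr_ge0 (cmod (a n) - cmod (b n)); rewrite sqrrB; rewrite sqrrD in h; lra.
    by have := ler_wpM2l (ltW (W0 n)) key; lra.
  by rewrite ler_pM2l// lerD// ?Hf ?Hg.
have If := integrable_sqr_cmod hw hf foo; have Ig := integrable_sqr_cmod hw hg goo; have Ifg := integrable_sqr_cmod hw hfg fgoo.
apply: (@cvg_unique _ _ ((fun N => \sum_(n < N) mono_sqnorm w n * complex.Re (a n * (b n)^*%C)) @ \oo)) => //.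
rewrite (_ : (fun N => _) = fun N => 2^-1 * (\sum_(n < N) mono_sqnorm w n * cmod (a n + b n) ^+ 2 - \sum_(n < N) mono_sqnorm w n * cmod (a n) ^+ 2 - \sum_(n < N) mono_sqnorm w n * cmod (b n) ^+ 2)); last first.
  apply/funext => N; rewrite -!sumrB mulr_sumr; apply: eq_bigr => n _; rewrite polar; ring.
rewrite (_ : Rintegral _ _ _ = 2^-1 * (fine (bergman_sqnorm w (fun z => f z + g z)) - fine (bergman_sqnorm w f) - fine (bergman_sqnorm w g))); last first.
  have mD := @measurable_pair_disc R.
  pose nsq (h : R[i] -> R[i]) (p : R * R) := cmod (h (complex_of_pair p)) ^+ 2 * w (cmod (complex_of_pair p)).
  pose h1 := nsq (fun z => f z + g z).
  have I1 := @integrableB _ _ R (@area_measure R) (@pair_disc R) mD _ _ Ifg If; have I2 := @integrableB _ _ R (@area_measure R) (@pair_disc R) mD _ _ I1 Ig.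
  transitivity (\int[@area_measure R]_(p in @pair_disc R) (2^-1 * (h1 p - nsq f p - nsq g p))).
    by apply: eq_Rintegral => p _; rewrite polar /h1 /nsq; ring.
  rewrite (@RintegralZl _ _ R (@area_measure R) (@pair_disc R) (fun p => h1 p - nsq f p - nsq g p) 2^-1 mD I2).
  rewrite (@RintegralB _ _ R (@area_measure R) (@pair_disc R) (fun p => h1 p - nsq f p) (nsq g) mD I1 Ig).
  by rewrite (@RintegralB _ _ R (@area_measure R) (@pair_disc R) h1 (nsq f) mD Ifg If).
apply: cvgM; first exact: cvg_cst.
apply: cvgB; last exact: (sqnorm_cvg hw hg goo).
by apply: cvgB; [exact: (sqnorm_cvg hw hfg fgoo)|exact: (sqnorm_cvg hw hf foo)].
Qed.

(** The imaginary part is the real part of the inner product with i g in place of g. *)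
Lemma inner_product a b f g w l : radial_weight w ->
  (forall z, cmod z < 1 -> is_pser a z (f z)) -> (bergman_sqnorm w f < +oo)%E ->
  (forall z, cmod z < 1 -> is_pser b z (g z)) -> (bergman_sqnorm w g < +oo)%E ->
  has_csum (fun n => a n * (b n)^*%C * (mono_sqnorm w n)%:C%C) l ->
  cintegral (@area_measure R) (@pair_disc R)
    (fun p => f (complex_of_pair p) * (g (complex_of_pair p))^*%C * (w (cmod (complex_of_pair p)))%:C%C) = l.
Proof.
move=> hw hf foo hg goo /cseq_cvgP[hr hi].
have ReM (x : R[i]) (r : R) : complex.Re (x * r%:C%C) = complex.Re x * r by case: x => x y /=; ring.
have ImM (x : R[i]) (r : R) : complex.Im (x * r%:C%C) = complex.Im x * r by case: x => x y /=; ring.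
have ImE (x y : R[i]) : complex.Im (x * y^*%C) = complex.Re (x * ('i%C * y)^*%C).
  by case: x => x1 x2; case: y => y1 y2 /=; ring.
have hig z : cmod z < 1 -> is_pser (fun n => 'i%C * b n) z ('i%C * g z).
  move=> /hg h; apply: cseq_cvg_eq (has_csumZ 'i%C h) => N.
  by apply: eq_bigr => n _; rewrite mulrA.
have ci : cmod ('i%C : R[i]) = 1 by rewrite /cmod/= expr0n add0r expr1n sqrtr1.
have igoo : (bergman_sqnorm w (fun z => 'i%C * g z)%R < +oo)%E.
  rewrite /bergman_sqnorm; under eq_integral do rewrite cmodM ci mul1r.
  exact: goo.
apply/eqP; rewrite eq_complex /cintegral/=; apply/andP; split; apply/eqP.
- under eq_Rintegral do rewrite ReM.
  apply: (inner_product_Re hw hf foo hg goo).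
  rewrite (_ : (fun N => _) = (fun N => complex.Re (\sum_(i < N) a i * (b i)^*%C * (mono_sqnorm w i)%:C%C)))//.
  by apply/funext => N; rewrite raddf_sum; apply: eq_bigr => n _; apply: esym; apply: etrans (ReM _ _) (mulrC _ _).
- under eq_Rintegral do rewrite ImM ImE.
  apply: (inner_product_Re hw hf foo hig igoo).
  rewrite (_ : (fun N => _) = (fun N => complex.Im (\sum_(i < N) a i * (b i)^*%C * (mono_sqnorm w i)%:C%C)))//.
  by apply/funext => N; rewrite raddf_sum; apply: eq_bigr => n _; apply: esym; apply: etrans (ImM _ _) _; rewrite ImE mulrC.
Qed.

Lemma mono_sqnorm_gt0 w n : radial_weight w -> 0 < mono_sqnorm w n.
Proof. by move=> hw; rewrite mulr_gt0// moment_gt0. Qed.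

(** The positive tail at r bounds the moment of order 2n+1 below by a constant times r^(2n+1), and r
    < 1 is chosen with s <= r^2. *)
Lemma mono_sqnorm_inv_bounded w (s : R) : radial_weight w -> 0 <= s -> s < 1 -> exists M : R, forall n, s ^+ n / mono_sqnorm w n <= M.
Proof.
move=> hw s0 s1; have [r [r0 r1 sr2]] : exists r : R, [/\ 0 < r, r < 1 & s <= r ^+ 2].
  by exists ((s + 1) / 2); split; [lra|lra|rewrite expr2; have := sqr_ge0 (s - 1); rewrite expr2; lra].
have [_ _ wt] := hw; have t0 : 0 < tail_integral w r by apply: wt; rewrite r1 ltW.
exists (c * r * tail_integral w r)^-1 => n.
rewrite ler_pdivrMr ?mono_sqnorm_gt0// mulrC ler_pdivlMr ?mulr_gt0//.
have := moment_ge_tail n.*2.+1 hw (ltW r0).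
have sr : s ^+ n <= r ^+ n.*2.
  by rewrite -mul2n exprM lerXn2r ?nnegrE ?exprn_ge0 ?(ltW r0).
rewrite exprS => h; rewrite /mono_sqnorm -!mulrA mulrCA ler_pM2l//; apply: le_trans h.
by rewrite mulrCA -mulrA ler_pM2l// ler_wpM2r// ltW.
Qed.

Definition kernel_coef w (t : R) n : R[i] := (t ^+ n / mono_sqnorm w n)%:C%C.

Lemma cmod_kernel_coef w t n : radial_weight w -> 0 <= t -> cmod (kernel_coef w t n) = t ^+ n / mono_sqnorm w n.
Proof. by move=> hw t0; rewrite cmodC ger0_norm// divr_ge0 ?exprn_ge0// ltW// mono_sqnorm_gt0. Qed.

Lemma kernel_coef_bounded w t : radial_weight w -> 0 <= t <= 1 -> geom_bounded (kernel_coef w t) 1.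
Proof.
move=> hw /andP[t0 t1] s s0 s1; have [M hM] := mono_sqnorm_inv_bounded hw s0 s1.
exists M => n; apply: le_trans (hM n); rewrite cmod_kernel_coef// mulrAC; apply: ler_wpM2r; first by rewrite invr_ge0 ltW ?mono_sqnorm_gt0.
by rewrite -[leRHS]mul1r ler_wpM2r ?exprn_ge0// exprn_ile1.
Qed.

Lemma has_csum_delta (F : nat -> R[i]) n : has_csum (fun k => if k == n then F k else 0) (F n).
Proof.
move=> e e0; exists n.+1 => N nN; rewrite (bigD1 (Ordinal nN))//= eqxx big1 ?addr0 ?subrr ?cmod0//.
move=> i ni; case: eqP => // iE; move: ni; rewrite -val_eqE/= iE eqxx//.
Qed.

Lemma delta_sqnorm (w : R -> R) n : radial_weight w -> (bergman_sqnorm w (fun z : R[i] => (z ^+ n)%R) < +oo)%E /\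
  forall z : R[i], cmod z < 1 -> is_pser (fun k => (k == n)%:R) z (z ^+ n).
Proof.
move=> hw; have hp (z : R[i]) : cmod z < 1 -> is_pser (fun k => (k == n)%:R) z (z ^+ n).
  move=> _; apply: cseq_cvg_eq (has_csum_delta (fun k => z ^+ k) n) => N.
  by apply: eq_bigr => k _; case: eqP; rewrite ?mul1r ?mul0r.
split=> //; apply: le_lt_trans (ltry (mono_sqnorm w n)); apply/(sqnorm_leP _ hw hp) => N.
apply: (@le_trans _ _ (\sum_(k < N) if k == n :> nat then mono_sqnorm w n else 0)).
  apply: ler_sum => k _; case: eqP => [->|_]; first by rewrite cmod1 expr1n mulr1.
  by rewrite cmod0 expr0n mulr0.
rewrite -big_mkcond/=; have [nN|nN] := ltnP n N.
  by rewrite (big_pred1 (Ordinal nN))//.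
rewrite big_pred0; first by rewrite ltW// mono_sqnorm_gt0.
by move=> k; apply/negbTE; rewrite neq_ltn (leq_trans (ltn_ord k) nN).
Qed.

(** As [bergman_kernel] is a choice, a candidate with the expected series is first shown to
    reproduce, so that the chosen function is a kernel. Reproducing z^n then determines the n-th
    coefficient of the chosen one. *)
Lemma bergman_kernel_pser w t z : radial_weight w -> 0 <= t < 1 -> cmod z < 1 ->
  is_pser (kernel_coef w t) z (bergman_kernel w t%:C%C z).
Proof.
move=> hw /andP[t0 t1].
have gk : geom_bounded (kernel_coef w t) 1 by apply: kernel_coef_bounded; rewrite // t0 ltW.
pose B z := xget 0 [set l | is_pser (kernel_coef w t) z l].
have hB x : cmod x < 1 -> is_pser (kernel_coef w t) x (B x).
  by move=> x1; apply: (@xgetPex _ 0 [set l | is_pser (kernel_coef w t) x l]); exact/abs_summable_cvg/(pser_abs_summable gk).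
have Bspace : bergman_space w B.
  apply/(bergman_space_pserP _ hw).
  have t20 : 0 <= t ^+ 2 by exact: sqr_ge0.
  have t21 : t ^+ 2 < 1 by rewrite expr_lt1.
  have h01 : 0 <= (1 : R) <= 1 by rewrite ler01 lexx.
  have [M hM] := geom_bounded_summable (kernel_coef_bounded hw h01) t20 t21.
  exists (kernel_coef w t), M; split=> // N; apply: le_trans (hM N).
  apply: ler_sum => n _; rewrite !cmod_kernel_coef// expr1n le_eqVlt; apply/orP; left; apply/eqP.
  by rewrite -!exprM mulnC exprM; field; rewrite gt_eqF// mono_sqnorm_gt0.
have HB : is_bergman_kernel w t%:C%C B.
  split=> // f [af foo]; have [a ga ha] := taylor af.
  apply/esym; apply: (inner_product hw ha foo hB Bspace.2).
  have := ha t%:C%C; rewrite cmodC ger0_norm// => /(_ t1).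
  apply: cseq_cvg_eq => N; apply: eq_bigr => n _; rewrite -mulrA; congr (_ * _).
  rewrite /kernel_coef conjc_real -rmorphM/= divfK ?rmorphXn//.
  by rewrite gt_eqF// mono_sqnorm_gt0.
have [Kspace Kf] : is_bergman_kernel w t%:C%C (bergman_kernel w t%:C%C).
  by apply: (@xgetPex _ (fun=> 0) [set K | is_bergman_kernel w t%:C%C K]); exists B.
have [b gb hb] := taylor Kspace.1.
move=> z1; have := hb z z1; rewrite (_ : b = kernel_coef w t)//.
apply/funext => n; have [doo hd] := delta_sqnorm n hw.
have := Kf _ (conj (pser_analytic _ hd) doo).
rewrite (inner_product (l := (b n)^*%C * (mono_sqnorm w n)%:C%C) hw hd doo hb Kspace.2); last first.
  apply: cseq_cvg_eq (has_csum_delta (fun k => (b k)^*%C * (mono_sqnorm w k)%:C%C) n) => N.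
  by apply: eq_bigr => k _; case: eqP; rewrite ?mul1r ?mul0r.
have gd : geom_bounded (fun k => ((k == n)%:R : R[i])) 1.
  by move=> s s0 s1; exists 1 => k; case: eqP => _; rewrite ?cmod1 ?cmod0 ?mul1r ?mul0r// exprn_ile1// ltW.
move=> /(_ gd) E; have Wn0 : (mono_sqnorm w n)%:C%C != 0 :> R[i] by rewrite -cmod_eq0 cmodC normr_eq0 gt_eqF// mono_sqnorm_gt0.
have : (b n)^*%C = kernel_coef w t n.
  by apply: (mulIf Wn0); rewrite -E /kernel_coef -rmorphXn -rmorphM/= divfK// gt_eqF// mono_sqnorm_gt0.
by move=> /(congr1 (@conjc R)); rewrite conjcK /kernel_coef conjc_real.
Qed.

End parseval.

                                                   

(** * Cauchy products and termwise integration *)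

Section cauchy_product.
Variable R : realType.

Lemma sum_triangle (V : nmodType) (F : nat -> nat -> V) n :
  \sum_(N < n) \sum_(k < N.+1) F k (N - k)%N = \sum_(i < n) \sum_(j < n - i) F i j.
Proof.
elim: n => [|n IH]; first by rewrite !big_ord0.
rewrite big_ord_recr/= IH.
have -> : \sum_(i < n) \sum_(j < n - i) F i j = \sum_(i < n.+1) \sum_(j < n - i) F i j.
  by rewrite [RHS]big_ord_recr/= subnn big_ord0 addr0.
rewrite -big_split/=; apply: eq_bigr => i _; rewrite subSn -1?ltnS//.
by rewrite [RHS]big_ord_recr.
Qed.

Lemma conv_abs_summable (u v : nat -> R[i]) : abs_summable u -> abs_summable v ->
  abs_summable (fun N => \sum_(k < N.+1) u k * v (N - k)%N).
Proof.
move=> [A hA] [B hB]; exists (A * B) => n.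
apply: (@le_trans _ _ (\sum_(N < n) \sum_(k < N.+1) cmod (u k) * cmod (v (N - k)%N))).
  by apply: ler_sum => N _; apply: le_trans (ler_cmod_sum _ _ _) _; under eq_bigr do rewrite cmodM.
rewrite (sum_triangle (fun i j => cmod (u i) * cmod (v j))).
apply: (@le_trans _ _ (\sum_(i < n) cmod (u i) * B)).
  by apply: ler_sum => i _; rewrite -mulr_sumr ler_wpM2l ?cmod_ge0.
rewrite -mulr_suml ler_wpM2r//.
by apply: le_trans (hB 0%N); rewrite big_ord0.
Qed.

(** The triangular partial sum differs from the square one by pairs with i + j >= n; in such a pair
    one index is large, where the tail of an absolutely convergent series is small. *)
Lemma has_csum_conv (u v : nat -> R[i]) l l' : abs_summable u -> abs_summable v ->
  has_csum u l -> has_csum v l' -> has_csum (fun N => \sum_(k < N.+1) u k * v (N - k)%N) (l * l').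
Proof.
move=> [A hA] [B hB] hu hv e e0.
have A0 : 0 <= A by apply: le_trans (hA 0%N); rewrite big_ord0.
have B0 : 0 <= B by by apply: le_trans (hB 0%N); rewrite big_ord0.
pose d := e / (4 * (A + B + 1)).
have AB : 0 < 4 * (A + B + 1) by rewrite mulr_gt0// ltr_wpDl// addr_ge0.
have d0 : 0 < d by rewrite divr_gt0.
have dE : d * (A + B + 1) = e / 4 by rewrite /d; field; rewrite gt_eqF// ltr_wpDl// addr_ge0.
have [N1 h1] := hu d d0; have [N2 h2] := hv d d0.
have [N3 h3] := abs_summable_cauchy (ex_intro _ A hA) d0; have [N4 h4] := abs_summable_cauchy (ex_intro _ B hB) d0.
exists (N1 + N2 + (N3 + N4).*2)%N => n nN.
have q1 : (N1 <= n)%N by lia. have q2 : (N2 <= n)%N by lia.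
rewrite (sum_triangle (fun i j => u i * v j)).
pose U := \sum_(i < n) u i; pose V := \sum_(j < n) v j.
have hU : cmod U <= A by apply: le_trans (hA n); exact: ler_cmod_sum.
have hl' : cmod l' <= B by exact: has_csum_le hv hB.
have e1 : cmod (U * V - l * l') <= d * B + A * d.
  have -> : U * V - l * l' = (U - l) * l' + U * (V - l') by ring.
  apply: le_trans (ler_cmodD _ _) _; rewrite !cmodM; apply: lerD.
    by apply: ler_pM; rewrite ?cmod_ge0//; apply/ltW/h1.
  by apply: ler_pM; rewrite ?cmod_ge0//; apply/ltW/h2.
have e2 : cmod (\sum_(i < n) \sum_(j < n - i) u i * v j - U * V) <= A * d + d * B.
  have -> : \sum_(i < n) \sum_(j < n - i) u i * v j - U * V = - (\sum_(i < n) u i * \sum_(n - i <= j < n) v j).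
    rewrite -sumrN mulr_suml -sumrB; apply: eq_bigr => i _.
    rewrite -mulr_sumr -mulrBr /V -!(big_mkord xpredT v) [X in _ - X](big_cat_nat (leq0n (n - i)) (leq_subr i n))/=.
    by rewrite opprD addNKr mulrN.
  rewrite cmodN; apply: le_trans (ler_cmod_sum _ _ _) _.
  apply: (@le_trans _ _ (\sum_(i < n) cmod (u i) * \sum_(n - i <= j < n) cmod (v j))).
    by apply: ler_sum => i _; rewrite cmodM ler_wpM2l ?cmod_ge0// ler_cmod_sum.
  (* For i < m the remaining j are at least N4, so the tail of [v] is small; for i >= m the tail of
     [u] is. *)
  pose m := (N3 + N4)%N; have mn : (m <= n)%N by rewrite /m; lia.
  rewrite -(big_mkord xpredT (fun i => cmod (u i) * \sum_(n - i <= j < n) cmod (v j))) (big_cat_nat (leq0n m) mn)/=.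
  apply: lerD.
    apply: (@le_trans _ _ (\sum_(0 <= i < m) cmod (u i) * d)).
      rewrite big_nat [leRHS]big_nat; apply: ler_sum => i /= im; rewrite ler_wpM2l ?cmod_ge0//.
      by apply/ltW/h4; lia.
    by rewrite -mulr_suml big_mkord ler_wpM2r// ltW.
  apply: (@le_trans _ _ (\sum_(m <= i < n) cmod (u i) * B)).
    apply: ler_sum => i _; rewrite ler_wpM2l ?cmod_ge0//; apply: le_trans (hB n).
    rewrite -(big_mkord xpredT (fun j => cmod (v j))) (big_cat_nat (leq0n (n - i)) (leq_subr i n))/= lerDr.
    by apply: sumr_ge0 => j _; exact: cmod_ge0.
  by rewrite -mulr_suml ler_wpM2r//; apply/ltW/h3; rewrite /m; lia.
have := ler_cmod_triangle (\sum_(i < n) \sum_(j < n - i) u i * v j) (U * V) (l * l'); nra.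
Qed.

(** Dominated convergence with majorant S w, since every partial sum of u_k t^k is at most S in
    modulus on [0,1]. *)
Lemma Rintegral_series (D : set R) (w : R -> R) (u : nat -> R) (S : R) (h : R -> R) :
  measurable D -> (forall t, D t -> 0 <= t <= 1) -> (forall t, D t -> 0 <= w t) ->
  (@lebesgue_measure R).-integrable D (EFin \o w) -> (forall n, \sum_(k < n) `|u k| <= S) ->
  (forall t, D t -> (fun N => \sum_(k < N) u k * t ^+ k) @ \oo --> h t) ->
  (fun N => \sum_(k < N) u k * \int[@lebesgue_measure R]_(t in D) (w t * t ^+ k)) @ \oo -->
    \int[@lebesgue_measure R]_(t in D) (h t * w t).
Proof.
move=> mD D01 w0 iw hS hh.
have mw : measurable_fun D w by have /measurable_int/measurable_EFinP := iw.
have S0 : 0 <= S by apply: le_trans (hS 0%N); rewrite big_ord0.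
pose F N t := ((\sum_(k < N) u k * t ^+ k) * w t)%:E.
pose g t := (S * w t)%:E.
have mp N : measurable_fun D (fun t => \sum_(k < N) u k * t ^+ k).
  by apply: measurable_sum => k; apply: measurable_funM.
have mF N : measurable_fun D (F N) by apply/measurable_EFinP; apply: measurable_funM.
have mh : measurable_fun D h by apply: measurable_fun_cvg hh.
have mf : measurable_fun D (fun t => (h t * w t)%:E) by apply/measurable_EFinP; apply: measurable_funM.
have ptw t : D t -> F N t @[N --> \oo] --> (h t * w t)%:E.
  move=> tD; apply/cvg_EFin; first by near=> N.
  by rewrite /comp/=; apply: cvgM; [exact: hh|exact: cvg_cst].
have Fg N t : D t -> (`|F N t| <= g t)%E.
  move=> tD; have /andP[t0 t1] := D01 _ tD; rewrite lee_fin normrM (ger0_norm (w0 _ tD)) ler_wpM2r ?w0//.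
  apply: le_trans (ler_norm_sum _ _ _) _; apply: le_trans (hS N); apply: ler_sum => k _.
  by rewrite normrM ler_piMr// normrX ger0_norm// exprn_ile1.
have ig : (@lebesgue_measure R).-integrable D g by exact: (@integrableZl _ _ R (@lebesgue_measure R) D mD S _ iw).
have iwk k : (@lebesgue_measure R).-integrable D (EFin \o (fun t => w t * t ^+ k)).
  apply: (@le_integrable _ _ R (@lebesgue_measure R) D mD _ _ _ _ iw); first by apply/measurable_EFinP; apply: measurable_funM.
  move=> t tD /=; have /andP[t0 t1] := D01 _ tD; rewrite lee_fin normrM ler_piMr// normrX ger0_norm// exprn_ile1//.
have [iF _ cv] := @dominated_convergence _ _ R (@lebesgue_measure R) D mD _ _ g mF mf (aeW (@lebesgue_measure R) ptw) ig (aeW (@lebesgue_measure R) (fun t N tD => Fg N t tD)).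
suff E N : (\int[@lebesgue_measure R]_(t in D) F N t = (\sum_(k < N) u k * \int[@lebesgue_measure R]_(t in D) (w t * t ^+ k)%R)%:E)%E.
  suff h' : (fun N => (\sum_(k < N) u k * \int[@lebesgue_measure R]_(t in D) (w t * t ^+ k)%R)%:E) @ \oo --> (\int[@lebesgue_measure R]_(t in D) (h t * w t))%:E.
    exact: (fine_cvg h').
  rewrite -(funext E) /Rintegral fineK//; exact: integrable_fin_num iF.
have -> : F N = (fun t => \sum_(k < N) ((u k)%:E * (w t * t ^+ k)%:E)%E).
  by apply/funext => t; rewrite /F mulr_suml -sumEFin; apply: eq_bigr => k _; rewrite mulrAC -mulrA.
rewrite (@integral_sum _ _ R (@lebesgue_measure R) D mD _ (fun (k : 'I_N) t => ((u k)%:E * (w t * t ^+ k)%:E)%E)); last first.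
  move=> k; exact: (@integrableZl _ _ R (@lebesgue_measure R) D mD (u k) _ (iwk k)).
rewrite -sumEFin; apply: eq_bigr => k _.
rewrite (@integralZl _ _ R (@lebesgue_measure R) D mD _ (iwk k)) EFinM; congr (_ * _)%E.
by rewrite /Rintegral fineK//; exact: integrable_fin_num (iwk k).
Unshelve. all: by end_near.
Qed.

End cauchy_product.

(** * The matrix of the generalized Cesàro operator *)

Section cesaro_series.
Variable R : realType.

Lemma has_csum_cintegral (D : set R) (w : R -> R) (u : nat -> R[i]) (h : R -> R[i]) :
  measurable D -> (forall t, D t -> 0 <= t <= 1) -> (forall t, D t -> 0 <= w t) ->
  (@lebesgue_measure R).-integrable D (EFin \o w) -> abs_summable u ->
  (forall t, D t -> is_pser u t%:C%C (h t)) ->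
  has_csum (fun k => u k * (\int[@lebesgue_measure R]_(t in D) (w t * t ^+ k))%:C%C)
    (cintegral (@lebesgue_measure R) D (fun t => h t * (w t)%:C%C)).
Proof.
move=> mD D01 w0 iw [S hS] hh.
have ReM (x : R[i]) (r : R) : complex.Re (x * r%:C%C) = complex.Re x * r by case: x => x y /=; ring.
have ImM (x : R[i]) (r : R) : complex.Im (x * r%:C%C) = complex.Im x * r by case: x => x y /=; ring.
apply/cseq_cvgP; rewrite /cintegral/=; split.
- under eq_Rintegral do rewrite ReM.
  rewrite (_ : (fun N => _) = fun N => \sum_(k < N) complex.Re (u k) * \int[@lebesgue_measure R]_(t in D) (w t * t ^+ k)); last first.
    by apply/funext => N; rewrite raddf_sum; apply: eq_bigr => k _; exact: ReM.
  apply: (@Rintegral_series R D w (fun k => complex.Re (u k)) S (fun t => complex.Re (h t)) mD D01 w0 iw).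
    by move=> n; apply: le_trans (hS n); apply: ler_sum => k _; exact: ler_Re_cmod.
  move=> t /hh/cseq_cvgP[+ _].
  rewrite (_ : (fun N => _) = fun N => \sum_(k < N) complex.Re (u k) * t ^+ k)//.
  by apply/funext => N; rewrite raddf_sum; apply: eq_bigr => k _; rewrite -rmorphXn; exact: ReM.
- under eq_Rintegral do rewrite ImM.
  rewrite (_ : (fun N => _) = fun N => \sum_(k < N) complex.Im (u k) * \int[@lebesgue_measure R]_(t in D) (w t * t ^+ k)); last first.
    by apply/funext => N; rewrite raddf_sum; apply: eq_bigr => k _; exact: ImM.
  apply: (@Rintegral_series R D w (fun k => complex.Im (u k)) S (fun t => complex.Im (h t)) mD D01 w0 iw).
    by move=> n; apply: le_trans (hS n); apply: ler_sum => k _; exact: ler_Im_cmod.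
  move=> t /hh/cseq_cvgP[_].
  rewrite (_ : (fun N => _) = fun N => \sum_(k < N) complex.Im (u k) * t ^+ k)//.
  by apply/funext => N; rewrite raddf_sum; apply: eq_bigr => k _; rewrite -rmorphXn; exact: ImM.
Qed.

Lemma Rintegral_exprn n : \int[@lebesgue_measure R]_(t in `[0, 1]) (t ^+ n) = n.+1%:R^-1.
Proof.
rewrite /Rintegral (@continuous_FTC2 _ _ (fun x => x ^+ n.+1 / n.+1%:R))//=.
- by rewrite expr1n expr0n/= mul0r mul1r subr0.
- by apply: continuous_subspaceT => x; exact: exprn_continuous.
- split.
  + by move=> x _; apply: derivableM; [exact: exprn_derivable|exact: derivable_cst].
  + by apply: cvg_at_right_filter; apply: cvgM; [exact: exprn_continuous|exact: cvg_cst].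
  + by apply: cvg_at_left_filter; apply: cvgM; [exact: exprn_continuous|exact: cvg_cst].
- move=> x x01; rewrite derive1Mr//; last exact: exprn_derivable.
  by rewrite derive1E exp_derive/= scaler1 -mulr_natl mulrAC divff// mul1r.
Qed.

(** Integrating s^n over [0,1] divides the n-th coefficient by n+1; at z = 0 only the constant term
    remains. *)
Lemma segment_mean_pser (b : nat -> R[i]) (g : R[i] -> R[i]) (z : R[i]) : geom_bounded b 1 ->
  (forall z, cmod z < 1 -> is_pser b z (g z)) -> cmod z < 1 ->
  is_pser (fun n => b n * (n.+1%:R^-1)%:C%C) z (segment_mean g z).
Proof.
move=> gb hg z1; rewrite /segment_mean; case: eqP => [->|/eqP z0].
  apply: cseq_cvg_eq (hg 0 _); last by rewrite cmod0.
  by move=> N; apply: eq_bigr => -[[|k] ?] _ /=; rewrite ?invr1 ?mulr1// exprS mul0r !mulr0.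
have bz : abs_summable (fun n => b n * z ^+ n * z).
  have := abs_summableZ z (pser_abs_summable gb z1).
  by apply: abs_summable_le => n; rewrite mulrC.
have i1 : (@lebesgue_measure R).-integrable (`[0, 1]%classic : set R) (EFin \o (fun=> 1 : R)).
  apply: continuous_compact_integrable; first exact: segment_compact.
  by apply: continuous_subspaceT => x; exact: cvg_cst.
have h01 t : (`[0, 1]%classic : set R) t -> 0 <= t <= 1 by rewrite /= in_itv.
have gz t : (`[0, 1]%classic : set R) t -> is_pser (fun n => b n * z ^+ n * z) t%:C%C (g (t%:C%C * z) * z).
  move=> t01; rewrite [X in is_pser _ _ X]mulrC; apply: cseq_cvg_eq (has_csumZ z (hg (t%:C%C * z) _)).
    by move=> N; apply: eq_bigr => k _; rewrite exprMn; ring.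
  have /andP[t0 t1] := h01 _ t01; rewrite cmodM cmodC ger0_norm//.
  by apply: le_lt_trans z1; rewrite ler_piMl ?cmod_ge0.
have H := @has_csum_cintegral `[0, 1] (fun=> 1) _ (fun s => g (s%:C%C * z) * z) (measurable_itv _) h01 (fun _ _ => ler01) i1 bz gz.
have -> : segment_integral g z = cintegral lebesgue_measure `[0, 1] (fun t : R => g (t%:C%C * z) * z * 1%:C%C).
  by congr cintegral; apply/funext => t; rewrite mulr1.
apply: cseq_cvg_eq (has_csumZ z^-1 H) => N; apply: eq_bigr => k _.
under eq_Rintegral do rewrite mul1r.
rewrite Rintegral_exprn (_ : b k * z ^+ k * z * _ = z * (b k * (k.+1%:R^-1)%:C%C * z ^+ k)); first by rewrite mulKf.
by ring.
Qed.

Variable c : R.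
Hypothesis c0 : 0 < c.
Hypothesis radial : forall k : R -> \bar R,
  measurable_fun (`[0, 1[%classic : set R) k -> (forall r : R, 0 <= r < 1 -> (0 <= k r)%E) ->
  (\int[@area_measure R]_(p in @pair_disc R) k (cmod (complex_of_pair p)) =
   c%:E * \int[lebesgue_measure]_(r in `[0%R, 1%R[) (k r * r%:E))%E.

(** The factor t^k from f(tz) and t^(N-k) from the kernel combine to t^N, whose integral against the
    weight is the moment of order N. *)
Definition cesaro_coef (w : R -> R) (a : nat -> R[i]) (N : nat) : R[i] :=
  (\sum_(k < N.+1) a k * ((N - k).+1%:R * mono_sqnorm c w (N - k))^-1%:C%C) * (moment w N)%:C%C.

(** For fixed z the integrand is a power series in t, the Cauchy product of the series of f(tz) and
    of the averaged kernel. Since |z| < 1 its coefficients are absolutely summable, which allows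
    termwise integration up to t = 1. *)
Lemma cesaro_pser (w : R -> R) (a : nat -> R[i]) (f : R[i] -> R[i]) (z : R[i]) : radial_weight w ->
  (forall z, cmod z < 1 -> is_pser a z (f z)) -> cmod z < 1 ->
  is_pser (cesaro_coef w a) z (cesaro_op w f z).
Proof.
move=> hw hf z1; have [w0 iw _] := hw.
have ga : geom_bounded a 1 by apply: pser_cvg_radius => x /hf; exists (f x).
pose b n : R[i] := ((n.+1%:R * mono_sqnorm c w n)^-1)%:C%C.
have gb : geom_bounded b 1.
  have h01 : 0 <= (1 : R) <= 1 by rewrite ler01 lexx.
  move=> s s0 s1; have [M hM] := kernel_coef_bounded c0 hw h01 s0 s1; exists M => n; apply: le_trans (hM n).
  rewrite ler_wpM2r ?exprn_ge0// cmod_kernel_coef// expr1n cmodC ger0_norm; last first.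
    by rewrite invr_ge0 mulr_ge0// ltW// mono_sqnorm_gt0.
  by rewrite div1r invfM ler_piMl ?invr_ge0 ?(ltW (mono_sqnorm_gt0 _ _ _))// invf_le1// ler1n.
have sa := pser_abs_summable ga z1; have sb := pser_abs_summable gb z1.
have sab := conv_abs_summable sa sb.
have h01 t : (`[0, 1[%classic : set R) t -> 0 <= t < 1 by rewrite /= in_itv.
have tz t : (`[0, 1[%classic : set R) t -> cmod (t%:C%C * z) < 1.
  move=> /h01/andP[t0 t1]; rewrite cmodM cmodC ger0_norm//.
  by apply: le_lt_trans z1; rewrite ler_piMl ?cmod_ge0// ltW.
pose h t := f (t%:C%C * z) * segment_mean (bergman_kernel w t%:C%C) z.
have hh t : (`[0, 1[%classic : set R) t -> is_pser (fun N => \sum_(k < N.+1) a k * z ^+ k * (b (N - k)%N * z ^+ (N - k))) t%:C%C (h t).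
  move=> t01; have t01' := h01 _ t01; have /andP[t0 t1] := t01'.
  have gk : geom_bounded (kernel_coef c w t) 1 by apply: kernel_coef_bounded => //; rewrite t0 ltW.
  have hk (x : R[i]) : cmod x < 1 -> is_pser (kernel_coef c w t) x (bergman_kernel w t%:C%C x).
    by move=> x1; apply: bergman_kernel_pser.
  have hm : has_csum (fun n => b n * (t%:C%C * z) ^+ n) (segment_mean (bergman_kernel w t%:C%C) z).
    apply: cseq_cvg_eq (segment_mean_pser gk hk z1) => N; apply: eq_bigr => k _.
    have E : kernel_coef c w t k * (k.+1%:R^-1)%:C%C = b k * (t ^+ k)%:C%C.
      by rewrite /kernel_coef /b -!rmorphM [(_.+1%:R * _)^-1]invfM; congr (real_complex _ _); ring.
    by rewrite E exprMn rmorphXn mulrA.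
  have := has_csum_conv (pser_abs_summable ga (tz _ t01)) (pser_abs_summable gb (tz _ t01)) (hf _ (tz _ t01)) hm.
  apply: cseq_cvg_eq => N; apply: eq_bigr => n _; rewrite mulr_suml; apply: eq_bigr => k _.
  have E (x : R[i]) : x ^+ n = x ^+ k * x ^+ (n - k) by rewrite -exprD subnKC// -ltnS.
  by rewrite !exprMn (E t%:C%C); ring.
have h01' t : (`[0, 1[%classic : set R) t -> 0 <= t <= 1 by move=> /h01/andP[-> /ltW].
have w0' t : (`[0, 1[%classic : set R) t -> 0 <= w t by move=> /h01/w0.
have := @has_csum_cintegral `[0, 1[ w _ h (measurable_itv _) h01' w0' iw sab hh.
apply: cseq_cvg_eq => N; apply: eq_bigr => n _; rewrite /cesaro_coef [RHS]mulrAC; congr (_ * _).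
rewrite mulr_suml; apply: eq_bigr => k _.
have E : z ^+ n = z ^+ k * z ^+ (n - k) by rewrite -exprD subnKC// -ltnS.
by rewrite E /b; ring.
Qed.

End cesaro_series.

                                      

(** * Sufficiency for the matrix: a Schur test *)

Section discrete_hardy.
Variable R : realType.
Implicit Types (om m g a h : nat -> R).

(** The quadratic T - 2tU + t^2 S is a sum of nonnegative terms, evaluated at t = U/S; if S = 0
    every g_i vanishes. *)
Lemma weighted_cauchy_schwarz (I : finType) (a g h : I -> R) :
  (forall i, 0 <= g i) -> (forall i, 0 < h i) ->
  (\sum_i a i * g i) ^+ 2 <= (\sum_i g i * h i) * (\sum_i a i ^+ 2 * g i / h i).
Proof.
move=> g0 h0; set U := \sum_i a i * g i; set S := \sum_i g i * h i; set T := \sum_i _.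
have S0 : 0 <= S by apply: sumr_ge0 => i _; rewrite mulr_ge0// ltW.
have key t : 0 <= T - 2 * t * U + t ^+ 2 * S.
  rewrite /T /U /S !mulr_sumr -sumrB -big_split/=; apply: sumr_ge0 => i _.
  rewrite (_ : _ + _ = g i * h i * (a i / h i - t) ^+ 2); last by field; rewrite gt_eqF.
  by apply: mulr_ge0; [apply: mulr_ge0 => //; exact: ltW|exact: sqr_ge0].
move: S0; rewrite le_eqVlt => /predU1P[S0|S0].
  have U0 : U = 0.
    rewrite /U big1// => i _; have : g i * h i = 0.
      apply: (psumr_eq0P (P := xpredT) (F := fun i => g i * h i)) => // j _.
      by rewrite mulr_ge0// ltW.
    by move/eqP; rewrite mulf_eq0 (gt_eqF (h0 i)) orbF => /eqP ->; rewrite mulr0.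
  by rewrite U0 -S0 mul0r expr0n.
have := key (U / S); rewrite (_ : _ + _ = T - U ^+ 2 / S); last by field; rewrite gt_eqF.
by rewrite subr_ge0 ler_pdivrMr// mulrC.
Qed.

(** The Schur test function: its partial sums are of order sqrt N, while the tails of h_n/(n+1) are
    again of order h. *)
Let h n : R := (Num.sqrt n.+1%:R)^-1.

Let h_gt0 n : 0 < h n. Proof. by rewrite invr_gt0 sqrtr_gt0 ltr0n. Qed.

Let h_le k n : (k <= n)%N -> h n <= h k.
Proof. by move=> kn; rewrite lef_pV2 ?posrE ?sqrtr_gt0 ?ltr0n// ler_wsqrtr// ler_nat. Qed.

Let h_sqr n : h n ^+ 2 = n.+1%:R^-1.
Proof. by rewrite exprVn sqr_sqrtr// ler0n. Qed.

Let h_half k n : (n <= k.*2)%N -> h k <= 2 * h n.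
Proof.
move=> nk; rewrite -(@ler_pXn2r _ 2%N) ?nnegrE ?mulr_ge0 ?(ltW (h_gt0 _))//.
rewrite exprMn !h_sqr ler_pdivlMr ?ltr0n// mulrC ler_pdivrMr ?ltr0n// -natrX -natrM ler_nat; lia.
Qed.

Let sum_h N : \sum_(k < N) h k <= 2 * Num.sqrt N%:R.
Proof.
elim: N => [|N IH]; first by rewrite big_ord0 sqrtr0 mulr0.
rewrite big_ord_recr/=; apply: le_trans (lerD IH (lexx _)) _.
rewrite /h; set x := Num.sqrt N%:R; set y := Num.sqrt N.+1%:R.
have x0 : 0 <= x by exact: sqrtr_ge0.
have y0 : 0 < y by rewrite sqrtr_gt0 ltr0n.
have x2 : x ^+ 2 = N%:R by rewrite sqr_sqrtr// ler0n.
have y2 : y ^+ 2 = N%:R + 1 by rewrite sqr_sqrtr ?natr1// ler0n.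
rewrite -lerBrDl -(ler_pM2r y0) mulVf ?gt_eqF//.
have := sqr_ge0 (x - y); rewrite sqrrB x2 y2; rewrite expr2 in y2; lra.
Qed.

(** Telescoping: h_(n+1)/(n+2) is the cube of h_(n+1), which is at most 2(h_n - h_(n+1)). *)
Let sum_h3 k J : \sum_(j < J) h (k.+1 + j)%N / (k.+1 + j).+1%:R <= 2 * (h k - h (k + J)).
Proof.
elim: J => [|J IH]; first by rewrite big_ord0 addn0 subrr mulr0.
rewrite big_ord_recr/=; apply: le_trans (lerD IH (lexx _)) _.
rewrite addnS addSn; set n := (k + J)%N.
suff : h n.+1 / n.+2%:R <= 2 * (h n - h n.+1) by move=> hz; apply: le_trans (lerD (lexx _) hz) _; rewrite -mulrDr addrA subrK.
rewrite -h_sqr.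
have hn := h_gt0 n; have hn1 := h_gt0 n.+1.
have e : h n ^+ 2 - h n.+1 ^+ 2 = h n ^+ 2 * h n.+1 ^+ 2.
  have q0 : 0 < n.+1%:R :> R by rewrite ltr0n.
  rewrite !h_sqr -[n.+2%:R]natr1; move: n.+1%:R q0 => q q0.
  by field; apply/andP; split; rewrite gt_eqF//; lra.
have hl := h_le (leqnSn n).
set x := h n in hn hl e *; set y := h n.+1 in hn1 hl e *.
have h1 : (x - y) * (x + y) = x ^+ 2 * y ^+ 2 by rewrite -e; ring.
rewrite -(ler_pM2r (addr_gt0 hn hn1)) -!mulrA h1.
have : y ^+ 3 * (x + y) <= 2 * x ^+ 2 * y ^+ 2.
  have h2 : y * (x + y) <= 2 * x ^+ 2 by rewrite expr2; nra.
  have := ler_wpM2r (sqr_ge0 y) h2; rewrite !exprS; lra.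
by rewrite !exprS; lra.
Qed.

(** Schur test: weighted Cauchy-Schwarz in each row, then exchange of the sums. Monotonicity
    replaces m_N by m_k, so what has to be controlled are the row and column sums of the matrix om_N
    g_(N-k) against h. *)
Lemma hardy_bounded om m (A B : R) :
  (forall n, 0 < om n) -> (forall k n, (k <= n)%N -> om n <= om k) ->
  (forall n, 0 <= m n) -> (forall k n, (k <= n)%N -> m n <= m k) ->
  (forall n, om n <= A * om n.*2.+1) ->
  (forall n, om n * \sum_(j < n.+1) (j.+1%:R * om j.*2.+1)^-1 <= B) ->
  exists M : R, forall a P, \sum_(N < P) m N * (om N * \sum_(k < N.+1) a k * ((N - k).+1%:R * om (N - k).*2.+1)^-1) ^+ 2
    <= M * \sum_(k < P) m k * a k ^+ 2.
Proof.
move=> om0 oml m0 ml hA hB.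
pose g j := (j.+1%:R * om j.*2.+1)^-1.
have g0 j : 0 < g j by rewrite invr_gt0 mulr_gt0// ltr0n.
have A0 : 0 < A by have := hA 0%N; have := om0 0%N; have := om0 1%N; nra.
have g0' j : 0 <= g j by exact: ltW.
have h0' j : 0 <= h j by exact: ltW.
have om0' j : 0 <= om j by exact: ltW.
have A0' : 0 <= A by exact: ltW.
have B0 : 0 <= B.
  by apply: le_trans (hB 0%N); apply: mulr_ge0; [exact: ltW|apply: sumr_ge0 => i _; exact/ltW/g0].
(* For k <= N/2, doubling at N gives om_N <= A om_(2(N-k)+1), while N-k+1 >= (N+1)/2. *)
have far N k : (k.*2 <= N)%N -> om N * g (N - k)%N <= 2 * A / N.+1%:R.
  move=> kN; have kN' : (k <= N)%N by lia.
  rewrite /g ler_pdivrMr ?mulr_gt0 ?ltr0n// mulrACA.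
  apply: (@le_trans _ _ (A * om (N - k).*2.+1)).
    by apply: le_trans (hA N) _; rewrite ler_pM2l// oml//; lia.
  rewrite (_ : _ * _ * _ = A * om (N - k)%N.*2.+1 * (2 * (N - k).+1%:R / N.+1%:R)); last by ring.
  rewrite ler_peMr ?mulr_ge0 ?(ltW A0) ?(ltW (om0 _))//.
  rewrite ler_pdivlMr ?ltr0n// mul1r -[2]/(2%:R) -natrM ler_nat; lia.
(* Terms with k > N/2 have h_k <= 2 h_N and are summed by the bound B; the others use [far] and the
   sum of h. Each term is bounded by the sum of both estimates, so the range need not be split. *)
have row N : om N * \sum_(k < N.+1) g (N - k)%N * h k <= (2 * B + 4 * A) * h N.
  apply: (@le_trans _ _ (\sum_(k < N.+1) (2 * h N * (om N * g (N - k)%N) + 2 * A / N.+1%:R * h k))).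
    rewrite mulr_sumr; apply: ler_sum => k _; rewrite [leLHS]mulrA.
    have t0 : 0 <= om N * g (N - k)%N by rewrite mulr_ge0// ltW.
    have [kN|kN] := leqP k.*2 N.
      apply: le_trans (ler_wpM2r (ltW (h_gt0 k)) (far _ _ kN)) _.
      by rewrite lerDr; apply: mulr_ge0 => //; rewrite mulr_ge0 ?(ltW (h_gt0 _)).
    apply: le_trans (ler_wpM2l t0 (h_half (ltnW kN))) _; rewrite [leLHS]mulrC lerDl.
    by apply: mulr_ge0; rewrite ?(ltW (h_gt0 _))// divr_ge0 ?ler0n// mulr_ge0 ?(ltW A0).
  rewrite big_split/= -!mulr_sumr [leRHS]mulrDl; apply: lerD.
    rewrite [leRHS]mulrAC ler_wpM2l ?mulr_ge0 ?g0' ?h0' ?om0' ?A0'//; apply: le_trans (hB N).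
    by rewrite (reindex_inj rev_ord_inj)/= ler_pM2l// ler_sum// => j _; rewrite subSS subKn// -ltnS.
  apply: le_trans (ler_wpM2l _ (sum_h N.+1)) _; first by rewrite !mulr_ge0 ?invr_ge0 ?ler0n ?g0' ?h0' ?om0' ?A0'.
  have hN := h_sqr N; rewrite -hN /h.
  by rewrite le_eqVlt; apply/orP; left; apply/eqP; field; rewrite gt_eqF// sqrtr_gt0 ltr0n.
(* For j <= k monotonicity of om and h reduces the sum to the bound B at k; for j > k [far] leaves a
   tail of h_n/(n+1), which telescopes. *)
have col k J : \sum_(j < J) om (k + j)%N * h (k + j)%N * g j <= (B + 4 * A) * h k.
  apply: (@le_trans _ _ (\sum_(j < k.+1 + J) om (k + j)%N * h (k + j)%N * g j)).
    apply: (nneg_sum_leq (u := fun j => om (k + j)%N * h (k + j)%N * g j)); last by rewrite leq_addl.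
    by move=> j; rewrite !mulr_ge0.
  rewrite big_split_ord/= [leRHS]mulrDl; apply: lerD.
    apply: (@le_trans _ _ (\sum_(j < k.+1) om k * h k * g j)).
      apply: ler_sum => j _; rewrite ler_wpM2r ?g0' ?h0' ?om0' ?A0'//; apply: ler_pM; rewrite ?g0' ?h0' ?om0' ?A0'//.
        by rewrite oml// leq_addr.
      by rewrite h_le// leq_addr.
    by rewrite -mulr_sumr mulrAC ler_wpM2r ?g0' ?h0' ?om0' ?A0'// hB.
  apply: (@le_trans _ _ (\sum_(j < J) 2 * A * (h (k.+1 + j)%N / (k.+1 + j).+1%:R))).
    apply: ler_sum => j _.
    apply: (@le_trans _ _ (2 * A / (k + (k.+1 + j)).+1%:R * h (k.+1 + j)%N)).
      rewrite mulrAC; apply: ler_pM; rewrite ?mulr_ge0 ?g0' ?h0' ?om0' ?A0'//.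
        have := @far (k + (k.+1 + j))%N k; rewrite addKn; apply; lia.
      by rewrite h_le//; lia.
    rewrite -mulrA ler_pM2l ?mulr_gt0// mulrC ler_pM2l// lef_pV2 ?posrE ?ltr0n// ler_nat; lia.
  rewrite -mulr_sumr; apply: le_trans (ler_wpM2l _ (sum_h3 k J)) _; first by rewrite mulr_ge0 ?g0' ?h0' ?om0' ?A0'.
  by have := h_gt0 (k + J); nra.
exists ((2 * B + 4 * A) * (B + 4 * A)) => a P.
apply: (@le_trans _ _ (\sum_(N < P) \sum_(k < N.+1) (2 * B + 4 * A) * (m k * (a k ^+ 2 / h k) * (om (k + (N - k))%N * h (k + (N - k))%N * g (N - k)%N)))).
  apply: ler_sum => N _.
  have h1 := weighted_cauchy_schwarz (fun k : 'I_N.+1 => a k) (fun k : 'I_N.+1 => ltW (g0 (N - k)%N)) (fun k : 'I_N.+1 => h_gt0 k).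
  set T := \sum_(i < N.+1) a i ^+ 2 * _ / _ in h1.
  have T0 : 0 <= T.
    by apply: sumr_ge0 => i _; apply: divr_ge0 => //; apply: mulr_ge0 => //; exact: sqr_ge0.
  have h2 := le_trans (ler_wpM2l (om0' N) h1) _; rewrite mulrA in h2; have {}h2 := h2 _ (ler_wpM2r T0 (row N)).
  apply: (@le_trans _ _ (m N * (om N * ((2 * B + 4 * A) * h N * T)))).
    by rewrite ler_wpM2l// exprMn (expr2 (om N)) -(mulrA (om N)) ler_wpM2l.
  rewrite (_ : _ * _ = \sum_(k < N.+1) (2 * B + 4 * A) * (m N * (a k ^+ 2 / h k) * (om N * h N * g (N - k)%N))); last first.
    by rewrite /T !mulr_sumr; apply: eq_bigr => k _; ring.
  apply: ler_sum => k _; have kN : (k <= N)%N by rewrite -ltnS.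
  rewrite subnKC// ler_wpM2l ?addr_ge0 ?mulr_ge0// -[leLHS]mulrA -[leRHS]mulrA ler_wpM2r ?ml//.
  by apply: mulr_ge0; [apply: divr_ge0; [exact: sqr_ge0|]|rewrite !mulr_ge0].
rewrite (sum_triangle (fun k j => (2 * B + 4 * A) * (m k * (a k ^+ 2 / h k) * (om (k + j)%N * h (k + j)%N * g j)))).
rewrite -mulrA mulr_sumr mulr_sumr; apply: ler_sum => k _.
rewrite -!mulr_sumr ler_wpM2l ?addr_ge0 ?mulr_ge0 ?(ltW A0)//.
apply: le_trans (ler_wpM2l _ (col k (P - k)%N)) _; first by apply: mulr_ge0 => //; apply: divr_ge0; [exact: sqr_ge0|].
by rewrite le_eqVlt; apply/orP; left; apply/eqP; field; rewrite gt_eqF.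
Qed.

End discrete_hardy.

(** * Necessity for the matrix: testing on indicators *)

Section discrete_necessity.
Variable R : realType.
Variables (om m : nat -> R) (M D : R).
Hypothesis om0 : forall n, 0 < om n.
Hypothesis oml : forall k n, (k <= n)%N -> om n <= om k.
Hypothesis m0 : forall n, 0 < m n.
Hypothesis ml : forall k n, (k <= n)%N -> m n <= m k.
Hypothesis hD : forall n, (0 < n)%N -> m n <= D * m (13 * n)%N.
Hypothesis hM : forall (a : nat -> R) P K, (forall k, 0 <= a k) -> (forall k, (K <= k)%N -> a k = 0) ->
  \sum_(N < P) m N * (om N * \sum_(k < N.+1) a k * ((N - k).+1%:R * om (N - k).*2.+1)^-1) ^+ 2
    <= M * \sum_(k < K) m k * a k ^+ 2.

Let g j := (j.+1%:R * om j.*2.+1)^-1.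

Let g0 j : 0 < g j. Proof. by rewrite invr_gt0 mulr_gt0// ltr0n. Qed.

Let g0' j : 0 <= g j. Proof. exact: ltW. Qed.

Let om0' n : 0 <= om n. Proof. exact: ltW. Qed.

                                                                                               
(** The test sequence is the indicator of [n, 3n]. If the rows p <= N < p+n all take values at least
    beta, the left side is at least n m_(p+n) beta^2 and the right side at most 3 n M m_n; since p+n
    <= 13n, [hD] cancels the weights and beta^2 <= 3 M D. Adding 1 to the constant avoids a square
    root. *)
Let test_bound : exists2 C : R, 0 < C & forall n p (beta : R), (0 < n)%N -> (p + n <= 13 * n)%N -> 0 <= beta ->
  (forall N, (p <= N)%N -> (N < p + n)%N -> beta <= om N * \sum_(j < N.+1 | (n <= N - j <= 3 * n)%N) g j) -> beta <= C.
Proof.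
exists (`|3 * M * D| + 1) => [|n p beta n0 pn b0 hb]; first by rewrite ltr_wpDl.
pose a k : R := if (n <= k <= 3 * n)%N then 1 else 0.
have a0 k : 0 <= a k by rewrite /a; case: ifP.
have az k : ((3 * n).+1 <= k)%N -> a k = 0 by move=> nk; rewrite /a [(k <= _)%N]leqNgt nk andbF.
have H := hM (p + n) a0 az.
have E N : \sum_(k < N.+1) a k * ((N - k).+1%:R * om (N - k).*2.+1)^-1 = \sum_(j < N.+1 | (n <= N - j <= 3 * n)%N) g j.
  rewrite (reindex_inj rev_ord_inj)/= [RHS]big_mkcond/=; apply: eq_bigr => j _.
  have jN : (j <= N)%N by rewrite -ltnS.
  by rewrite subSS subKn// /a /g; case: ifP; rewrite ?mul1r ?mul0r.
have lo : n%:R * (m (p + n)%N * beta ^+ 2) <= \sum_(N < p + n) m N * (om N * \sum_(k < N.+1) a k * ((N - k).+1%:R * om (N - k).*2.+1)^-1) ^+ 2.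
  rewrite big_split_ord/=; apply: ler_wpDl.
    by apply: sumr_ge0 => N _; apply: mulr_ge0; [exact/ltW|exact: sqr_ge0].
  rewrite -[n in n%:R]card_ord mulr_natl -sumr_const; apply: ler_sum => j _.
  rewrite E; apply: ler_pM; [exact/ltW|exact: sqr_ge0|by rewrite ml// leq_add2l ltnW|].
  have hj := hb (p + j)%N (leq_addr _ _); rewrite ltn_add2l ltn_ord in hj.
  by rewrite lerXn2r ?nnegrE// ?hj// (le_trans b0 (hj isT)).
have up : \sum_(k < (3 * n).+1) m k * a k ^+ 2 <= 3 * n%:R * m n.
  apply: (@le_trans _ _ (\sum_(n <= k < (3 * n).+1) m n)).
    rewrite -(big_mkord xpredT (fun k => m k * a k ^+ 2)) (@big_cat_nat _ _ _ n)/=; [|lia|lia].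
    rewrite big_nat big1 ?add0r => [|k /andP[_ kn]]; last by rewrite /a leqNgt kn expr0n mulr0.
    apply: ler_sum_nat => k kn.
    by rewrite /a -ltnS kn expr1n mulr1 ml//; case/andP: kn.
  rewrite sumr_const_nat -[leLHS]mulr_natl ler_wpM2r ?(ltW (m0 _))//; rewrite -natrM ler_nat; lia.
have mp := m0 (p + n)%N; have nR : 0 < n%:R :> R by rewrite ltr0n.
have M0 : 0 <= M.
  have [//|Mn] := leP 0 M.
  have s0 : 0 < \sum_(k < (3 * n).+1) m k * a k ^+ 2.
    have nn : (n < (3 * n).+1)%N by lia.
    rewrite (bigD1 (Ordinal nn))//= {1}/a leqnn /= (_ : (n <= 3 * n)%N); last lia.
    rewrite expr1n mulr1 ltr_wpDr// sumr_ge0// => k _; apply: mulr_ge0; [exact/ltW|exact: sqr_ge0].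
  have : 0 <= n%:R * (m (p + n)%N * beta ^+ 2).
    by apply: mulr_ge0; [exact: ltW|apply: mulr_ge0; [exact: ltW|exact: sqr_ge0]].
  by move=> /le_trans /(_ (le_trans lo H)); rewrite nmulr_rge0// leNgt s0.
have b2 : beta ^+ 2 <= 3 * M * D.
  rewrite -(ler_pM2l mp) -(ler_pM2l nR); apply: le_trans lo _; apply: le_trans H _.
  apply: le_trans (ler_wpM2l M0 up) _.
  have h1 : m n <= D * m (p + n)%N.
    apply: le_trans (hD n0) _; have D0 : 0 <= D by have := hD n0; have := m0 n; have := m0 (13 * n)%N; nra.
    by rewrite ler_wpM2l// ml.
  have := ler_wpM2l (mulr_ge0 (mulr_ge0 M0 (ler0n R 3)) (ltW nR)) h1; lra.
have := ler_norm (3 * M * D); have [|b1] := leP beta 1; first by have := normr_ge0 (3 * M * D); lra.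
have b3 : beta <= beta ^+ 2 by rewrite expr2 ler_peMl// ltW.
lra.
Qed.

(** In the rows 12n <= N < 13n the support [n, 3n] corresponds to indices 9n <= j < 12n, where g_j
    >= 1/(13 n om_(18n+1)). The gain is that 18n+1 exceeds 13n by a fixed factor. *)
Let shift_bound : exists2 C : R, 0 < C & forall n, (0 < n)%N -> om (13 * n)%N <= C * om (18 * n).+1.
Proof.
have [C C0 hC] := test_bound; exists (13 * C) => [|n n0]; first by rewrite mulr_gt0.
have o1 := om0 (18 * n).+1.
suff : om (13 * n)%N / (13 * om (18 * n).+1) <= C by rewrite ler_pdivrMr ?mulr_gt0// mulrCA mulrA.
apply: (hC n (12 * n)%N) => //; [lia|by rewrite divr_ge0 ?mulr_ge0 |].
move=> N pN Np; apply: ler_pM; rewrite ?invr_ge0 ?mulr_ge0//.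
  by rewrite oml//; lia.
have -> : \sum_(j < N.+1 | (n <= N - j <= 3 * n)%N) g j = \sum_(0 <= j < N.+1 | (n <= N - j <= 3 * n)%N) g j by rewrite big_mkord.
rewrite (@big_cat_nat _ _ _ (N - 3 * n))/=; [|lia|lia]; apply: ler_wpDl; first by rewrite sumr_ge0.
rewrite (@big_cat_nat _ _ _ (N - n).+1)/=; [|lia|lia]; apply: ler_wpDr; first by rewrite sumr_ge0.
rewrite big_nat_cond (eq_bigl (fun j => (N - 3 * n <= j < (N - n).+1)%N)); last by move=> j; lia.
rewrite -big_nat; apply: (@le_trans _ _ (\sum_(N - 3 * n <= j < (N - n).+1) ((13 * n)%:R * om (18 * n).+1)^-1)).
  rewrite sumr_const_nat -[leRHS]mulr_natl natrM !invfM mulrA mulrA ler_pM2r ?invr_gt0//.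
  rewrite mulrAC ler_peMl ?invr_ge0//.
  by rewrite ler_pdivlMr ?ltr0n// mul1r ler_nat; lia.
apply: ler_sum_nat => j jn.
rewrite /g lef_pV2 ?posrE ?mulr_gt0 ?ltr0n//; last lia.
apply: ler_pM; rewrite ?ler0n // ?ler_nat; first lia.
by rewrite oml//; lia.
Qed.

(** With n = x %/ 13, the ratio 18/13 > 5/4 leaves room for rounding once x >= 110; smaller x are
    covered by a ratio of two fixed moments. *)
Let growth : exists2 C : R, 1 <= C & forall x, om x <= C * om (x + x %/ 4)%N.
Proof.
have [C C0 hC] := shift_bound.
exists (Num.max (Num.max 1 C) (om 0%N / om 200%N)) => [|x]; first by rewrite !le_max lexx.
have [x66|x66] := leqP 110 x.
  apply: (@le_trans _ _ (C * om (x + x %/ 4)%N)); last by rewrite ler_wpM2r// !le_max lexx orbT.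
  apply: (@le_trans _ _ (om (13 * (x %/ 13))%N)); first by rewrite oml//; lia.
  by apply: le_trans (hC _ _) _; [lia|rewrite ler_wpM2l ?(ltW C0)// oml//; lia].
apply: (@le_trans _ _ (om 0%N / om 200%N * om (x + x %/ 4)%N)); last by rewrite ler_wpM2r // le_max lexx orbT.
rewrite mulrAC ler_pdivlMr//; apply: ler_pM; rewrite  ?oml//; lia.
Qed.

(** Since (5/4)^4 > 2, four growth steps carry n past 2n+1 once n >= 50. *)
Lemma hardy_bounded_doubling : exists2 A : R, 0 < A & forall n, om n <= A * om n.*2.+1.
Proof.
have [C C1 hC] := growth.
have C0 : 0 <= C by apply: le_trans C1.
have iterE i x : om x <= C ^+ i * om (iter i (fun x => x + x %/ 4)%N x).
  elim: i => [|i IH]; first by rewrite mul1r.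
  by apply: le_trans IH _; rewrite exprSr -mulrA ler_wpM2l ?exprn_ge0//= hC.
have h4 := iterE 4%N; rewrite /= in h4.
exists (Num.max (C ^+ 4) (om 0%N / om 101%N)) => [|n]; first by rewrite lt_max exprn_gt0 ?orTb// (lt_le_trans ltr01).
have [n20|n20] := leqP 50 n.
  apply: le_trans (h4 n) _; apply: ler_pM; rewrite ?exprn_ge0 // ?le_max ?lexx// oml//; lia.
apply: (@le_trans _ _ (om 0%N / om 101%N * om n.*2.+1)); last by rewrite ler_wpM2r // le_max lexx orbT.
rewrite mulrAC ler_pdivlMr//; apply: ler_pM; rewrite  ?oml//; lia.
Qed.

(** In the rows 2n <= N < 3n every j <= n is hit by the support [n, 3n], so after doubling om_n
    sum_(j<=n) g_j is bounded. Applied at Ln with L = 2^(s+1) and compared with the s+1 dyadic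
    blocks between n and Ln, this bounds om_(Ln)/om_n by a constant over s+1. *)
Lemma hardy_bounded_decay (B : R) : 0 < B -> exists2 L, (1 < L)%N & forall n, (0 < n)%N -> om (L * n)%N <= om n / B.
Proof.
move=> B0; have [C C0 hC] := test_bound; have [A A0 hA] := hardy_bounded_doubling.
have G n : (0 < n)%N -> om n * \sum_(j < n.+1) g j <= A ^+ 2 * C.
  move=> n0; have : om (3 * n)%N * \sum_(j < n.+1) g j <= C.
    apply: (hC n (2 * n)%N) => //; [lia|by rewrite mulr_ge0// sumr_ge0|].
    move=> N pN Np; apply: ler_pM; rewrite ?sumr_ge0 ?oml//; first lia.
    rewrite -(big_mkord xpredT) -(big_mkord (fun j => (n <= N - j <= 3 * n)%N)) [leRHS](@big_cat_nat _ _ _ n.+1)/=; [|lia|lia].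
    rewrite ler_wpDr ?sumr_ge0//.
    rewrite big_nat [leRHS]big_nat_cond le_eqVlt; apply/orP; left; apply/eqP/eq_bigl => j; lia.
  move=> h; apply: le_trans (ler_wpM2l (ltW (exprn_gt0 2 A0)) h); rewrite mulrA ler_wpM2r ?sumr_ge0//.
  apply: le_trans (hA n) _; rewrite expr2 -mulrA ler_wpM2l ?(ltW A0)//; apply: le_trans (hA _) _.
  by rewrite ler_wpM2l ?(ltW A0)// oml//; lia.
have [s hs] : exists s, 2 * (A ^+ 2 * C) * B <= s.+1%:R.
  by exists (Num.truncn (2 * (A ^+ 2 * C) * B)); rewrite ltW// truncnS_gt.
(* On [y, 2y) each g_j is at least 1/(2 y om_y), so every dyadic block contributes at least 1/2
   after multiplication by om_n >= om_y. *)
have lg n k : (0 < n)%N -> k%:R / 2 <= om n * \sum_(n <= j < 2 ^ k * n) g j.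
  move=> n0; elim: k => [|k IH]; first by rewrite mul0r mul1n big_geq// mulr0.
  have kn : (n <= 2 ^ k * n)%N by rewrite leq_pmull// expn_gt0.
  rewrite (@big_cat_nat _ _ _ (2 ^ k * n))//=; last by rewrite expnS; lia.
  rewrite -natr1 mulrDl mulrDr lerD//.
  set y := (2 ^ k * n)%N in kn *.
  have y0 : (0 < y)%N by lia.
  have -> : (2 ^ k.+1 * n)%N = y.*2 by rewrite expnS /y; lia.
  apply: (@le_trans _ _ (om y * \sum_(y <= j < y.*2) (y.*2%:R * om y)^-1)); last first.
    apply: ler_pM; rewrite ?oml//; first by apply: sumr_ge0 => j _; rewrite invr_ge0 mulr_ge0.
    apply: ler_sum_nat => j jn.
    rewrite /g lef_pV2 ?posrE ?mulr_gt0 ?ltr0n//; last lia.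
    by apply: ler_pM; rewrite ?ler0n  ?ler_nat ?oml//; lia.
  rewrite sumr_const_nat (_ : y.*2 - y = y)%N; last lia.
  rewrite -mulr_natl -muln2 natrM le_eqVlt; apply/orP; left; apply/eqP; field.
  by rewrite gt_eqF ?om0// pnatr_eq0 -lt0n.
exists (2 ^ s.+1)%N => [|n n0]; first by rewrite -{1}(expn0 2) ltn_exp2l.
set L := (2 ^ s.+1)%N; have Ln : (n <= L * n)%N by rewrite leq_pmull// expn_gt0.
have := G (L * n)%N; rewrite muln_gt0 n0 expn_gt0 => /(_ isT) GL.
have oL := om0 (L * n)%N; have on := om0 n.
have h1 : \sum_(n <= j < L * n) g j <= \sum_(j < (L * n).+1) g j.
  rewrite -(big_mkord xpredT g) big_nat_recr//= (@big_cat_nat _ _ _ n 0)//=.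
  have : 0 <= \sum_(0 <= j < n) g j by apply: sumr_ge0.
  by have := g0 (L * n)%N; lra.
have h2 := lg n s.+1 n0; rewrite -/L in h2.
set S := \sum_(n <= j < L * n) g j in h1 h2; set T := \sum_(j < _) _ in h1 GL.
rewrite ler_pdivlMr//.
have h3 : om (L * n)%N * S <= A ^+ 2 * C by apply: le_trans GL; rewrite ler_pM2l.
have K0 : 0 < A ^+ 2 * C by rewrite mulr_gt0// exprn_gt0.
have h4 : A ^+ 2 * C * B <= om n * S by lra.
have S0 : 0 < S by have := mulr_gt0 K0 B0; nra.
rewrite -(ler_pM2r K0) -mulrA (mulrC B); apply: le_trans (ler_wpM2l (ltW oL) h4) _.
by rewrite mulrCA ler_wpM2l// ltW.
Qed.

End discrete_necessity.

                                            

(** * Moments against tails: the dictionary with the weight classes *)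

Section weight_classes.
Variable R : realType.
Implicit Types (om : nat -> R).

(** Strong induction through y = n %/ L: decay halves the part j <= y, and by doubling the block y <
    j <= n contributes at most L A. The constant satisfies B/2 + L A <= B. *)
Lemma log_sum_bounded om (A : R) L : (forall n, 0 < om n) -> (forall k n, (k <= n)%N -> om n <= om k) ->
  (forall n, om n <= A * om n.*2.+1) -> (1 < L)%N -> (forall n, (0 < n)%N -> om (L * n)%N <= om n / 2) ->
  exists B : R, forall n, om n * \sum_(j < n.+1) (j.+1%:R * om j.*2.+1)^-1 <= B.
Proof.
move=> om0 oml hA L1 hL; pose g j := (j.+1%:R * om j.*2.+1)^-1.
have g0 j : 0 <= g j by rewrite invr_ge0 mulr_ge0// ltW.
have A0 : 0 < A by have := hA 0%N; have := om0 0%N; have := om0 1%N; nra.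
pose G n := \sum_(j < n.+1) g j.
have G0 n : 0 <= G n by apply: sumr_ge0.
have Gl k n : (k <= n)%N -> G k <= G n by move=> kn; exact: nneg_sum_leq.
pose B := 2 * L%:R * A + om 0%N * G L.
have LA : 0 <= L%:R * A by rewrite mulr_ge0 ?ler0n// ltW.
have oG : 0 <= om 0%N * G L by rewrite mulr_ge0// ltW.
exists B => n; rewrite -/(G n).
elim/ltn_ind: n => n IH; have [nL|Ln] := ltnP n L.
  apply: (@le_trans _ _ (om 0%N * G L)); last by rewrite /B; lra.
  by apply: ler_pM; rewrite ?oml ?Gl ?G0 ?(ltW (om0 _))// ltnW.
pose y := (n %/ L)%N.
have y0 : (0 < y)%N by rewrite divn_gt0// (ltn_trans _ L1).
have yn : (y < n)%N by rewrite ltn_Pdiv// (leq_trans _ Ln)// (ltn_trans _ L1).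
have Ly : (L * y <= n)%N by rewrite mulnC leq_divM.
have nLy : (n < L * y.+1)%N by rewrite mulnC ltn_ceil// (ltn_trans _ L1).
have oy : om n <= om y / 2 by apply: le_trans (hL y y0); rewrite oml.
have h1 : om n * G y <= B / 2.
  apply: le_trans (ler_wpM2r (G0 y) oy) _; have := IH y yn; lra.
have h2 : om n * \sum_(y.+1 <= j < n.+1) g j <= L%:R * A.
  have h3 : \sum_(y.+1 <= j < n.+1) g j <= L%:R * A / om n.
    apply: (@le_trans _ _ (\sum_(y.+1 <= j < n.+1) (y.+1%:R^-1 * (A / om n)))).
      apply: ler_sum_nat => j /andP[yj jn]; rewrite /g invfM ler_pM ?invr_ge0 ?ler0n ?(ltW (om0 _))//.
        by rewrite lef_pV2 ?posrE ?ltr0n// ler_nat; lia.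
      rewrite ler_pdivlMr// ler_pdivrMl// mulrC; apply: le_trans (hA n) _.
      by rewrite ler_pM2l// oml//; lia.
    rewrite sumr_const_nat -[leLHS]mulr_natl mulrA -[leRHS]mulrA ler_wpM2r//; first by rewrite divr_ge0 ?(ltW A0) ?(ltW (om0 _)).
    by rewrite ler_pdivrMr ?ltr0n// -natrM ler_nat; lia.
  by rewrite -ler_pdivlMl// mulrC.
have -> : G n = G y + \sum_(y.+1 <= j < n.+1) g j.
  rewrite /G -!(big_mkord xpredT g) (@big_cat_nat _ _ _ y.+1)//=; lia.
by rewrite mulrDr; apply: le_trans (lerD h1 h2) _; rewrite /B; lra.
Qed.

(** Chooses s so that the contraction 2^-(2^s - 1) of the split moment absorbs a loss C^(s+1) with a
    factor 2 to spare. *)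
Lemma expn_beats_geometric (C : R) : exists s, 2 * C ^+ s.+1 <= 2 ^+ (2 ^ s).-1.
Proof.
have [k hk] : exists k, `|C| <= 2 ^+ k.
  exists (Num.truncn `|C|).+1; apply: le_trans (ltW (truncnS_gt _)) _.
  by rewrite -natrX ler_nat ltnW// ltn_expl.
exists (2 * k + 4)%N; apply: (@le_trans _ _ (2 * (2 ^+ k) ^+ (2 * k + 4).+1)).
  by rewrite ler_pM2l//; apply: le_trans (ler_norm _) _; rewrite normrX lerXn2r ?nnegrE ?exprn_ge0.
rewrite -exprM -exprS ler_weXn2l ?ler1n//.
have : (k < 2 ^ k)%N by rewrite ltn_expl.
rewrite expnD mulnC expnM (_ : (2 ^ 2)%N = 4)// (_ : (2 ^ 4)%N = 16)//.
rewrite (_ : (4 ^ k = 2 ^ k * 2 ^ k)%N); last by rewrite -expnMn.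
set p := (2 ^ k)%N; nia.
Qed.

(** Bernoulli gives (1 + 1/n)^n >= 2, and the product of the two powers is at most 1. *)
Lemma one_sub_inv_exp_le n : (0 < n)%N -> (1 - n%:R^-1) ^+ n <= 2^-1 :> R.
Proof.
move=> n0; have nR : 0 < n%:R :> R by rewrite ltr0n.
have x1 : n%:R^-1 <= 1 :> R by rewrite invf_le1// ler1n.
have x0 : 0 < n%:R^-1 :> R by rewrite invr_gt0.
have b : 2 <= (1 + n%:R^-1) ^+ n :> R.
  suff h k : 1 + k%:R * n%:R^-1 <= (1 + n%:R^-1) ^+ k :> R.
    by apply: le_trans (h n); rewrite divff ?gt_eqF//; lra.
  elim: k => [|k IH]; first by rewrite mul0r addr0.
  rewrite exprSr -natr1; have kR : 0 <= k%:R :> R by rewrite ler0n.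
  have h0 : 0 <= 1 + n%:R^-1 :> R by lra.
  by apply: le_trans (ler_wpM2r h0 IH); rewrite mulrDl; nra.
have s0 : 0 <= (1 - n%:R^-1) ^+ n :> R by rewrite exprn_ge0// subr_ge0.
have p1 : (1 - n%:R^-1) ^+ n * (1 + n%:R^-1) ^+ n <= 1 :> R.
  rewrite -exprMn exprn_ile1//; last by nra.
  by apply: mulr_ge0; lra.
nra.
Qed.

(** Bernoulli on each half of the exponent gives factors at least 1/2 and 1/4. *)
Lemma one_sub_inv_exp_ge n : (1 < n)%N -> 8^-1 <= (1 - n%:R^-1) ^+ n :> R.
Proof.
move=> n1; have nR : 0 < n%:R :> R by rewrite ltr0n (ltn_trans _ n1).
have x1 : n%:R^-1 <= 1 :> R by rewrite invf_le1// ler1n ltnW.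
have x0 : 0 < n%:R^-1 :> R by rewrite invr_gt0.
have h k : 1 - k%:R * n%:R^-1 <= (1 - n%:R^-1) ^+ k :> R.
  elim: k => [|k IH]; first by rewrite mul0r subr0.
  rewrite exprSr -natr1; have kR : 0 <= k%:R :> R by rewrite ler0n.
  have h0 : 0 <= 1 - n%:R^-1 :> R by lra.
  by apply: le_trans (ler_wpM2r h0 IH); rewrite mulrDl; nra.
have h1 : 2^-1 <= (1 - n%:R^-1) ^+ n./2 :> R.
  apply: le_trans (h _); suff : (n./2)%:R * n%:R^-1 <= 2^-1 :> R by lra.
  by rewrite ler_pdivrMr// ler_pdivlMl// -natrM ler_nat; lia.
have h2 : 4^-1 <= (1 - n%:R^-1) ^+ uphalf n :> R.
  apply: le_trans (h _); suff : (uphalf n)%:R * n%:R^-1 <= 3 / 4 :> R by lra.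
  by rewrite ler_pdivrMr// mulrAC ler_pdivlMr// -!natrM ler_nat; lia.
have -> : n = (n./2 + uphalf n)%N by lia.
rewrite (_ : (n./2 + uphalf n)%:R = n%:R); last by congr (_%:R); lia.
rewrite exprD; apply: le_trans (ler_pM _ _ h1 h2); lra.
Qed.

Variable w : R -> R.
Hypothesis hw : radial_weight w.

(** At 1 - 1/n the power r^n has constant order, so this tail is the natural size of the moment of
    order n. *)
Definition tail_at n : R := tail_integral w (1 - n%:R^-1).

Let om := moment w.
Let om0 n : 0 < om n. Proof. exact: moment_gt0. Qed.

Let oml k n : (k <= n)%N -> om n <= om k. Proof. exact: moment_le. Qed.

Let inv01 n : (0 < n)%N -> 0 < (n%:R^-1 : R) <= 1.
Proof. by move=> n0; rewrite invr_gt0 ltr0n n0 invf_le1 ?ler1n// ltr0n. Qed.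

Let phi0 n : (0 < n)%N -> 0 < tail_at n.
Proof. by move=> /inv01 h; apply: (radial_weight_tail_gt0 hw); lra. Qed.

Let phil k n : (0 < k)%N -> (k <= n)%N -> tail_at n <= tail_at k.
Proof.
move=> k0 kn; have n0 : (0 < n)%N by exact: leq_trans kn.
apply: tail_le => //; first by have := inv01 k0; lra.
by rewrite lerD2l lerN2 lef_pV2 ?posrE ?ltr0n// ler_nat.
Qed.

Let phi_om n : (1 < n)%N -> tail_at n <= 8 * om n.
Proof.
move=> n1; have n0 := ltnW n1; have h0 : 0 <= 1 - n%:R^-1 :> R by have := inv01 n0; lra.
have := moment_ge_tail n hw h0; rewrite -/(tail_at n) => h.
have := ler_wpM2r (ltW (phi0 n0)) (one_sub_inv_exp_ge n1); rewrite -/om in h *; lra.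
Qed.

(** Splitting at rho = 1 - 1/n, where rho^n <= 1/2: the excess exponent (2^s - 1) n gives the factor
    2^-(2^s - 1). *)
Let split_om n s : (0 < n)%N -> om (2 ^ s * n)%N <= 2^-1 ^+ (2 ^ s).-1 * om n + tail_at n.
Proof.
move=> n0; have h01 : 0 <= (1 - n%:R^-1 : R) < 1 by have := inv01 n0; lra.
have ns : (n <= 2 ^ s * n)%N by rewrite leq_pmull// expn_gt0.
apply: le_trans (moment_le_split hw h01 ns) _; rewrite lerD2r ler_wpM2r ?(ltW (om0 _))//.
rewrite (_ : (2 ^ s * n - n = n * (2 ^ s).-1)%N); last by rewrite -subn1 mulnBr muln1 mulnC.
rewrite exprM lerXn2r ?nnegrE ?invr_ge0 ?ler0n ?exprn_ge0//; [by case/andP: h01|exact: one_sub_inv_exp_le].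
Qed.

Let Dhat_dbl : class_Dhat w -> exists2 C : R, 1 < C & forall n, (0 < n)%N -> tail_at n <= C * tail_at n.*2.
Proof.
move=> [C [C1 hC]]; exists C => // n n0; have h := inv01 n0; have := hC (1 - n%:R^-1); rewrite /tail_at.
rewrite (_ : (1 + (1 - n%:R^-1)) / 2 = 1 - n.*2%:R^-1); last first.
  by rewrite -muln2 natrM; field; rewrite gt_eqF// ltr0n.
by apply; lra.
Qed.

Let tail_at_le : exists2 B : R, 0 < B & forall n, (0 < n)%N -> tail_at n <= B * om n.
Proof.
have p0 : 0 <= tail_at 1 / om 1%N by rewrite divr_ge0// ltW// phi0.
exists (8 + tail_at 1 / om 1%N) => [|[|[|n]]] // => [|_|_]; first lra.
- by rewrite mulrDl divfK ?gt_eqF// lerDr mulr_ge0// ltW.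
- by apply: le_trans (phi_om _) _ => //; rewrite ler_wpM2r ?(ltW (om0 _))//; lra.
Qed.

(** Strong induction through y = n %/ 2^s. Splitting at scale y contracts the moment by 2^-(2^s -
    1), and passing from the tail at y to the tail at n costs at most C^(s+1); s makes the product
    at most 1/2. *)
Lemma Dhat_moment_le_tail : class_Dhat w -> exists2 A : R, 0 < A & forall n, (0 < n)%N -> om n <= A * tail_at n.
Proof.
move=> /Dhat_dbl[C C1 dbl].
have C0 : 0 < C by lra.
have dbls s n : (0 < n)%N -> tail_at n <= C ^+ s * tail_at (2 ^ s * n)%N.
  move=> n0; elim: s => [|s IH]; first by rewrite !mul1r mul1n.
  apply: le_trans IH _; rewrite exprSr -mulrA ler_wpM2l ?exprn_ge0 ?(ltW C0)// expnS -mulnA mul2n.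
  by apply: dbl; rewrite muln_gt0 expn_gt0.
have [s hs] := expn_beats_geometric C.
pose L := (2 ^ s)%N; have L0 : (0 < L)%N by rewrite expn_gt0.
have K0 : 0 < C ^+ s.+1 by rewrite exprn_gt0.
have P0 : 0 < om 0%N / tail_at L by rewrite divr_gt0// phi0.
pose A := 2 * C ^+ s.+1 + om 0%N / tail_at L.
have A0 : 0 < A by rewrite /A; lra.
exists A => // n; elim/ltn_ind: n => n IH n0.
have [nL|Ln] := leqP n L.
  apply: (@le_trans _ _ (om 0%N / tail_at L * tail_at n)); last by rewrite ler_wpM2r ?(ltW (phi0 n0))// /A; lra.
  rewrite mulrAC ler_pdivlMr ?phi0//.
  by apply: ler_pM; rewrite ?(ltW (om0 _)) ?(ltW (phi0 L0)) ?oml ?phil.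
(* For s = 0 the choice of s would read 2 C <= 1. *)
case: (posnP s) => [s0|s0].
  by move: hs; rewrite s0 expr1 expr0; lra.
have L1 : (1 < L)%N by rewrite -(expn0 2) ltn_exp2l.
pose y := (n %/ L)%N.
have y0 : (0 < y)%N by rewrite divn_gt0// ltnW.
have yn : (y < n)%N by rewrite ltn_Pdiv.
have Ly : (L * y <= n)%N by rewrite mulnC leq_divM.
have nLy : (n <= 2 ^ s.+1 * y)%N.
  have : (n < L * y.+1)%N by rewrite mulnC ltn_ceil.
  by rewrite expnS -/L; nia.
have py : tail_at y <= C ^+ s.+1 * tail_at n.
  by apply: le_trans (dbls s.+1 y y0) _; rewrite ler_pM2l// phil.
have q0 : 0 <= 2^-1 ^+ (2 ^ s).-1 :> R by rewrite exprn_ge0// invr_ge0.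
have q1 : 2^-1 ^+ (2 ^ s).-1 * C ^+ s.+1 <= 2^-1.
  by rewrite exprVn ler_pdivrMl ?exprn_gt0//; lra.
apply: le_trans (oml Ly) _; apply: le_trans (split_om s y0) _.
have h1 : 2^-1 ^+ (2 ^ s).-1 * om y <= A * 2^-1 * tail_at n.
  apply: le_trans (ler_wpM2l q0 (IH y yn y0)) _.
  apply: (@le_trans _ _ (A * (2^-1 ^+ (2 ^ s).-1 * C ^+ s.+1) * tail_at n)).
    rewrite mulrCA -!mulrA ler_pM2l// ler_wpM2l//.
  by rewrite ler_wpM2r ?(ltW (phi0 n0))// ler_pM2l.
apply: le_trans (lerD h1 py) _; rewrite -mulrDl ler_wpM2r ?(ltW (phi0 n0))// /A; lra.
Qed.

Lemma Dhat_moment_doubling : class_Dhat w -> exists A : R, forall n, om n <= A * om n.*2.+1.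
Proof.
move=> hd; have [A A0 hA] := Dhat_moment_le_tail hd; have [C C1 dbl] := Dhat_dbl hd.
exists (Num.max (om 0%N / om 1%N) (A * (C * (C * 8)))) => n.
case: n => [|n].
  apply: (@le_trans _ _ (om 0%N / om 1%N * om 1%N)); first by rewrite divfK ?gt_eqF.
  by rewrite ler_wpM2r ?(ltW (om0 _))// le_max lexx.
apply: (@le_trans _ _ (A * (C * (C * 8)) * om n.+1.*2.+1)); last by rewrite ler_wpM2r ?(ltW (om0 _))// le_max lexx orbT.
apply: le_trans (hA _ (ltn0Sn n)) _; rewrite -!mulrA ler_pM2l//.
apply: le_trans (dbl _ (ltn0Sn n)) _; rewrite ler_pM2l; last lra.
have n2 : (0 < n.+1.*2)%N by lia.
apply: le_trans (dbl _ n2) _; rewrite ler_pM2l; last lra.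
by apply: le_trans (phi_om _) _; [lia|rewrite ler_pM2l// oml//; lia].
Qed.

(** Iterating [class_Dcheck] shrinks the tail at L^k n by C^k relative to the tail at n. Moments are
    comparable with tails, so C^k >= 2 A B halves the moment. *)
Lemma D_moment_decay : class_D w -> exists2 L, (1 < L)%N & forall n, (0 < n)%N -> om (L * n)%N <= om n / 2.
Proof.
move=> [hd [K [C [K1 C1 hC]]]]; have [A A0 hA] := Dhat_moment_le_tail hd.
pose L := (Num.truncn K).+1; have KL : K <= L%:R by rewrite ltW// truncnS_gt.
have L0 : (0 < L)%N by [].
have C0 : 0 < C by lra.
have step n : (0 < n)%N -> C * tail_at (L * n)%N <= tail_at n.
  move=> n0; have h := inv01 n0; have r1 : 0 <= (1 - n%:R^-1 : R) < 1 by lra.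
  apply: le_trans (hC _ r1); rewrite ler_pM2l//.
  have Kn : (1 - (1 - n%:R^-1)) / K = (K * n%:R)^-1 by rewrite subKr invfM mulrC.
  have nR : 0 < n%:R :> R by rewrite ltr0n.
  apply: tail_le => //.
    by rewrite Kn subr_ge0 invf_le1 ?mulr_gt0//; [have : 1 <= n%:R :> R by [rewrite ler1n]; nra|lra].
  by rewrite Kn lerD2l lerN2 lef_pV2 ?posrE ?natrM ?mulr_gt0 ?ltr0n ?ler_pM2r//; lra.
have steps k n : (0 < n)%N -> C ^+ k * tail_at (L ^ k * n)%N <= tail_at n.
  move=> n0; elim: k => [|k IH]; first by rewrite mul1r mul1n.
  apply: le_trans IH; rewrite exprSr -mulrA ler_pM2l ?exprn_gt0// expnS -mulnA.
  by apply: step; rewrite muln_gt0 n0 expn_gt0.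
have [B B0 hB] := tail_at_le.
have [k hk] : exists k, 2 * A * B <= C ^+ k.
  have d0 : 0 < C - 1 by lra.
  have [k h1] : exists k, 2 * A * B / (C - 1) <= k%:R.
    by exists (Num.truncn (2 * A * B / (C - 1))).+1; rewrite ltW// truncnS_gt.
  exists k; rewrite ler_pdivrMr// in h1; apply: le_trans h1 _.
  elim: k => [|k IH]; first by rewrite mul0r.
  rewrite exprSr -natr1 mulrDl mul1r.
  have c1 : 1 <= C ^+ k by rewrite exprn_ege1// ltW.
  nra.
exists (L ^ k.+1)%N => [|n n0].
  have L1 : (1 < L)%N by rewrite -(ltr_nat R) (lt_le_trans K1).
  by rewrite -(expn0 L) ltn_exp2l.
have Ln : (L ^ k * n <= L ^ k.+1 * n)%N by rewrite leq_mul2r leq_exp2l ?leqnSn ?orbT// -(ltr_nat R) (lt_le_trans K1).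
apply: le_trans (oml Ln) _.
have p0 : (0 < L ^ k * n)%N by rewrite muln_gt0 n0 expn_gt0.
apply: le_trans (hA _ p0) _.
rewrite ler_pdivlMr// -(ler_pM2l (mulr_gt0 B0 A0)).
have h1 := le_trans (steps k n n0) (hB n n0).
have h2 := ler_wpM2r (ltW (phi0 p0)) hk.
have := ler_wpM2l (ltW A0) (le_trans h2 h1); nra.
Qed.

(** Passing from n to 2^s n costs A^s; for s large the contracted part of the split is at most om_n
    / 2 and is absorbed on the left. *)
Lemma moment_doubling_le_tail (A : R) : 0 < A -> (forall n, om n <= A * om n.*2.+1) ->
  exists2 B : R, 0 < B & forall n, (0 < n)%N -> om n <= B * tail_at n.
Proof.
move=> A0 hA.
have dbls s n : om n <= A ^+ s * om (2 ^ s * n)%N.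
  elim: s => [|s IH]; first by rewrite mul1r mul1n.
  apply: le_trans IH _; rewrite exprSr -mulrA ler_wpM2l ?exprn_ge0 ?(ltW A0)// expnS -mulnA.
  by apply: le_trans (hA _) _; rewrite ler_pM2l// oml//; lia.
have [s hs] := expn_beats_geometric (Num.max A 1).
have M1 : A ^+ s <= Num.max A 1 ^+ s.+1.
  apply: (@le_trans _ _ (Num.max A 1 ^+ s)).
    by rewrite lerXn2r ?nnegrE ?le_max ?lexx ?ler01 ?(ltW A0) ?orbT.
  by rewrite ler_weXn2l// le_max lexx orbT.
exists (2 * A ^+ s) => [|n n0]; first by rewrite mulr_gt0// exprn_gt0.
have h1 := le_trans (dbls s n) (ler_wpM2l (exprn_ge0 s (ltW A0)) (split_om s n0)).
have q1 : A ^+ s * 2^-1 ^+ (2 ^ s).-1 <= 2^-1.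
  by rewrite exprVn ler_pdivrMr ?exprn_gt0//; lra.
have := ler_wpM2r (ltW (om0 n)) q1; lra.
Qed.

(** Carries estimates at the points 1 - 1/n over to arbitrary r, with n the integer part of 1/(1 -
    r). *)
Let bracket (r : R) : 0 <= r < 1 -> exists2 n, (0 < n)%N & 1 - n%:R^-1 <= r /\ r < 1 - n.+1%:R^-1.
Proof.
move=> /andP[r0 r1]; have d0 : 0 < 1 - r by rewrite subr_gt0.
have i1 : 1 <= (1 - r)^-1 by rewrite invf_ge1//; lra.
have /truncn_itv/andP[t1 t2] : 0 <= (1 - r)^-1 by lra.
exists (Num.truncn (1 - r)^-1) => [|]; first by rewrite truncn_gt0.
have tR : 0 < (Num.truncn (1 - r)^-1)%:R :> R by rewrite ltr0n truncn_gt0.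
split.
  suff : 1 - r <= (Num.truncn (1 - r)^-1)%:R^-1 by lra.
  by rewrite -[leLHS]invrK lef_pV2 ?posrE ?invr_gt0.
suff : (Num.truncn (1 - r)^-1).+1%:R^-1 < 1 - r by move: (_.+1%:R^-1) => x; lra.
by rewrite -[ltRHS]invrK ltf_pV2 ?posrE ?invr_gt0 ?ltr0n.
Qed.

(** From the tail at r to the tail at 1 - 1/n, the moment n, the moment 2n+2 by two doublings, and
    the tail at 1 - 1/(2n+2), a point beyond (1 + r)/2. *)
Lemma moment_doubling_Dhat (A : R) : 0 < A -> (forall n, om n <= A * om n.*2.+1) -> class_Dhat w.
Proof.
have arith k : (0 < k)%N -> (k.+1.*2 <= k.*2.+1.*2.+1)%N by lia.
move=> A0 hA; have [B B0 hB] := moment_doubling_le_tail A0 hA.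
have [E E0 hE] := tail_at_le.
pose K := E * (A * (A * B)); have K0 : 0 < K by rewrite !mulr_gt0.
exists (K + 1); split=> [|r r01]; first lra.
have [n n0 [nr rn]] := bracket r01; have h := inv01 n0; have /andP[r0 r1] := r01.
have t0 : 0 < tail_integral w ((1 + r) / 2) by apply: (radial_weight_tail_gt0 hw); lra.
apply: (@le_trans _ _ (K * tail_integral w ((1 + r) / 2))); last by rewrite ler_wpM2r ?(ltW t0)//; lra.
apply: (@le_trans _ _ (tail_at n)); first by apply: tail_le => //; lra.
apply: le_trans (hE n n0) _; rewrite /K -!mulrA ler_pM2l//.
apply: le_trans (hA n) _; rewrite ler_pM2l//; apply: le_trans (hA _) _; rewrite ler_pM2l//.
apply: (@le_trans _ _ (om n.+1.*2)); first by rewrite oml// arith.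
apply: le_trans (hB _ _) _; first by rewrite double_gt0.
rewrite ler_pM2l//; apply: tail_le => //; first lra.
have -> : n.+1.*2%:R^-1 = n.+1%:R^-1 / 2 :> R by rewrite -muln2 natrM invfM.
by move: (n.+1%:R^-1) rn => x; lra.
Qed.

(** The decay factor 16 B pays for the 8 between tail and moment and the B on the way back, and
    leaves the 2 that serves as constant of [class_Dcheck]. *)
Lemma moment_decay_Dcheck (A : R) : 0 < A -> (forall n, om n <= A * om n.*2.+1) ->
  (forall B : R, 0 < B -> exists2 L, (1 < L)%N & forall n, (0 < n)%N -> om (L * n)%N <= om n / B) -> class_Dcheck w.
Proof.
move=> A0 hA hL; have [B B0 hB] := moment_doubling_le_tail A0 hA.
have [L L1 {}hL] := hL (16 * B) (mulr_gt0 (ltr0Sn R 15) B0).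
have LR : 1 < L%:R :> R by rewrite ltr1n.
exists (2 * L%:R), 2; split; [lra|lra|move=> r r01].
have [n n0 [nr rn]] := bracket r01; have h := inv01 n0; have /andP[r0 r1] := r01.
have h1 : tail_integral w (1 - (1 - r) / (2 * L%:R)) <= tail_at (L * n.*2)%N.
  apply: tail_le => //.
    by have := @inv01 (L * n.*2)%N; rewrite muln_gt0 double_gt0 n0 (ltnW L1) => /(_ isT); lra.
  rewrite (_ : (L * n.*2)%:R^-1 = n%:R^-1 / (2 * L%:R)); last by rewrite -muln2 !natrM !invfM; ring.
  by rewrite lerD2l lerN2 ler_wpM2r ?invr_ge0 ?mulr_ge0 ?ler0n//; lra.
have h2 : tail_at (L * n.*2)%N <= 8 * om (L * n.*2)%N by apply: phi_om; rewrite (leq_trans _ (leq_pmull _ (ltnW L1)))// -[2%N]/(1.*2) leq_double.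
have h3 : om (L * n.*2)%N <= om n.*2 / (16 * B) by apply: hL; rewrite double_gt0.
have h4 : om n.*2 <= B * tail_at n.+1.
  by apply: le_trans (hB n.+1 (ltn0Sn n)); rewrite oml// -addnn -addn1 leq_add2l.
have h5 : tail_at n.+1 <= tail_integral w r by apply: tail_le => //; exact: ltW.
rewrite ler_pdivlMr ?mulr_gt0// in h3.
have h6 : om (L * n.*2)%N * 16 <= tail_integral w r.
  by rewrite -(ler_pM2l B0); have := ler_wpM2l (ltW B0) h5; lra.
lra.
Qed.

End weight_classes.

                                           

(** * Boundedness of the operator as the matrix inequality, and the equivalence *)

Section boundedness.
Variables (R : realType) (c : R).
Hypothesis c0 : 0 < c.
Hypothesis radial : forall k : R -> \bar R,
  measurable_fun (`[0, 1[%classic : set R) k -> (forall r : R, 0 <= r < 1 -> (0 <= k r)%E) ->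
  (\int[@area_measure R]_(p in @pair_disc R) k (cmod (complex_of_pair p)) =
   c%:E * \int[lebesgue_measure]_(r in `[0%R, 1%R[) (k r * r%:E))%E.
Variables (mu omega : R -> R).
Hypotheses (hmu : radial_weight mu) (homega : radial_weight omega).

Let m n := moment mu n.*2.+1.
Let om := moment omega.
Let om0 n : 0 < om n. Proof. exact: moment_gt0. Qed.

Let oml k n : (k <= n)%N -> om n <= om k. Proof. exact: moment_le. Qed.

Let m0 n : 0 < m n. Proof. exact: moment_gt0. Qed.

Let ml k n : (k <= n)%N -> m n <= m k.
Proof. by move=> kn; apply: moment_le => //; rewrite ltnS leq_double. Qed.

Lemma sqnorm_fineK (f : R[i] -> R[i]) : bergman_space mu f -> (fine (bergman_sqnorm mu f))%:E = bergman_sqnorm mu f.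
Proof. by move=> [_ foo]; rewrite fineK// ge0_fin_numE// sqnorm_ge0. Qed.

Lemma cesaro_coefE a N : cesaro_coef c omega (fun k => (a k)%:C%C) N =
  (c^-1 * (om N * \sum_(k < N.+1) a k * ((N - k).+1%:R * om (N - k).*2.+1)^-1))%:C%C.
Proof.
rewrite /cesaro_coef (eq_bigr (fun k : 'I_N.+1 => (a k * ((N - k).+1%:R * (c * om (N - k).*2.+1))^-1)%:C%C)); last first.
  by move=> k _; rewrite -rmorphM.
rewrite -rmorph_sum -rmorphM/=; congr (real_complex _ _).
rewrite mulrC mulrCA; congr (_ * _); rewrite mulr_sumr; apply: eq_bigr => k _.
by rewrite [(_ * (c * _))^-1]invfM [(c * _)^-1]invfM [(_ * om _)^-1]invfM; ring.
Qed.

(** The matrix entries are nonnegative, so replacing a_k by its modulus can only enlarge the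
    result. *)
Lemma cmod_cesaro_coef_le a N : cmod (cesaro_coef c omega a N) <=
  c^-1 * (om N * \sum_(k < N.+1) cmod (a k) * ((N - k).+1%:R * om (N - k).*2.+1)^-1).
Proof.
have -> : c^-1 * (om N * \sum_(k < N.+1) cmod (a k) * ((N - k).+1%:R * om (N - k).*2.+1)^-1) =
  (\sum_(k < N.+1) cmod (a k) * ((N - k).+1%:R * (c * om (N - k).*2.+1))^-1) * om N.
  rewrite mulrC -mulrA mulrC; congr (_ * _); rewrite mulr_suml; apply: eq_bigr => k _.
  by rewrite [(_ * (c * _))^-1]invfM [(c * _)^-1]invfM [(_ * om _)^-1]invfM; ring.
rewrite /cesaro_coef cmodM cmodC (ger0_norm (ltW (om0 N))) ler_wpM2r ?(ltW (om0 N))//.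
apply: le_trans (ler_cmod_sum _ _ _) _; apply: ler_sum => k _; rewrite cmodM cmodC ger0_norm//.
by rewrite invr_ge0 mulr_ge0// ltW// mono_sqnorm_gt0.
Qed.

(** The operator bound is read on polynomials with nonnegative coefficients; the factor c^2 in the
    constant undoes the c^-1 of the kernel. *)
Lemma bounded_matrix : bounded_on_bergman mu (cesaro_op omega) ->
  exists M : R, forall (a : nat -> R) P K, (forall k, 0 <= a k) -> (forall k, (K <= k)%N -> a k = 0) ->
  \sum_(N < P) m N * (om N * \sum_(k < N.+1) a k * ((N - k).+1%:R * om (N - k).*2.+1)^-1) ^+ 2
    <= M * \sum_(k < K) m k * a k ^+ 2.
Proof.
move=> [M hM]; exists (M ^+ 2 * c ^+ 2) => a P K a0 aK.
pose ac k : R[i] := (a k)%:C%C.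
pose f (z : R[i]) := \sum_(k < K) ac k * z ^+ k.
have hf z : cmod z < 1 -> is_pser ac z (f z).
  move=> _ e e0; exists K => N KN; rewrite -!(big_mkord xpredT (fun k => ac k * z ^+ k)) (big_cat_nat (leq0n K) KN)/=.
  rewrite /f big_mkord [X in _ + X - _]big_nat [X in _ + X - _]big1 ?addr0 ?subrr ?cmod0// => k /andP[Kk _].
  by rewrite /ac aK// mul0r.
pose S := \sum_(k < K) mono_sqnorm c mu k * a k ^+ 2.
have S0 k : 0 <= mono_sqnorm c mu k * a k ^+ 2.
  by apply: mulr_ge0; [exact/ltW/mono_sqnorm_gt0|exact: sqr_ge0].
have hS N : \sum_(n < N) mono_sqnorm c mu n * cmod (ac n) ^+ 2 <= S.
  have -> : \sum_(n < N) mono_sqnorm c mu n * cmod (ac n) ^+ 2 = \sum_(n < N) mono_sqnorm c mu n * a n ^+ 2.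
    by apply: eq_bigr => n _; rewrite cmodC ger0_norm.
  apply: (@le_trans _ _ (\sum_(n < maxn N K) mono_sqnorm c mu n * a n ^+ 2)).
    by apply: (nneg_sum_leq (u := fun n => mono_sqnorm c mu n * a n ^+ 2)); rewrite ?leq_maxl.
  rewrite -(big_mkord xpredT (fun n => mono_sqnorm c mu n * a n ^+ 2)) (big_cat_nat (leq0n K) (leq_maxr N K))/=.
  rewrite big_mkord [X in _ + X <= _]big_nat [X in _ + X <= _]big1 ?addr0// => k /andP[Kk _].
  by rewrite aK// expr0n mulr0.
have gac : geom_bounded ac 1 by apply: pser_cvg_radius => z /hf; exists (f z).
have fs : bergman_space mu f by apply/(bergman_space_pserP c0 radial _ hmu); exists ac, S.
have [Ts hT] := hM _ fs.
have fS : fine (bergman_sqnorm mu f) <= S.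
  by rewrite -lee_fin sqnorm_fineK//; apply/(sqnorm_leP c0 radial _ hmu hf).
have n0 : 0 <= fine (bergman_sqnorm mu f) by rewrite fine_ge0// sqnorm_ge0.
have T0 : 0 <= fine (bergman_sqnorm mu (cesaro_op omega f)) by rewrite fine_ge0// sqnorm_ge0.
have TS : fine (bergman_sqnorm mu (cesaro_op omega f)) <= M ^+ 2 * S.
  apply: (@le_trans _ _ (M ^+ 2 * fine (bergman_sqnorm mu f))); last by rewrite ler_wpM2l// sqr_ge0.
  rewrite -(sqr_sqrtr T0) -(sqr_sqrtr n0) -exprMn.
  by rewrite lerXn2r ?nnegrE ?sqrtr_ge0// (le_trans (sqrtr_ge0 _) hT).
have hTf (z : R[i]) : cmod z < 1 -> is_pser (cesaro_coef c omega ac) z (cesaro_op omega f z).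
  by move=> z1; apply: cesaro_pser.
have hP := (sqnorm_leP c0 radial (fine (bergman_sqnorm mu (cesaro_op omega f))) hmu hTf).1 _ P.
rewrite sqnorm_fineK// lexx in hP; have {}hP := le_trans (hP isT) TS.
have cc : 0 < c^-1 by rewrite invr_gt0.
rewrite -(ler_pM2l cc) mulr_sumr.
apply: (@le_trans _ _ (M ^+ 2 * S)).
  apply: le_trans hP; rewrite le_eqVlt; apply/orP; left; apply/eqP; apply: eq_bigr => N _.
  rewrite cesaro_coefE cmodC real_normK ?num_real// /mono_sqnorm -/(m N) [in RHS]exprMn expr2.
  by field; rewrite gt_eqF.
rewrite le_eqVlt; apply/orP; left; apply/eqP; rewrite /S /mono_sqnorm.
rewrite [X in _ * X = _](eq_bigr (fun k : 'I_K => c * (m k * a k ^+ 2))); last by move=> k _; rewrite mulrA.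
by rewrite -mulr_sumr; field; rewrite gt_eqF.
Qed.

(** Applied to the moduli |a_k|, the inequality bounds every partial sum of the squared norm of the
    image, which also places the image in the space. *)
Lemma matrix_bounded (M : R) :
  (forall (a : nat -> R) P, \sum_(N < P) m N * (om N * \sum_(k < N.+1) a k * ((N - k).+1%:R * om (N - k).*2.+1)^-1) ^+ 2
    <= M * \sum_(k < P) m k * a k ^+ 2) -> bounded_on_bergman mu (cesaro_op omega).
Proof.
move=> hM; pose M' := c^-1 ^+ 2 * `|M|.
have M0 : 0 <= M' by apply: mulr_ge0; [exact: sqr_ge0|exact: normr_ge0].
exists (Num.sqrt M') => f fs; have [af foo] := fs; have [a ga ha] := taylor af.
have hTf (z : R[i]) : cmod z < 1 -> is_pser (cesaro_coef c omega a) z (cesaro_op omega f z).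
  by move=> z1; apply: cesaro_pser.
set F := fine (bergman_sqnorm mu f).
have hF N : \sum_(n < N) mono_sqnorm c mu n * cmod (a n) ^+ 2 <= F.
  by apply: (sqnorm_leP c0 radial F hmu ha).1; rewrite sqnorm_fineK.
have key P : \sum_(N < P) mono_sqnorm c mu N * cmod (cesaro_coef c omega a N) ^+ 2 <= M' * F.
  have h1 := hM (fun k => cmod (a k)) P.
  apply: (@le_trans _ _ (\sum_(N < P) (c * c^-1 ^+ 2) * (m N * (om N * \sum_(k < N.+1) cmod (a k) * ((N - k).+1%:R * om (N - k).*2.+1)^-1) ^+ 2))).
    apply: ler_sum => N _; have h2 := cmod_cesaro_coef_le a N.
    have h3 := lerXn2r 2 (cmod_ge0 _) (le_trans (cmod_ge0 _) h2) h2.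
    have := ler_wpM2l (ltW (mono_sqnorm_gt0 c0 N hmu)) h3; rewrite exprMn => /le_trans; apply.
    by rewrite /mono_sqnorm -/(m N) le_eqVlt; apply/orP; left; apply/eqP; ring.
  have cc : 0 <= c * c^-1 ^+ 2 by apply: mulr_ge0; [exact: ltW|exact: sqr_ge0].
  rewrite -mulr_sumr; apply: le_trans (ler_wpM2l cc h1) _.
  have q0 : 0 <= \sum_(k < P) m k * cmod (a k) ^+ 2.
    by apply: sumr_ge0 => k _; apply: mulr_ge0; [exact/ltW|exact: sqr_ge0].
  apply: le_trans (ler_wpM2l cc (ler_wpM2r q0 (ler_norm M))) _.
  apply: le_trans (ler_wpM2l M0 (hF P)).
  rewrite le_eqVlt; apply/orP; left; apply/eqP; rewrite /M' /mono_sqnorm.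
  rewrite [X in _ = _ * X](eq_bigr (fun k : 'I_P => c * (m k * cmod (a k) ^+ 2))); last by move=> k _; rewrite mulrA.
  by rewrite -mulr_sumr; ring.
have Ts : bergman_space mu (cesaro_op omega f).
  apply/(bergman_space_pserP c0 radial _ hmu); exists (cesaro_coef c omega a), (M' * F); split=> //.
  by apply: pser_cvg_radius => z /hTf; exists (cesaro_op omega f z).
split=> //; rewrite /bergman_norm -/F -sqrtrM// ler_wsqrtr//.
by rewrite -lee_fin sqnorm_fineK//; apply/(sqnorm_leP c0 radial _ hmu hTf).
Qed.

Lemma cesaro_bounded_iff : class_D mu -> bounded_on_bergman mu (cesaro_op omega) <-> class_D omega.
Proof.
move=> [mu_hat _]; split=> [/bounded_matrix[M hM]|hD].
  have [A hA] := Dhat_moment_doubling hmu mu_hat.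
  have A0 : 0 <= A.
    by have := hA 0%N; have := moment_gt0 0 hmu; have := moment_gt0 1 hmu; nra.
  have hmD n : (0 < n)%N -> m n <= A ^+ 4 * m (13 * n)%N.
    (* Four doublings take the exponent 2n+1 to 32n+31, past 26n+1, the exponent in m_(13n). *)
    move=> n0; apply: (@le_trans _ _ (A ^+ 4 * moment mu n.*2.+1.*2.+1.*2.+1.*2.+1.*2.+1)); last first.
      by rewrite ler_wpM2l ?exprn_ge0//; apply: moment_le => //; lia.
    rewrite !exprS mulr1 -!mulrA.
    do 4! (apply: le_trans (hA _) _; apply: ler_wpM2l => //).
  have [B B0 hB] := hardy_bounded_doubling om0 oml m0 ml hmD hM.
  split; first exact: moment_doubling_Dhat B0 hB.
  apply: moment_decay_Dcheck B0 hB _ => // E E0.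
  exact: hardy_bounded_decay om0 oml m0 ml hmD hM E E0.
have [A hA] := Dhat_moment_doubling homega hD.1.
have [L L1 hL] := D_moment_decay homega hD.
have [B hB] := log_sum_bounded om0 oml hA L1 hL.
have [M hM] := hardy_bounded om0 oml (fun n => ltW (m0 n)) ml hA hB.
exact: matrix_bounded hM.
Qed.

End boundedness.

Theorem theorem2 (R : realType) (mu omega : R -> R)
  (mu_weight : radial_weight mu) (omega_weight : radial_weight omega)
  (mu_D : class_D mu) :
  bounded_on_bergman mu (cesaro_op omega) <-> class_D omega.
Proof.
have [c c0 radial] := @radial_integral R.
exact: cesaro_bounded_iff c0 radial _ _ mu_weight omega_weight mu_D.
Qed.
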